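(* Let $\alpha,\beta>-1$ and write all semi-infinite matrices with indices starting at $1$, in the basis $\{\tilde P_{n-1}^{(\alpha,\beta)}\}_{n\ge1}$ of orthonormal Jacobi polynomials (equivalently, of weighted normalized Jacobi polynomials $\{\hat P_{n-1}^{(\alpha,\beta)}\}_{n\ge 1}$). 1. Multiplication by $1+x$ is the symmetric tridiagonal matrix $\mathcal{M}_1$ with $(\mathcal{M}_1)_{n,n}=a_n$, $(\mathcal{M}_1)_{n,n+1}=(\mathcal{M}_1)_{n+1,n}=b_n$, where $$a_n = \dfrac{2n(2n-2)+(4n+2\beta-2)(\alpha+\beta)}{(2n+\alpha+\beta)(2n+\alpha+\beta-2)},\qquad b_n = 2\sqrt{\dfrac{n(n+\alpha)(n+\beta)(n+\alpha+\beta)}{(2n+\alpha+\beta-1)(2n+\alpha+\beta)^2(2n+\alpha+\beta+1)}}.$$ 2. Multiplication by $1-x$ is the symmetric tridiagonal matrix $\mathcal{M}_2$ with $(\mathcal{M}_2)_{n,n}=c_n$, $(\mathcal{M}_2)_{n,n+1}=(\mathcal{M}_2)_{n+1,n}=d_n$, where $$c_n = \dfrac{2n(2n-2)+(4n+2\alpha-2)(\alpha+\beta)}{(2n+\alpha+\beta)(2n+\alpha+\beta-2)},\qquad d_n = -2\sqrt{\dfrac{n(n+\alpha)(n+\beta)(n+\alpha+\beta)}{(2n+\alpha+\beta-1)(2n+\alpha+\beta)^2(2n+\alpha+\beta+1)}}.$$ 3. Moreover, the multiplication operators $\mathcal{M}=\mathcal{M}_1\mathcal{M}_2$ (by $1-x^2$),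 $\mathcal{M}^+=\mathcal{M}_1^2$ (by $(1+x)^2$) and $\mathcal{M}^-=\mathcal{M}_2^2$ (by $(1-x)^2$) can all be computed to high component-wise relative accuracy by symmetric tridiagonal operator multiplication. Similarly, the multiplication operator $\mathcal{S}$ defined in the context is the sum of three symmetric pentadiagonal operators. 4. The entries of the Cholesky factor $\mathcal{R}$ of $\mathcal{M}=\mathcal{R}^\top\mathcal{R}$ satisfy the pentadiagonal Cholesky recurrence $\mathcal{M}_{n,n}=e_n^2+f_{n-1}^2+g_{n-2}^2$, $\mathcal{M}_{n,n+1}=e_nf_n+f_{n-1}g_{n-1}$, $\mathcal{M}_{n,n+2}=e_ng_n$ (with $f_0=g_0=g_{-1}=0$), and the products $\mathcal{R}\mathcal{R}^\top$ and $\mathcal{R}\mathcal{D}\mathcal{R}^\top$ are the products of banded matrices. The Cholesky factor is particularly nice: $\mathcal{R}$ is upper triangular with only possibly nonzero entries $\mathcal{R}_{n,n}=e_n$, $\mathcal{R}_{n,n+1}=f_n$, $\mathcal{R}_{n,n+2}=g_n$, where $$e_n = 2\sqrt{\dfrac{(n+\alpha)(n+\beta)(n+\alpha+\beta)(n+\alpha+\beta+1)}{(2n+\alpha+\beta-1)(2n+\alpha+\beta)^2(2n+\alpha+\beta+1)}},$$ $$f_n = \dfrac{2(\alpha-\beta)\sqrt{n(n+\alpha+\beta+1)}}{(2n+\alpha+\beta)(2n+\alpha+\beta+2)},$$ $$g_n = -2\sqrt{\dfrac{n(n+1)(n+\alpha+1)(n+\beta+1)}{(2n+\alpha+\beta+1)(2n+\alpha+\beta+2)^2(2n+\alpha+\beta+3)}}.$$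 The inverse Cholesky factor $\mathcal{R}^{-1}$ is upper triangular and dense (but still rank-structured), and its entries $R^{-1}_{i,j}$ generically satisfy, for $i\ge1$, $j\ge0$, $$e_i R_{i,i+j}^{-1} + f_i R_{i+1,i+j}^{-1} + g_i R_{i+2,i+j}^{-1} = \delta_{0,j}$$ (with $\delta$ the Kronecker delta). In particular, for $n\ge1$, $$R_{n,n}^{-1} = \frac{1}{2}\sqrt{\dfrac{(2n+\alpha+\beta-1)(2n+\alpha+\beta)^2(2n+\alpha+\beta+1)}{(n+\alpha)(n+\beta)(n+\alpha+\beta)(n+\alpha+\beta+1)}},$$ $$R_{n,n+1}^{-1} = \dfrac{\beta-\alpha}{2}\sqrt{\dfrac{n(2n+\alpha+\beta-1)(2n+\alpha+\beta+1)^2(2n+\alpha+\beta+3)}{(n+\alpha)_2(n+\beta)_2(n+\alpha+\beta)_3}},$$ $$R_{n,n+2}^{-1} = \dfrac{1}{8}\sqrt{\dfrac{(n)_2(2n+\alpha+\beta-1)(2n+\alpha+\beta+2)^2(2n+\alpha+\beta+5)}{(n+\alpha)_3(n+\beta)_3(n+\alpha+\beta)_4}}\Big((2n+\alpha+\beta)(2n+\alpha+\beta+4)+3(\alpha-\beta)^2\Big).$$ 5. Finally, the product $\mathcal{R}^{-\top}\mathcal{S}\mathcal{R}^\top = \mathcal{R}\mathcal{S}\mathcal{R}^{-1}$ is symmetric and pentadiagonal; this implies that, to compute it, only the main diagonal and the first two superdiagonals of $\mathcal{R}^{-1}$ are required.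
   Context: $P_n^{(\alpha,\beta)}$ denotes the Jacobi polynomial, orthogonal with respect to $(1-x)^\alpha(1+x)^\beta\,dx$ on $[-1,1]$ with standard normalization; $\tilde P_n^{(\alpha,\beta)}=\sqrt{\frac{(2n+\alpha+\beta+1)\Gamma(n+\alpha+\beta+1)\,n!}{2^{\alpha+\beta+1}\Gamma(n+\alpha+1)\Gamma(n+\beta+1)}}\,P_n^{(\alpha,\beta)}$ are the orthonormal Jacobi polynomials, and $\hat P_n^{(\alpha,\beta)}(x)=(1-x)^{\alpha/2}(1+x)^{\beta/2}\tilde P_n^{(\alpha,\beta)}(x)$ are the weighted normalized Jacobi polynomials, orthonormal in $L^2([-1,1],dx)$. The matrix of multiplication by a polynomial $p(x)$ has $(i,j)$ entry $\int_{-1}^1 p(x)\hat P_{i-1}^{(\alpha,\beta)}(x)\hat P_{j-1}^{(\alpha,\beta)}(x)\,dx$, $i,j\ge1$. $\mathcal{D}$ is the diagonal scaling of the basis function of degree $n$ by $n(n+\alpha+\beta+1)$, $n\ge0$, i.e. $\mathcal{D}_{n,n}=(n-1)(n+\alpha+\beta)$ for $n\ge1$. For target parameters $\gamma,\delta>-1$ (from the connection problem expanding $\hat P_n^{(\gamma,\delta)}$ in $\hat P_\ell^{(\alpha,\beta)}$), $$\mathcal{S}=\left[\left(\tfrac{\gamma}{2}\right)^2-\left(\tfrac{\alpha}{2}\right)^2\right]\mathcal{M}^+ + \left[\left(\tfrac{\delta}{2}\right)^2-\left(\tfrac{\beta}{2}\right)^2\right]\mathcal{M}^--\left(\tfrac{\gamma\delta+\gamma+\delta-\alpha\beta-\alpha-\beta}{2}\right)\mathcal{M}.$$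 The Cholesky factor $\mathcal{R}$ of the symmetric positive-definite matrix $\mathcal{M}$ is the upper triangular matrix with positive diagonal such that $\mathcal{M}=\mathcal{R}^\top\mathcal{R}$; $\mathcal{R}^{-1}$ is its upper triangular inverse and $\mathcal{R}^{-\top}=(\mathcal{R}^{-1})^\top$. Pentadiagonal means that entries $(i,j)$ with $|i-j|>2$ vanish. ''High component-wise relative accuracy'' means that, in floating-point arithmetic, each individual entry is obtained with small relative error. ''Dense'' means not banded, and ''rank-structured'' is used in the usual sense that blocks taken from the upper triangular part have low rank. $(x)_k=x(x+1)\cdots(x+k-1)$ is the Pochhammer symbol. At parameter values where a formula is formally $0/0$ (only for $n=1$ with $\alpha+\beta=0$ or $\alpha+\beta=-1$), common factors are cancelled, i.e. the value is taken by continuity.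
   Formalization: Floating-point M1*M2 can lose all relative accuracy in first off-diagonal entries for large n; the bound there is C*i*j*u, and a bound C*u uniform in the indices is proved for M computed as I - X^2 (X: multiplication by x). C depends on alpha, beta. *)

(* Defs.v *)
From HB Require Import structures.
From mathcomp Require Import all_boot all_order all_algebra.
From mathcomp Require Import all_classical all_reals all_analysis.

Set Implicit Arguments.
Unset Strict Implicit.
Unset Printing Implicit Defensive.

Import Order.TTheory GRing.Theory Num.Theory.
Import numFieldNormedType.Exports.

Local Open Scope classical_set_scope.
Local Open Scope ring_scope.

Definition pochhammer (R : realType) (x : R) (k : nat) : R :=
  \prod_(i < k) (x + i%:R).

(* Euler's integral; only used at x > 0. *)
Definition Gamma (R : realType) (x : R) : R :=
  \int[lebesgue_measure]_(t in `]0, +oo[) (t `^ (x - 1) * expR (- t)).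

Definition jacobi_weight (R : realType) (alpha beta x : R) : R :=
  (1 - x) `^ alpha * (1 + x) `^ beta.

(* P_n^(alpha,beta) is the polynomial of degree n ([size] is degree + 1)
   orthogonal to the other ones with P_n(1) = (alpha+1)_n / n!; these
   conditions determine the family. *)
Definition is_jacobi (R : realType) (alpha beta : R) (P : nat -> {poly R}) :
    Prop :=
  [/\ forall n, size (P n) = n.+1,
      forall m n, m <> n ->
        \int[lebesgue_measure]_(x in `[-1, 1])
          ((P m).[x] * (P n).[x] * jacobi_weight alpha beta x) = 0
    & forall n, (P n).[1] = pochhammer (alpha + 1) n / n`!%:R].

(* For n = 0 the product (2n + alpha + beta + 1) Gamma(n + alpha + beta + 1) is
   written Gamma(alpha + beta + 2): this is its value when Gamma is continued
   to ]-1, 0[, and its limit at alpha + beta = -1. *)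
Definition jacobi_factor (R : realType) (alpha beta : R) (n : nat) : R :=
  (if n == 0%N then Gamma (alpha + beta + 2)
   else (2 * n%:R + alpha + beta + 1) * Gamma (n%:R + alpha + beta + 1))
  * n`!%:R
  / (2 `^ (alpha + beta + 1) * Gamma (n%:R + alpha + 1)
     * Gamma (n%:R + beta + 1)).

Definition jacobi_tilde (R : realType) (alpha beta : R) (P : nat -> {poly R})
    (n : nat) (x : R) : R :=
  Num.sqrt (jacobi_factor alpha beta n) * (P n).[x].

Definition jacobi_hat (R : realType) (alpha beta : R) (P : nat -> {poly R})
    (n : nat) (x : R) : R :=
  (1 - x) `^ (alpha / 2) * (1 + x) `^ (beta / 2)
  * jacobi_tilde alpha beta P n x.

(* Rows and columns are numbered from 1: only the entries A i j with
   0 < i and 0 < j are meaningful. *)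
Definition smx (R : realType) := nat -> nat -> R.

Definition smx_eq (R : realType) (A B : smx R) : Prop :=
  forall i j : nat, (0 < i)%N -> (0 < j)%N -> A i j = B i j.

Definition smx_id (R : realType) : smx R := fun i j => (i == j)%:R.

Definition smx_tr (R : realType) (A : smx R) : smx R := fun i j => A j i.

Definition smx_mul (R : realType) (A B : smx R) : smx R := fun i j =>
  limn (fun N : nat => \sum_(1 <= k < N) A i k * B k j).

Definition smx_tridiag (R : realType) (diag off : nat -> R) : smx R :=
  fun i j => if j == i then diag i
             else if j == i.+1 then off i
             else if i == j.+1 then off j
             else 0.

Definition smx_sym (R : realType) (A : smx R) : Prop := smx_eq (smx_tr A) A.

Definition smx_bandwidth (R : realType) (w : nat) (A : smx R) : Prop :=
  forall i j : nat, (0 < i)%N -> (0 < j)%N ->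
    (i + w < j)%N || (j + w < i)%N -> A i j = 0.

Definition smx_pentadiag (R : realType) (A : smx R) : Prop :=
  smx_bandwidth 2 A.

Definition smx_banded (R : realType) (A : smx R) : Prop :=
  exists w : nat, smx_bandwidth w A.

Definition smx_upper (R : realType) (A : smx R) : Prop :=
  forall i j : nat, (0 < j)%N -> (j < i)%N -> A i j = 0.

(* Every finite block lying in the upper triangular part i <= j has rank at
   most r. *)
Definition smx_rank_structured (R : realType) (r : nat) (A : smx R) : Prop :=
  forall i0 j0 p q : nat, (0 < i0)%N -> (i0 + p <= j0.+1)%N ->
    (\rank (\matrix_(k < p, l < q) A (i0 + k)%N (j0 + l)%N) <= r)%N.

Definition is_cholesky (R : realType) (M Rc : smx R) : Prop :=
  [/\ smx_upper Rc,
      forall i : nat, (0 < i)%N -> 0 < Rc i i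
    & smx_eq (smx_mul (smx_tr Rc) Rc) M].

Definition is_upper_inverse (R : realType) (Rc Ri : smx R) : Prop :=
  [/\ smx_upper Ri,
      smx_eq (smx_mul Rc Ri) (@smx_id R)
    & smx_eq (smx_mul Ri Rc) (@smx_id R)].

Definition mulmat (R : realType) (alpha beta : R) (P : nat -> {poly R})
    (p : {poly R}) : smx R := fun i j =>
  \int[lebesgue_measure]_(x in `[-1, 1])
    (p.[x] * jacobi_hat alpha beta P i.-1 x * jacobi_hat alpha beta P j.-1 x).

Definition S_coef_plus (R : realType) (alpha gamma : R) : R :=
  (gamma / 2) ^+ 2 - (alpha / 2) ^+ 2.

Definition S_coef_minus (R : realType) (beta delta : R) : R :=
  (delta / 2) ^+ 2 - (beta / 2) ^+ 2.

Definition S_coef_mid (R : realType) (alpha beta gamma delta : R) : R :=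
  - ((gamma * delta + gamma + delta - alpha * beta - alpha - beta) / 2).

Definition smx_scale (R : realType) (c : R) (A : smx R) : smx R :=
  fun i j => c * A i j.

Definition S_mat (R : realType) (alpha beta gamma delta : R)
    (Mplus Mminus M : smx R) : smx R := fun i j =>
  smx_scale (S_coef_plus alpha gamma) Mplus i j
  + smx_scale (S_coef_minus beta delta) Mminus i j
  + smx_scale (S_coef_mid alpha beta gamma delta) M i j.

Definition D_mat (R : realType) (alpha beta : R) : smx R := fun i j =>
  if i == j then (i%:R - 1) * (i%:R + alpha + beta) else 0.

(* With s = alpha + beta, the factors 2n+s-2 and 2n+s-1 of the denominators
   can vanish for n = 1 only, where they equal s and s+1 and cancel against
   the numerator. The branches n = 1 below are the cancelled forms. *)

Definition jac_a (R : realType) (alpha beta : R) (n : nat) : R :=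
  let s := alpha + beta in let x : R := n%:R in
  if n == 1%N then (2 + 2 * beta) / (2 + s)
  else (2 * x * (2 * x - 2) + (4 * x + 2 * beta - 2) * s)
       / ((2 * x + s) * (2 * x + s - 2)).

Definition jac_c (R : realType) (alpha beta : R) (n : nat) : R :=
  let s := alpha + beta in let x : R := n%:R in
  if n == 1%N then (2 + 2 * alpha) / (2 + s)
  else (2 * x * (2 * x - 2) + (4 * x + 2 * alpha - 2) * s)
       / ((2 * x + s) * (2 * x + s - 2)).

Definition jac_b (R : realType) (alpha beta : R) (n : nat) : R :=
  let s := alpha + beta in let x : R := n%:R in
  2 * Num.sqrt
    (if n == 1%N then
       (1 + alpha) * (1 + beta) / ((2 + s) ^+ 2 * (3 + s))
     else
       x * (x + alpha) * (x + beta) * (x + s)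
       / ((2 * x + s - 1) * (2 * x + s) ^+ 2 * (2 * x + s + 1))).

Definition jac_d (R : realType) (alpha beta : R) (n : nat) : R :=
  let s := alpha + beta in let x : R := n%:R in
  - 2 * Num.sqrt
    (if n == 1%N then
       (1 + alpha) * (1 + beta) / ((2 + s) ^+ 2 * (3 + s))
     else
       x * (x + alpha) * (x + beta) * (x + s)
       / ((2 * x + s - 1) * (2 * x + s) ^+ 2 * (2 * x + s + 1))).

Definition jac_e (R : realType) (alpha beta : R) (n : nat) : R :=
  let s := alpha + beta in let x : R := n%:R in
  2 * Num.sqrt
    (if n == 1%N then
       (1 + alpha) * (1 + beta) * (2 + s) / ((2 + s) ^+ 2 * (3 + s))
     else
       (x + alpha) * (x + beta) * (x + s) * (x + s + 1)
       / ((2 * x + s - 1) * (2 * x + s) ^+ 2 * (2 * x + s + 1))).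

(* The conventions f_0 = g_0 = 0 are built in; g_{-1} = 0 then follows when the
   index n - 2 is computed with the truncated subtraction of nat. *)
Definition jac_f (R : realType) (alpha beta : R) (n : nat) : R :=
  let s := alpha + beta in let x : R := n%:R in
  if n == 0%N then 0
  else 2 * (alpha - beta) * Num.sqrt (x * (x + s + 1))
       / ((2 * x + s) * (2 * x + s + 2)).

Definition jac_g (R : realType) (alpha beta : R) (n : nat) : R :=
  let s := alpha + beta in let x : R := n%:R in
  if n == 0%N then 0
  else - 2 * Num.sqrt
    (x * (x + 1) * (x + alpha + 1) * (x + beta + 1)
     / ((2 * x + s + 1) * (2 * x + s + 2) ^+ 2 * (2 * x + s + 3))).

Definition jac_inv0 (R : realType) (alpha beta : R) (n : nat) : R :=
  let s := alpha + beta in let x : R := n%:R in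
  1 / 2 * Num.sqrt
    (if n == 1%N then
       (2 + s) ^+ 2 * (3 + s) / ((1 + alpha) * (1 + beta) * (2 + s))
     else
       (2 * x + s - 1) * (2 * x + s) ^+ 2 * (2 * x + s + 1)
       / ((x + alpha) * (x + beta) * (x + s) * (x + s + 1))).

(* For n = 1, (n+s)_(k+1) = (1+s) (2+s)_k. *)
Definition jac_inv1 (R : realType) (alpha beta : R) (n : nat) : R :=
  let s := alpha + beta in let x : R := n%:R in
  (beta - alpha) / 2 * Num.sqrt
    (if n == 1%N then
       (3 + s) ^+ 2 * (5 + s)
       / (pochhammer (1 + alpha) 2 * pochhammer (1 + beta) 2
          * pochhammer (2 + s) 2)
     else
       x * (2 * x + s - 1) * (2 * x + s + 1) ^+ 2 * (2 * x + s + 3)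
       / (pochhammer (x + alpha) 2 * pochhammer (x + beta) 2
          * pochhammer (x + s) 3)).

Definition jac_inv2 (R : realType) (alpha beta : R) (n : nat) : R :=
  let s := alpha + beta in let x : R := n%:R in
  1 / 8 * Num.sqrt
    (if n == 1%N then
       pochhammer 1 2 * (4 + s) ^+ 2 * (7 + s)
       / (pochhammer (1 + alpha) 3 * pochhammer (1 + beta) 3
          * pochhammer (2 + s) 3)
     else
       pochhammer x 2 * (2 * x + s - 1) * (2 * x + s + 2) ^+ 2
       * (2 * x + s + 5)
       / (pochhammer (x + alpha) 3 * pochhammer (x + beta) 3
          * pochhammer (x + s) 4))
  * ((2 * x + s) * (2 * x + s + 4) + 3 * (alpha - beta) ^+ 2).

Definition smx_upper3 (R : realType) (e f g : nat -> R) : smx R := fun i j =>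
  if j == i then e i
  else if j == i.+1 then f i
  else if j == i.+2 then g i
  else 0.

(* Rounding onto a set of floating-point numbers (the range of rnd) that
   contains 1 and is closed under negation, with unit roundoff u and without
   overflow or underflow, as in IEEE round-to-nearest. The computed value of
   x op y is rnd (x op y). *)
Definition is_rounding (R : realType) (u : R) (rnd : R -> R) : Prop :=
  [/\ 0 <= u < 1,
      forall x, `|rnd x - x| <= u * `|x|,
      forall x, rnd (- x) = - rnd x,
      forall x, rnd (rnd x) = rnd x
    & rnd 1 = 1].

(* Computed product of the operators whose entries are the roundings of those
   of A and B. A being tridiagonal, the terms with k > i + 1 vanish and the
   summation stops at k = i + 1. *)
Definition fl_mul (R : realType) (rnd : R -> R) (A B : smx R) : smx R :=
  fun i j =>
    foldl (fun t k => rnd (t + rnd (rnd (A i k) * rnd (B k j)))) 0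
          (iota 1 i.+1).

(* Computed I - A^2. *)
Definition fl_id_sub_sqr (R : realType) (rnd : R -> R) (A : smx R) : smx R :=
  fun i j => rnd (smx_id R i j - fl_mul rnd A A i j).

(* Componentwise relative error of the approximation A' of A; an entry that is
   exactly 0 has to be computed exactly. *)
Definition cw_rel_error_le (R : realType) (eps : nat -> nat -> R)
    (A' A : smx R) : Prop :=
  forall i j : nat, (0 < i)%N -> (0 < j)%N ->
    `|A' i j - A i j| <= eps i j * `|A i j|.

(* Main.v *)
Require Import Defs.
From HB Require Import structures.
From mathcomp Require Import all_boot all_order all_algebra.
From mathcomp Require Import all_classical all_reals all_analysis.
From mathcomp Require Import measurable_realfun ring lra zify.

(* The weight w enters only through the moments of the functional
   L(p) = int p w. Tonelli's theorem gives Gamma a * Gamma b =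
   B(a, b) * Gamma (a + b), from which the functional equation of Gamma, the
   integrability of w and the moments L((1 + x)^j) follow. For the monic
   polynomials q_n defined by the three-term recurrence with coefficients a_n
   and b_n^2 in the variable t = 1 + x, the quantity L(t^j q_n) has a closed
   form, proved by induction from one rational identity. It vanishes for j < n,
   so that P_n is a multiple of q_n, and it gives the norms: multiplication by
   1 + x is the tridiagonal matrix of the a_n and b_n, and the entries of
   M, M+ and M- follow by tridiagonal products. The formulas for R are then
   identities between square roots of rational functions, and R is unique.

   Every column of R^-1 solves the three-term recurrence with coefficients
   e_i, f_i, g_i. Solved for the first term it expresses all rows above row j0
   through two of them, whence the rank bound; solved for the last term it
   shows that a banded R^-1 would have zero diagonal entries. Since M and S are
   multiplication matrices, they commute, so R S R^-1 = R^-T M S R^-1 =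
   R^-T S M R^-1 = R^-T S R^T.

   For the rounding errors, the entries of a tridiagonal product are sums of
   at most three terms. Those of M+ and M- have terms of equal sign. In M the
   diagonal entries are at least e_n^2, which is bounded below, and the entry
   next to the diagonal is b_n (c_{n+1} - a_n), which is either of order n^-2
   or zero; in the latter case the computed terms cancel exactly. *)

Set Implicit Arguments.
Unset Strict Implicit.
Unset Printing Implicit Defensive.

Import Order.TTheory GRing.Theory Num.Theory.
Import numFieldNormedType.Exports.

Local Open Scope classical_set_scope.
Local Open Scope ring_scope.

(** * Gamma and Beta integrals *)

(** The image of Lebesgue measure under [x |-> c * x + d], scaled by [c], agrees with Lebesgue
    measure on half-open intervals; uniqueness of that measure gives the rest. *)
Lemma ge0_integral_affine (R : realType) (c d : R) (h : R -> \bar R) :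
  0 < c -> measurable_fun setT h -> (forall x, (0 <= h x)%E) ->
  (\int[lebesgue_measure]_x h x =
   c%:E * \int[lebesgue_measure]_x h (c * x + d)%R)%E.
Proof.
move=> c0 mh h0.
pose phi : measurableTypeR R -> measurableTypeR R := fun x => c * x + d.
have mphi : measurable_fun setT phi.
  by apply: measurable_funD => //; apply: measurable_funM.
pose nu : {measure set (measurableTypeR R) -> \bar R} :=
  mscale (NngNum (ltW c0)) (pushforward lebesgue_measure phi).
have E A : measurable A -> lebesgue_measure A = nu mphi A.
  apply: lebesgue_measure_unique => _ [[a b] /= _ <-].
  rewrite /nu /mscale /= /pushforward.
  have -> : phi @^-1` `]a, b]%classic = `](a - d) / c, (b - d) / c]%classic.
    apply/seteqP; split => x /=; rewrite !in_itv /= /phi;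
      by rewrite ltr_pdivrMr// ler_pdivlMr// (mulrC x) ltrBlDr lerBrDr.
  rewrite !lebesgue_measure_itv /= !lte_fin ltr_pM2r ?invr_gt0// ltrBlDr subrK.
  case: ifPn => _; last by rewrite mule0.
  rewrite -!EFinB -EFinM; congr EFin.
  by field; rewrite gt_eqF.
transitivity (\int[nu mphi]_x h x)%E.
  by apply: eq_measure_integral => A mA _; exact: E.
rewrite /nu ge0_integral_mscale //=.
rewrite ge0_integral_pushforward //.
Qed.

(** Extended by 0 to the whole line, so that products of densities can be translated and integrated
    over the plane. *)
Definition gamma_density (R : realType) (a t : R) : R :=
  if 0 < t then t `^ (a - 1) * expR (- t) else 0.

Definition beta_density (R : realType) (a b u : R) : R :=
  if (0 < u) && (u < 1) then u `^ (a - 1) * (1 - u) `^ (b - 1) else 0.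

Section GammaBeta.
Variable R : realType.
Implicit Types a b c t u : R.
Local Notation mu := (@lebesgue_measure R).

(** Kept in the extended reals, where Tonelli's theorem applies before finiteness is known. *)
Definition egamma a : \bar R := \int[mu]_t (gamma_density a t)%:E.

Definition ebeta a b : \bar R := \int[mu]_u (beta_density a b u)%:E.

Lemma gamma_density_ge0 a t : 0 <= gamma_density a t.
Proof.
by rewrite /gamma_density; case: ifP => // _; rewrite mulr_ge0 ?powR_ge0 ?expR_ge0.
Qed.

Lemma beta_density_ge0 a b u : 0 <= beta_density a b u.
Proof.
by rewrite /beta_density; case: ifP => // _; rewrite mulr_ge0 ?powR_ge0.
Qed.

Lemma measurable_gamma_density a : measurable_fun setT (gamma_density a).
Proof.
apply: measurable_fun_ifT => //; first exact: measurable_fun_ltr.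
apply: measurable_funM; first exact: measurable_powR.
by apply: measurableT_comp => //; exact: measurable_funN.
Qed.

Lemma measurable_beta_density a b : measurable_fun setT (beta_density a b).
Proof.
apply: measurable_fun_ifT => //.
  by apply: measurable_and; exact: measurable_fun_ltr.
apply: measurable_funM; first exact: measurable_powR.
apply: (@measurableT_comp _ _ _ _ _ _ (fun x : R => x `^ (b - 1))).
  exact: measurable_powR.
exact: measurable_funB.
Qed.

Lemma egamma_ge0 a : (0 <= egamma a)%E.
Proof. by apply: integral_ge0 => t _; rewrite lee_fin gamma_density_ge0. Qed.

Lemma ebeta_ge0 a b : (0 <= ebeta a b)%E.
Proof. by apply: integral_ge0 => t _; rewrite lee_fin beta_density_ge0. Qed.

(** The substitution [s = t * u] turns the convolution into the Beta integral and collects the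
    powers of [t] and the factor [expR (- t)]. *)
Lemma gamma_density_convolution a b t :
  (\int[mu]_s (gamma_density a s * gamma_density b (t - s))%:E =
   ebeta a b * (gamma_density (a + b) t)%:E)%E.
Proof.
have [t0|t0] := ltP 0 t; last first.
  rewrite [gamma_density (a + b) t]ifF ?ltNge ?t0// mule0.
  apply: integral0_eq => s _; congr EFin.
  rewrite /gamma_density; case: ltP => s0; last by rewrite mul0r.
  by rewrite ifF ?mulr0//; apply/negbTE; rewrite -leNgt; lra.
rewrite (@ge0_integral_affine _ t 0)//; last first.
- by move=> s; rewrite lee_fin mulr_ge0 ?gamma_density_ge0.
- apply/measurable_EFinP/measurable_funM; first exact: measurable_gamma_density.
  apply: measurableT_comp; first exact: measurable_gamma_density.
  exact: measurable_funB.
transitivity (t%:E * \int[mu]_u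
    ((t `^ (a - 1) * t `^ (b - 1) * expR (- t))%:E * (beta_density a b u)%:E))%E.
  congr (_ * _)%E; apply: eq_integral => u _; rewrite -EFinM; congr EFin.
  rewrite addr0 /gamma_density /beta_density pmulr_rgt0//.
  have -> : t - t * u = t * (1 - u) by ring.
  rewrite pmulr_rgt0// subr_gt0.
  have [u0|u0] := ltP 0 u; last by rewrite mul0r mulr0.
  have [u1|u1] := ltP u 1; last by rewrite !mulr0.
  rewrite !powRM ?(ltW t0) ?(ltW u0) ?subr_ge0 ?(ltW u1)//.
  have -> : expR (- t) = expR (- (t * u)) * expR (- (t * (1 - u))).
    by rewrite -expRD; congr expR; ring.
  rewrite /=; ring.
rewrite ge0_integralZl_EFin//; last first.
- by rewrite !mulr_ge0 ?powR_ge0 ?expR_ge0.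
- by apply: measurableT_comp => //; exact: measurable_beta_density.
- by move=> u _; rewrite lee_fin beta_density_ge0.
rewrite muleA muleC; congr (_ * _)%E; rewrite -EFinM /gamma_density t0.
congr EFin; rewrite -{1}(powRr1 (ltW t0)) !mulrA; congr (_ * _).
rewrite -!powRD ?(gt_eqF t0) ?implybT//; congr (_ `^ _); ring.
Qed.

(** The double integral of [gamma_density a s * gamma_density b (t - s)] is computed in both orders:
    over [t] first it splits by translation, over [s] first it is a convolution. *)
Lemma egammaM a b : (egamma a * egamma b = ebeta a b * egamma (a + b))%E.
Proof.
have mg c : measurable_fun setT (EFin \o gamma_density c).
  by apply: measurableT_comp => //; exact: measurable_gamma_density.
transitivity (\int[mu]_s \int[mu]_t
    (gamma_density a s * gamma_density b (t - s))%:E)%E.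
  rewrite muleC {2}/egamma -ge0_integralZl ?egamma_ge0//; last first.
  - by move=> s _; rewrite lee_fin gamma_density_ge0.
  - exact: mg.
  apply: eq_integral => s _.
  transitivity (\int[mu]_t
      ((gamma_density a s)%:E * (gamma_density b (t - s))%:E))%E; last first.
    by apply: eq_integral => t _; rewrite EFinM.
  rewrite ge0_integralZl_EFin ?gamma_density_ge0//; last first.
  - apply/measurable_EFinP/measurableT_comp; first exact: measurable_gamma_density.
    exact: measurable_funB.
  - by move=> t _; rewrite lee_fin gamma_density_ge0.
  rewrite muleC; congr (_ * _)%E.
  rewrite /egamma (@ge0_integral_affine _ 1 (- s)) ?ltr01//; last first.
  - by move=> t; rewrite lee_fin gamma_density_ge0.
  - exact: mg.
  by rewrite mul1e; apply: eq_integral => t _; rewrite mul1r.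
rewrite (@fubini_tonelli _ _ _ _ _ mu mu
  (fun z : R * R => (gamma_density a z.1 * gamma_density b (z.2 - z.1))%:E))//=.
- under eq_integral do rewrite gamma_density_convolution.
  rewrite ge0_integralZl ?ebeta_ge0//; last first.
  - by move=> t _; rewrite lee_fin gamma_density_ge0.
  - exact: mg.
- apply/measurable_EFinP/measurable_funM.
    by apply: measurableT_comp => //; exact: measurable_gamma_density.
  apply: measurableT_comp => //; first exact: measurable_gamma_density.
  exact: measurable_funB.
- by move=> z; rewrite lee_fin mulr_ge0 ?gamma_density_ge0.
Qed.
Lemma integral_powR_itv a e : 0 < e -> e < 1 ->
  (\int[mu]_(u in `[e, 1%R]) (a * u `^ (a - 1))%:E = (1 - e `^ a)%:E)%E.
Proof.
move=> e0 e1.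
have dF c x : 0 < x -> derivable (fun y : R => y `^ c) x 1.
  by move=> x0; apply: derivable_powR; rewrite in_itv /= x0.
have cF c x : 0 < x -> {for x, continuous (fun y : R => y `^ c)}.
  by move=> x0; apply: differentiable_continuous; apply/derivable1_diffP/dF.
rewrite (@continuous_FTC2 _ _ (fun x => x `^ a))//.
- by rewrite powR1.
- apply: derivable_within_continuous => x; rewrite in_itv /= => /andP[ex _].
  by apply: derivableM => //; apply: dF; exact: lt_le_trans ex.
- split.
  + by move=> x; rewrite in_itv /= => /andP[ex _]; apply: dF; exact: lt_trans ex.
  + by apply: cvg_at_right_filter; exact: cF.
  + by apply: cvg_at_left_filter; exact: cF.
- move=> x; rewrite in_itv /= => /andP[ex _].
  by rewrite powR_derive1// in_itv /= andbT; exact: lt_trans ex.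
Qed.

(** The integrand may be singular at 0, so the integral is a monotone limit over the intervals
    [[1/(n+2), 1]], each computed by the fundamental theorem of calculus; the shift by 2 keeps the
    left end below 1. *)
Lemma ebeta1r a : 0 < a -> ebeta a 1 = (a^-1)%:E.
Proof.
move=> a0.
suff H : (a%:E * ebeta a 1 = 1)%E.
  have /(congr1 (mule a^-1%:E)) := H.
  by rewrite muleA -EFinM mulVf ?gt_eqF// mul1e mule1.
rewrite /ebeta -ge0_integralZl_EFin ?(ltW a0)//; last first.
- by apply: measurableT_comp => //; exact: measurable_beta_density.
- by move=> u _; rewrite lee_fin beta_density_ge0.
have mp (D : set R) : measurable_fun D (fun u : R => (a * u `^ (a - 1))%:E).
  apply: measurableT_comp => //; apply: measurable_funM => //.
  by apply: measurable_funTS; exact: measurable_powR.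
transitivity (\int[mu]_(u in `]0%R, 1%R[) (a * u `^ (a - 1))%:E)%E.
  rewrite [RHS]integral_mkcond; apply: eq_integral => u _.
  rewrite patchE -EFinM /beta_density mem_setE in_itv /=.
  by case: ifP => _; rewrite ?subrr ?powRr0 ?mulr1 ?mulr0.
rewrite integral_itv_bndo_bndc//.
have -> : `]0%R, 1%R]%classic = \bigcup_n `[(n.+2%:R^-1 : R), 1]%classic.
  apply/seteqP; split => [x /=|x [n _] /=]; rewrite !in_itv /=.
    move=> /andP[x0 x1]; exists (Num.truncn x^-1) => //=.
    rewrite in_itv /= x1 andbT -[leRHS]invrK lef_pV2 ?posrE ?invr_gt0//.
    apply/ltW/(lt_le_trans (truncnS_gt _)).
    by rewrite ler_nat.
  by move=> /andP[nx ->]; rewrite (lt_le_trans _ nx)// invr_gt0.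
pose F n := `[(n.+2%:R^-1 : R), 1]%classic.
pose G := fun u : R => (a * u `^ (a - 1))%:E.
have ndF : nondecreasing_seq F.
  move=> m n mn; rewrite subsetEset => x; rewrite /F /= !in_itv /=.
  move=> /andP[mx ->]; rewrite andbT (le_trans _ mx)// lef_pV2 ?posrE//.
  by rewrite ler_nat !ltnS.
have c1 : (\int[mu]_(x in F n) G x)%E @[n --> \oo] -->
    (\int[mu]_(x in \bigcup_n F n) G x)%E.
  apply: ge0_nondecreasing_set_cvg_integral => //.
  - by move=> n; exact: measurable_itv.
  - by move=> n; exact: mp.
  - by move=> n x _; rewrite lee_fin mulr_ge0 ?(ltW a0) ?powR_ge0.
have c2 : (\int[mu]_(x in F n) G x)%E @[n --> \oo] --> (1%:E : \bar R).
  under eq_fun do rewrite /F /G integral_powR_itv ?invr_gt0 ?invf_lt1 ?ltr1n//.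
  apply: cvg_EFin; first exact: nearW.
  rewrite -[X in _ --> X]subr0; apply: cvgB; first exact: cvg_cst.
  have /cvg_at_rightP h := powR_cvg0 a0.
  apply: (h (fun n => n.+2%:R^-1)); split; first by move=> n; rewrite invr_gt0.
  have := @cvg_harmonic R; rewrite -(@cvg_shiftS _ (@harmonic R)); exact.
exact: cvg_unique c1 c2.
Qed.

(** The integrand is the density of the exponential law of rate 1, which has total mass 1. *)
Lemma egamma1 : egamma (1 : R) = 1%E.
Proof.
rewrite -(@integral_exponential_pdf R 1)// /egamma.
transitivity (\int[mu]_(t in `]0%R, +oo[) (exponential_pdf 1 t)%:E)%E.
  rewrite [RHS]integral_mkcond; apply: eq_integral => t _.
  rewrite patchE mem_setE in_itv /= andbT /gamma_density.
  case: ifP => // t0; rewrite exponential_pdfE ?(ltW t0)//.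
  by rewrite subrr powRr0 !mul1r mulN1r.
rewrite integral_itv_obnd_cbnd; last first.
  apply/measurable_funTS; apply: measurableT_comp => //.
  exact: measurable_exponential_pdf.
rewrite integral_mkcond; apply: eq_integral => t _.
rewrite patchE mem_setE in_itv /= andbT.
by case: leP => // t0; rewrite lt0_exponential_pdf.
Qed.

Lemma egammaS a : 0 < a -> (egamma (a + 1) = a%:E * egamma a)%E.
Proof.
move=> a0; have := egammaM a 1; rewrite egamma1 ebeta1r// mule1 => ->.
by rewrite muleA -EFinM divff ?mul1e// gt_eqF.
Qed.

(** For [t > 1] the power is at least 1, which leaves the integral of [expR (- t)] over this
    half-line, equal to [expR (-1)]. *)
Lemma egamma_ge1_gt0 a : 1 <= a -> (0 < egamma a)%E.
Proof.
move=> a1; apply: (@lt_le_trans _ _ (expR (-1))%:E).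
  by rewrite lte_fin expR_gt0.
have -> : (expR (-1))%:E = (\int[mu]_t ((expR (-1))%:E * (gamma_density 1 t)%:E))%E.
  rewrite ge0_integralZl_EFin ?expR_ge0//; last first.
  - by apply: measurableT_comp => //; exact: measurable_gamma_density.
  - by move=> u _; rewrite lee_fin gamma_density_ge0.
  by rewrite [X in (_ * X)%E]egamma1 mule1.
rewrite /egamma (@ge0_integral_affine _ 1 1 (fun t => (gamma_density a t)%:E))//.
- rewrite mul1e; apply: ge0_le_integral => //.
  + by move=> t _; rewrite -EFinM lee_fin mulr_ge0 ?expR_ge0 ?gamma_density_ge0.
  + apply: measurable_funeM; apply: measurableT_comp => //.
    exact: measurable_gamma_density.
  + apply: measurableT_comp => //; apply: measurableT_comp => //.
      exact: measurable_gamma_density.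
    by apply: measurable_funD => //; exact: measurable_funM.
  + move=> t _; rewrite -EFinM lee_fin mul1r.
    have [t0|t0] := ltP 0 t; last first.
      by rewrite {1}/gamma_density ltNge t0 mulr0 gamma_density_ge0.
    rewrite /gamma_density t0 addr_gt0// subrr powRr0 mul1r -expRD opprD addrC.
    rewrite ler_peMl ?expR_ge0//.
    apply: (@le_trans _ _ (1 `^ (a - 1))); first by rewrite powR1.
    by apply: ge0_ler_powR; rewrite ?nnegrE ?subr_ge0//; lra.
- by apply: measurableT_comp => //; exact: measurable_gamma_density.
- by move=> t; rewrite lee_fin gamma_density_ge0.
Qed.

Lemma egamma_gt0 a : 0 < a -> (0 < egamma a)%E.
Proof.
move=> a0; have := @egamma_ge1_gt0 (a + 1); rewrite egammaS//.
rewrite lerDr (ltW a0) => /(_ isT); apply: contraTT.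
rewrite -!leNgt => H.
have -> : egamma a = 0%E by apply/eqP; rewrite eq_le H egamma_ge0.
by rewrite mule0.
Qed.

Lemma egamma_nat_lty n : (egamma (n.+1%:R : R) < +oo)%E.
Proof.
elim: n => [|n ih]; first by rewrite egamma1 ltry.
rewrite -natr1 egammaS//; apply: lte_mul_pinfty => //.
Qed.

Lemma egamma_lty a : 0 < a -> (egamma a < +oo)%E.
Proof.
move=> a0.
suff H : (egamma (a + 1) < +oo)%E.
  have -> : (egamma a = (a^-1)%:E * egamma (a + 1))%E.
    by rewrite egammaS// muleA -EFinM mulVf ?gt_eqF// mul1e.
  by apply: lte_mul_pinfty => //; rewrite lee_fin invr_ge0 ltW.
(* With [n] the integer part of [a], the power of exponent [a] is at most 1 plus the power of
   exponent [n + 1]; this bounds Gamma at [a + 1] by the sum of its values at 1 and at [n + 2]. *)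
pose n := Num.truncn a.
apply: (@le_lt_trans _ _ (egamma (1 : R) + egamma (n.+2%:R : R))%E); last first.
  by rewrite egamma1 lte_add_pinfty ?ltry// egamma_nat_lty.
have mg c : measurable_fun setT (fun t => (gamma_density c t)%:E).
  by apply: measurableT_comp => //; exact: measurable_gamma_density.
rewrite /egamma -ge0_integralD//; last first.
- exact: mg.
- by move=> u _; rewrite lee_fin gamma_density_ge0.
- exact: mg.
- by move=> u _; rewrite lee_fin gamma_density_ge0.
apply: ge0_le_integral => //.
- by move=> u _; rewrite lee_fin gamma_density_ge0.
- exact: mg.
- by apply: emeasurable_funD; exact: mg.
move=> t _; rewrite -EFinD lee_fin /gamma_density.
case: ifP => [t0|]; last by rewrite addr0.
rewrite -mulrDl ler_wpM2r ?expR_ge0// subrr powRr0 addrK.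
have -> : n.+2%:R - 1 = n.+1%:R :> R by rewrite -[n.+2%:R]natr1 addrK.
have [t1|t1] := leP t 1.
  apply: (@le_trans _ _ 1); last by rewrite lerDl powR_ge0.
  apply: (@le_trans _ _ (1 `^ a)); last by rewrite powR1.
  apply: ge0_ler_powR; rewrite ?nnegrE ?(ltW a0) ?(ltW t0)//.
apply: (@le_trans _ _ (t `^ n.+1%:R)); last by rewrite lerDr.
by apply: ler_powR; [exact: ltW|exact/ltW/truncnS_gt].
Qed.

Lemma GammaE a : Gamma a = fine (egamma a).
Proof.
rewrite /Gamma /Rintegral integral_mkcond; congr fine; apply: eq_integral => t _.
by rewrite patchE mem_setE in_itv /= andbT /gamma_density; case: ifP.
Qed.

Lemma Gamma_fin a : 0 < a -> egamma a = (Gamma a)%:E.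
Proof.
by move=> a0; rewrite GammaE fineK// ge0_fin_numE ?egamma_ge0 ?egamma_lty.
Qed.

Lemma Gamma_gt0 a : 0 < a -> 0 < Gamma a.
Proof. by move=> a0; rewrite -lte_fin -Gamma_fin// egamma_gt0. Qed.

Lemma GammaS a : 0 < a -> Gamma (a + 1) = a * Gamma a.
Proof.
move=> a0; apply: EFin_inj; rewrite EFinM -!Gamma_fin ?addr_gt0//.
exact: egammaS.
Qed.

Lemma ebetaE a b : 0 < a -> 0 < b ->
  ebeta a b = (Gamma a * Gamma b / Gamma (a + b))%:E.
Proof.
move=> a0 b0; have ab0 := addr_gt0 a0 b0; have := egammaM a b.
rewrite !Gamma_fin// -!EFinM => /(congr1 (fun x => x * (Gamma (a + b))^-1%:E)%E).
by rewrite -muleA -!EFinM divff ?mule1// gt_eqF// Gamma_gt0.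
Qed.
End GammaBeta.

(** * Integration against the Jacobi weight, and its moments *)

Section JacobiFunctional.
Variables (R : realType) (alpha beta : R).
Hypotheses (alpha_gt : -1 < alpha) (beta_gt : -1 < beta).
Local Notation mu := (@lebesgue_measure R).
Local Notation w := (jacobi_weight alpha beta).

Lemma jacobi_weight_ge0 x : 0 <= w x.
Proof. by rewrite mulr_ge0 ?powR_ge0. Qed.

Lemma measurable_jacobi_weight : measurable_fun setT w.
Proof.
apply: measurable_funM.
- apply: (@measurableT_comp _ _ _ _ _ _ (fun x : R => x `^ alpha)).
    exact: measurable_powR.
  exact: measurable_funB.
- apply: (@measurableT_comp _ _ _ _ _ _ (fun x : R => x `^ beta)).
    exact: measurable_powR.
  exact: measurable_funD.
Qed.

(** Substituting [x = 2 * u - 1] gives the Beta integral with parameters [beta + 1] and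
    [alpha + 1]. *)
Lemma integral_jacobi_weight :
  (\int[mu]_(x in `[(-1)%R, 1%R]) (w x)%:E =
   (2 `^ (alpha + beta + 1) * (Gamma (alpha + 1) * Gamma (beta + 1)
     / Gamma (alpha + beta + 2)))%:E)%E.
Proof.
move: (alpha_gt) (beta_gt) => ha hb.
have a0 : 0 < alpha + 1 by lra.
have b0 : 0 < beta + 1 by lra.
have mw (D : set R) : measurable_fun D (fun x => (w x)%:E).
  apply: measurable_funTS; apply: measurableT_comp => //.
  exact: measurable_jacobi_weight.
rewrite integral_itv_bndoo; last exact: mw.
rewrite integral_mkcond (@ge0_integral_affine _ 2 (-1)) ?ltr0n//; last first.
- move=> x; rewrite patchE; case: ifP => // _.
  by rewrite lee_fin jacobi_weight_ge0.
- apply/(measurable_restrictT (fun x => (w x)%:E)); [exact: measurable_itv|exact: mw].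
transitivity (2%:E * \int[mu]_x
   ((2 `^ (alpha + beta))%:E * (beta_density (beta + 1) (alpha + 1) x)%:E))%E.
  congr (_ * _)%E; apply: eq_integral => u _.
  rewrite patchE mem_setE in_itv /= /beta_density -EFinM.
  have -> : (-1 < 2 * u - 1) = (0 < u) by apply/idP/idP => ?; lra.
  have -> : (2 * u - 1 < 1) = (u < 1) by apply/idP/idP => ?; lra.
  case: ifP => [/andP[u0 u1]|_]; last by rewrite mulr0.
  rewrite /jacobi_weight.
  have -> : 1 - (2 * u - 1) = 2 * (1 - u) by ring.
  have -> : 1 + (2 * u - 1) = 2 * u by ring.
  rewrite !powRM ?subr_ge0 ?(ltW u0) ?(ltW u1)// !addrK.
  rewrite powRD ?pnatr_eq0 ?implybT//; congr EFin; ring.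
rewrite ge0_integralZl_EFin ?powR_ge0//; last first.
- by apply: measurableT_comp => //; exact: measurable_beta_density.
- by move=> u _; rewrite lee_fin beta_density_ge0.
rewrite -[X in (_ * (_ * X))%E]/(ebeta _ _) ebetaE// -!EFinM; congr EFin.
have -> : beta + 1 + (alpha + 1) = alpha + beta + 2 by ring.
rewrite (@powRD _ _ _ 1) ?pnatr_eq0 ?implybT// powRr1//; ring.
Qed.

Lemma integrable_jacobi_weight :
  mu.-integrable `[-1, 1] (EFin \o w).
Proof.
apply/integrableP; split.
  apply: measurable_funTS; apply: measurableT_comp => //.
  exact: measurable_jacobi_weight.
under eq_integral do rewrite /= ger0_norm ?jacobi_weight_ge0//.
by rewrite integral_jacobi_weight ltry.
Qed.

Lemma measurable_horner (q : {poly R}) : measurable_fun setT (horner q).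
Proof.
elim/poly_ind: q => [|q c ih].
  rewrite (_ : horner 0 = cst 0); first exact: measurable_cst.
  by apply/funext => x; rewrite horner0.
rewrite (_ : horner _ = fun x => q.[x] * x + c).
  by apply: measurable_funD => //; exact: measurable_funM.
by apply/funext => x; rewrite hornerMXaddC.
Qed.

Lemma horner_bound (q : {poly R}) (x : R) : `|x| <= 1 ->
  `|q.[x]| <= \sum_(i < size q) `|q`_i|.
Proof.
move=> x1; rewrite horner_coef; apply: (le_trans (ler_norm_sum _ _ _)).
apply: ler_sum => i _; rewrite normrM normrX ler_piMr//.
by rewrite exprn_ile1.
Qed.

Lemma integrable_horner_weight (q : {poly R}) :
  mu.-integrable `[-1, 1] (EFin \o (fun x => q.[x] * w x)).
Proof.
pose C := \sum_(i < size q) `|q`_i|.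
apply: (@le_integrable _ _ _ mu _ _ _ (fun x => (C%:E * (w x)%:E)%E)) => //.
- apply: measurable_funTS; apply: measurableT_comp => //.
  apply: measurable_funM; first exact: measurable_horner.
  exact: measurable_jacobi_weight.
- move=> x; rewrite /= in_itv /= -ler_norml => x1.
  rewrite lee_fin !normrM ler_wpM2r// (le_trans (horner_bound _ x1))//.
  exact: ler_norm.
- by apply: integrableZl => //; exact: integrable_jacobi_weight.
Qed.

Definition jacobi_functional (q : {poly R}) : R :=
  \int[mu]_(x in `[-1, 1]) (q.[x] * w x).
Local Notation L := jacobi_functional.

Lemma jacobi_functionalD (p q : {poly R}) : L (p + q) = L p + L q.
Proof.
rewrite /L -RintegralD//; [|exact: integrable_horner_weight..].
by apply: eq_Rintegral => x _; rewrite hornerD mulrDl.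
Qed.

Lemma jacobi_functionalZ (c : R) (q : {poly R}) : L (c *: q) = c * L q.
Proof.
rewrite /L -RintegralZl//; last exact: integrable_horner_weight.
by apply: eq_Rintegral => x _; rewrite hornerZ -mulrA.
Qed.

End JacobiFunctional.

Lemma GammaD_nat (R : realType) (a : R) n : 0 < a ->
  Gamma (a + n%:R) = pochhammer a n * Gamma a.
Proof.
move=> a0; elim: n => [|n ih]; first by rewrite addr0 /pochhammer big_ord0 mul1r.
rewrite -natr1 addrA GammaS; last by rewrite ltr_pwDl.
by rewrite ih /pochhammer big_ord_recr /= mulrA [_ * (a + _)]mulrC.
Qed.

(** The factor [(1 + x) ^+ j] is absorbed into the weight, which replaces [beta] by [beta + j]; the
    functional equation of Gamma then produces the Pochhammer symbols. *)
Lemma jacobi_functional_moment (R : realType) (alpha beta : R) j :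
  -1 < alpha -> -1 < beta ->
  jacobi_functional alpha beta ((1 + 'X) ^+ j) =
  2 `^ (alpha + beta + 1) * (Gamma (alpha + 1) * Gamma (beta + 1)
     / Gamma (alpha + beta + 2))
  * 2 ^+ j * pochhammer (beta + 1) j / pochhammer (alpha + beta + 2) j.
Proof.
move=> a1 b1; have bj : -1 < beta + j%:R by rewrite ltr_wpDr.
have a0 : 0 < alpha + 1 by lra.
have b0 : 0 < beta + 1 by lra.
have s0 : 0 < alpha + beta + 2 by lra.
transitivity (\int[lebesgue_measure]_(x in `[(-1 : R), 1])
    jacobi_weight alpha (beta + j%:R) x).
  apply: eq_Rintegral => x; rewrite inE /= in_itv /= => /andP[x1 x2].
  have -> : ((1 + 'X) ^+ j).[x] = (1 + x) ^+ j by rewrite !hornerE.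
  rewrite /jacobi_weight mulrCA; congr (_ * _).
  (* The addition rule for exponents can fail for base 0, so the endpoint [x = -1] is treated apart;
     for positive [j] both sides vanish there. *)
  have [->|x0] := eqVneq (1 + x) 0.
    case: j bj => [|j] bj; first by rewrite addr0 expr0 mul1r.
    rewrite expr0n mul0r powR0// gt_eqF// -natr1 addrA.
    by have : 0 <= (j%:R : R) := ler0n _ _; lra.
  rewrite powRD ?x0 ?implybT// powR_mulrn 1?mulrC//; lra.
rewrite /Rintegral integral_jacobi_weight//=.
have -> : alpha + (beta + j%:R) + 1 = alpha + beta + 1 + j%:R by ring.
have -> : alpha + (beta + j%:R) + 2 = alpha + beta + 2 + j%:R by ring.
have -> : beta + j%:R + 1 = beta + 1 + j%:R by ring.
rewrite powRD ?pnatr_eq0 ?implybT// powR_mulrn//.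
rewrite (GammaD_nat j b0) (GammaD_nat j s0).
have G0 := lt0r_neq0 (Gamma_gt0 s0).
have p0 : pochhammer (alpha + beta + 2) j != 0.
  apply/prodf_neq0 => i _; apply: lt0r_neq0.
  by rewrite ltr_pwDl.
move: (Gamma (alpha + 1)) (Gamma (beta + 1)) (Gamma _) G0 => Ga Gb G G0.
by move: (pochhammer _ j) (pochhammer _ j) p0 => p p' p0; field; rewrite G0 p0.
Qed.

(** * Orthogonal polynomials *)

Lemma pochhammer0 (R : realType) (x : R) : pochhammer x 0 = 1.
Proof. by rewrite /pochhammer big_ord0. Qed.

Lemma pochhammerS (R : realType) (x : R) n :
  pochhammer x n.+1 = pochhammer x n * (x + n%:R).
Proof. by rewrite /pochhammer big_ord_recr. Qed.

Lemma pochhammer_gt0 (R : realType) (x : R) n : 0 < x -> 0 < pochhammer x n.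
Proof. by move=> x0; apply: prodr_gt0 => i _; rewrite ltr_pwDl. Qed.

Section Coefficients.
Variables (R : realType) (alpha beta : R).
Hypotheses (alpha_gt : -1 < alpha) (beta_gt : -1 < beta).
Local Notation s := (alpha + beta).
Local Notation a := (jac_a alpha beta).
Local Notation b := (jac_b alpha beta).

(* [d_i = (2i+s+2)(2i+s+1)/(i+s+1)], the ratio of consecutive values of
   [(i+s+1)_i], with the common factor [s+1] cancelled for [i = 0]. It hides
   the case distinction on [n = 1] in the formulas for [b_n] and [e_n]. *)
Definition jac_ratio (i : nat) : R :=
  if i == 0%N then s + 2
  else (2 * i%:R + s + 2) * (2 * i%:R + s + 1) / (i%:R + s + 1).
Local Notation d := jac_ratio.

Lemma jac_ratioS n :
  d n.+1 = (2 * n%:R + s + 4) * (2 * n%:R + s + 3) / (n%:R + s + 2).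
Proof.
by rewrite /d /= -natr1; congr (_ * _ / _); ring.
Qed.

Lemma jac_ratio_gt0 n : 0 < d n.
Proof.
move: (alpha_gt) (beta_gt) => ha hb.
case: n => [|n]; first by rewrite /d /=; lra.
have n0 := ler0n R n.
by rewrite jac_ratioS divr_gt0 ?mulr_gt0//; lra.
Qed.

(** This form shows the sign of [a n - 1], which is the same for all [n] from 2 on. *)
Lemma jac_aSS n : a n.+2 =
  1 + (beta ^+ 2 - alpha ^+ 2) / ((2 * n%:R + s + 4) * (2 * n%:R + s + 2)).
Proof.
move: (alpha_gt) (beta_gt) => ha hb; have n0 := ler0n R n.
rewrite /jac_a /= -[n.+2]addn2 natrD.
field; apply/andP; split; apply: lt0r_neq0; lra.
Qed.

Lemma jac_b_arg_ge0 n :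
  0 <= n.+1%:R * (n.+1%:R + alpha) * (n.+1%:R + beta)
       / (d n * (2 * n%:R + s + 2) * (2 * n%:R + s + 3)).
Proof.
move: (alpha_gt) (beta_gt) => ha hb; have n0 := ler0n R n.
have d0 := jac_ratio_gt0 n.
by rewrite divr_ge0 ?mulr_ge0 ?(ltW d0) -?natr1//; lra.
Qed.

Lemma jac_bE n : b n.+1 =
  2 * Num.sqrt (n.+1%:R * (n.+1%:R + alpha) * (n.+1%:R + beta)
       / (d n * (2 * n%:R + s + 2) * (2 * n%:R + s + 3))).
Proof.
move: (alpha_gt) (beta_gt) => ha hb.
rewrite /jac_b; congr (_ * Num.sqrt _); case: n => [|n] /=.
  rewrite /d /=; field; apply/andP; split; apply: lt0r_neq0; lra.
have n0 := ler0n R n.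
rewrite jac_ratioS -[n.+2%:R]natr1 -[n.+1%:R]natr1.
by field; do ?[apply/andP; split]; apply: lt0r_neq0; lra.
Qed.

Lemma jac_b_sqr n : b n.+1 ^+ 2 =
  4 * (n.+1%:R * (n.+1%:R + alpha) * (n.+1%:R + beta)
       / (d n * (2 * n%:R + s + 2) * (2 * n%:R + s + 3))).
Proof.
by rewrite jac_bE exprMn sqr_sqrtr ?jac_b_arg_ge0// -natrX.
Qed.

Lemma jac_b_gt0 n : 0 < b n.+1.
Proof.
move: (alpha_gt) (beta_gt) => ha hb; have n0 := ler0n R n.
have d0 := jac_ratio_gt0 n.
rewrite jac_bE mulr_gt0// sqrtr_gt0 divr_gt0 ?mulr_gt0 -?natr1//; lra.
Qed.
End Coefficients.

Section OrthogonalPolynomials.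
Variables (R : realType) (alpha beta : R).
Hypotheses (alpha_gt : -1 < alpha) (beta_gt : -1 < beta).
Local Notation s := (alpha + beta).
Local Notation a := (jac_a alpha beta).
Local Notation b := (jac_b alpha beta).
Local Notation d := (jac_ratio alpha beta).

(* The monic Jacobi polynomials in the variable [t = 1 + x]. *)
Fixpoint monic_jacobi_pair (n : nat) : {poly R} * {poly R} :=
  if n is m.+1 then
    let pq := monic_jacobi_pair m in
    (pq.2, ('X - (a m.+2)%:P) * pq.2 - (b m.+1 ^+ 2) *: pq.1)
  else (1, 'X - (a 1)%:P).

Definition monic_jacobi n := (monic_jacobi_pair n).1.
Local Notation q := monic_jacobi.

Lemma monic_jacobi0 : q 0 = 1. Proof. by []. Qed.

Lemma monic_jacobi1 : q 1 = 'X - (a 1)%:P. Proof. by []. Qed.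

Lemma monic_jacobiSS n :
  q n.+2 = ('X - (a n.+2)%:P) * q n.+1 - (b n.+1 ^+ 2) *: q n.
Proof. by []. Qed.

Lemma size_monic_jacobi n : size (q n) = n.+1 /\ q n \is monic.
Proof.
elim/ltn_ind: n => -[|[|n]] ih.
- by rewrite monic_jacobi0 size_poly1 monic1.
- by rewrite monic_jacobi1 size_XsubC monicXsubC.
have [s1 m1] := ih n.+1 (ltnSn _).
have [s0 m0] := ih n (ltnW (ltnSn _)).
have mm : ('X - (a n.+2)%:P) * q n.+1 \is monic.
  by rewrite monicMl ?monicXsubC.
have sm : size (('X - (a n.+2)%:P) * q n.+1) = n.+3.
  by rewrite size_Mmonic ?monicXsubC ?polyXsubC_eq0 // s1 size_XsubC.
have lt : (size (- (b n.+1 ^+ 2 *: q n)) < n.+3)%N.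
  by rewrite size_polyN (leq_ltn_trans (size_scale_leq _ _))// s0.
split; first by rewrite monic_jacobiSS size_polyDl sm.
by rewrite monicE monic_jacobiSS lead_coefDl ?sm// -monicE.
Qed.

(** The Pochhammer symbol $(n+s+1)_n$, written as a product of the [d i] so that the possibly
    vanishing factor [s + 1] never appears in a denominator. *)
Definition pochD n := \prod_(i < n) d i.

Lemma pochD_gt0 n : 0 < pochD n.
Proof. by apply: prodr_gt0 => i _; exact: jac_ratio_gt0. Qed.

Lemma pochD0 : pochD 0 = 1.
Proof. by rewrite /pochD big_ord0. Qed.

Lemma pochDS n : pochD n.+1 = pochD n * d n.
Proof. by rewrite /pochD big_ord_recr. Qed.

(** The falling factorial of length [n]. At a natural number smaller than [n] it is 0, which is how
    orthogonality shows in the closed form of the moments. *)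
Definition ffR (x : R) n := \prod_(i < n) (x - i%:R).

Lemma ffR0 x : ffR x 0 = 1.
Proof. by rewrite /ffR big_ord0. Qed.

Lemma ffRS x n : ffR x n.+1 = ffR x n * (x - n%:R).
Proof. by rewrite /ffR big_ord_recr. Qed.

Lemma ffRSS x n : ffR (x + 1) n.+1 = (x + 1) * ffR x n.
Proof.
rewrite /ffR big_ord_recl subr0; congr (_ * _); apply: eq_bigr => i _.
by rewrite lift0 -natr1; ring.
Qed.

(* The Saalschutz-type closed form of [int t^j q_n w]. *)
Definition jacobi_moment (mu0 : R) n j :=
  mu0 * 2 ^+ (n + j) * ffR j%:R n * pochhammer (beta + 1) j
  * pochhammer (alpha + 1) n / (pochhammer (s + 2) (j + n) * pochD n).

(** From here on the integral is an abstract linear functional, known only by its values on the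
    powers of the variable [t = 1 + x]. *)
Variables (Lam : {poly R} -> R) (mu0 : R).
Hypothesis mu0_gt0 : 0 < mu0.
Hypothesis LamD : forall p r, Lam (p + r) = Lam p + Lam r.
Hypothesis LamZ : forall c p, Lam (c *: p) = c * Lam p.
Hypothesis LamX : forall j, Lam 'X^j =
  mu0 * 2 ^+ j * pochhammer (beta + 1) j / pochhammer (s + 2) j.

(** Strong induction on [n]: the three-term recurrence reduces the claim to the pairs
    [(n.+1, j.+1)], [(n.+1, j)] and [(n, j)]. Once the common products are named, a rational
    identity in [n], [j], [alpha] and [beta] remains. *)
Lemma Lam_moment n j : Lam ('X^j * q n) = jacobi_moment mu0 n j.
Proof.
move: (alpha_gt) (beta_gt) => ha hb.
have s0 : 0 < s + 2 by lra.
elim/ltn_ind: n j => -[|[|n]] ih j.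
- rewrite monic_jacobi0 mulr1 LamX /jacobi_moment ffR0 pochD0 pochhammer0.
  by rewrite add0n addn0 !mulr1.
- rewrite monic_jacobi1 mulrBr -exprSr LamD -scaleN1r LamZ mulrC.
  rewrite mulrC -[_ * _%:P]mulrC mul_polyC LamZ !LamX /jacobi_moment pochDS pochD0.
  rewrite ffRS ffR0 add1n addn1 !pochhammerS pochhammer0 exprS /jac_a /jac_ratio /=.
  have := pochhammer_gt0 j s0; move: (pochhammer _ j) => p p0.
  have j0 := ler0n R j.
  by field; do ?[apply/andP; split]; apply: lt0r_neq0; lra.
have -> : ('X^j : {poly R}) * q n.+2 = 'X^(j.+1) * q n.+1 + ((- a n.+2) *: ('X^j * q n.+1)
    + (- b n.+1 ^+ 2) *: ('X^j * q n)).
  rewrite monic_jacobiSS (exprSr 'X j) -!mul_polyC !polyCN; ring.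
rewrite !LamD !LamZ !ih// /jacobi_moment !pochDS -[j.+1%:R]natr1 ffRSS !ffRS.
rewrite !addnS !addSn !pochhammerS jac_b_sqr// jac_aSS// jac_ratioS !exprS.
have d0 := jac_ratio_gt0 ha hb n; move: (d n) d0 => dn d0.
have := pochhammer_gt0 (j + n) s0; move: (pochhammer _ (j + n)) => p p0.
have := pochD_gt0 n; move: (pochD n) => D D0.
rewrite -!natr1 natrD.
have j0 := ler0n R j; have n0 := ler0n R n.
move: (j%:R) (n%:R) j0 n0 => x y x0 y0.
by field; do ?[apply/andP; split]; apply: lt0r_neq0; lra.
Qed.

Lemma ffR_nat_small j n : (j < n)%N -> ffR j%:R n = 0.
Proof.
by move=> jn; rewrite /ffR (bigD1 (Ordinal jn)) //= subrr mul0r.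
Qed.

Lemma ffR_natn n : ffR n%:R n = n`!%:R.
Proof.
elim: n => [|n ih]; first by rewrite ffR0.
by rewrite -natr1 ffRSS ih natr1 factS natrM.
Qed.

Lemma jacobi_moment_small n j : (j < n)%N -> jacobi_moment mu0 n j = 0.
Proof.
by move=> jn; rewrite /jacobi_moment ffR_nat_small// mulr0 !mul0r.
Qed.

Definition jacobi_norm2 n := jacobi_moment mu0 n n.
Local Notation h := jacobi_norm2.

Lemma jacobi_norm2E n : h n = mu0 * 4 ^+ n * n`!%:R * pochhammer (beta + 1) n
  * pochhammer (alpha + 1) n / (pochhammer (s + 2) (n + n) * pochD n).
Proof.
by rewrite /h /jacobi_moment ffR_natn exprD -exprMn -natrM.
Qed.

Lemma jacobi_norm2_gt0 n : 0 < h n.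
Proof.
move: (alpha_gt) (beta_gt) => ha hb.
rewrite jacobi_norm2E divr_gt0 ?mulr_gt0 ?exprn_gt0 ?pochD_gt0 ?pochhammer_gt0 ?ltr0n ?fact_gt0//; lra.
Qed.

(** This ratio of squared norms makes the recurrence of the normalized polynomials symmetric. *)
Lemma jacobi_norm2S n : h n.+1 = b n.+1 ^+ 2 * h n.
Proof.
move: (alpha_gt) (beta_gt) => ha hb; have n0 := ler0n R n.
have s0 : 0 < s + 2 by lra.
rewrite !jacobi_norm2E jac_b_sqr// pochDS factS natrM addnS addSn !pochhammerS.
rewrite exprS -[n.+1%:R]natr1 -[(n + n).+1%:R]natr1 natrD.
have d0 := jac_ratio_gt0 ha hb n; move: (d n) d0 => dn d0.
have := pochhammer_gt0 (n + n) s0; move: (pochhammer _ (n + n)) => p p0.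
have := pochD_gt0 n; move: (pochD n) => D D0.
by field; do ?[apply/andP; split]; apply: lt0r_neq0; lra.
Qed.

Lemma Lam0 : Lam 0 = 0.
Proof. by rewrite -(scale0r 0) LamZ mul0r. Qed.

Lemma Lam_sum (I : Type) (r : seq I) (F : I -> {poly R}) :
  Lam (\sum_(i <- r) F i) = \sum_(i <- r) Lam (F i).
Proof. exact: (big_morph _ LamD Lam0). Qed.

Lemma LamB p r : Lam (p - r) = Lam p - Lam r.
Proof. by rewrite LamD -scaleN1r LamZ mulN1r. Qed.

(** All monomials of degree below [n] are annihilated by [q n], so only the coefficient of degree
    [n] contributes. *)
Lemma Lam_mul_monic n (r : {poly R}) : (size r <= n.+1)%N ->
  Lam (r * q n) = r`_n * h n.
Proof.
move=> sr.
have {1}-> : r = \sum_(i < n.+1) r`_i *: 'X^i.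
  rewrite -poly_def; apply/polyP => i; rewrite coef_poly; case: ltnP => // ni.
  by rewrite nth_default// (leq_trans sr).
rewrite mulr_suml Lam_sum big_ord_recr /=.
rewrite -scalerAl LamZ Lam_moment big1 ?add0r// => i _.
by rewrite -scalerAl LamZ Lam_moment jacobi_moment_small ?mulr0.
Qed.

Lemma monic_jacobi_coef n : (q n)`_n = 1.
Proof.
by have [sq /monicP] := size_monic_jacobi n; rewrite lead_coefE sq.
Qed.

Lemma Lam_monic_ortho m n :
  Lam (q m * q n) = if m == n then h n else 0.
Proof.
wlog mn : m n / (m <= n)%N => [H|].
  have [/H //|/ltnW /H nm] := leqP m n.
  by rewrite mulrC nm eq_sym; case: eqP => [->|].
have [sm _] := size_monic_jacobi m.
rewrite Lam_mul_monic ?sm//; case: eqVneq => [->|mn'].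
  by rewrite monic_jacobi_coef mul1r.
by rewrite nth_default ?mul0r// sm ltn_neqAle mn'.
Qed.

(** The point [t = 2] is [x = 1], where the standard normalization of the Jacobi polynomials is
    prescribed. *)
Lemma monic_jacobi_at2 n :
  (q n).[2] = 2 ^+ n * pochhammer (alpha + 1) n / pochD n.
Proof.
move: (alpha_gt) (beta_gt) => ha hb.
elim/ltn_ind: n => -[|[|n]] ih.
- by rewrite monic_jacobi0 hornerC pochD0 pochhammer0 expr0 mul1r divr1.
- rewrite monic_jacobi1 hornerXsubC pochDS pochD0 pochhammerS pochhammer0.
  rewrite /jac_a /jac_ratio /=; field; apply: lt0r_neq0; lra.
rewrite monic_jacobiSS hornerD hornerM hornerXsubC hornerN hornerZ !ih//.
rewrite !pochDS !pochhammerS jac_b_sqr// jac_aSS// jac_ratioS !exprS -!natr1.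
have d0 := jac_ratio_gt0 ha hb n; move: (d n) d0 => dn d0.
have := pochD_gt0 n; move: (pochD n) => D D0.
have n0 := ler0n R n; move: (n%:R) n0 => x x0.
by field; do ?[apply/andP; split]; apply: lt0r_neq0; lra.
Qed.

Section Uniqueness.
Variable P : nat -> {poly R}.
Hypothesis size_P : forall n, size (P n) = n.+1.
Hypothesis ortho_P : forall m n, m <> n -> Lam (P m * P n) = 0.

(** Subtracting a multiple of [P k] removes the coefficient of degree [k] from [r], and
    orthogonality to [P k] keeps the value of [Lam]. *)
Lemma ortho_lower n k (r : {poly R}) : (size r <= k)%N -> (k <= n)%N ->
  Lam (P n * r) = 0.
Proof.
elim: k r => [|k ih] r sr kn.
  move: sr; rewrite leqn0 size_poly_eq0 => /eqP ->.
  by rewrite mulr0 Lam0.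
have lk : (P k)`_k != 0.
  have := lead_coef_eq0 (P k); rewrite lead_coefE size_P /= => ->.
  by rewrite -size_poly_eq0 size_P.
pose c := r`_k / (P k)`_k.
rewrite -(subrK (c *: P k) r) mulrDr LamD -scalerAr LamZ ortho_P; last first.
  by move=> nk; rewrite nk ltnn in kn.
rewrite mulr0 addr0 ih ?(ltnW kn)//; apply/leq_sizeP => j kj.
rewrite coefB coefZ; have [->|jk] := eqVneq j k; first by rewrite /c divfK ?subrr.
have kj' : (k < j)%N by rewrite ltn_neqAle eq_sym jk.
rewrite (nth_default _ (leq_trans sr kj')) sub0r.
by rewrite nth_default ?mulr0 ?oppr0// size_P.
Qed.

(** The difference [r] has degree [m] below [n]. Both [P n] and [q n] are orthogonal to [q m], hence
    so is [r]; but that pairing is the leading coefficient of [r] times [h m > 0]. *)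
Lemma ortho_eq_monic n : P n = (P n)`_n *: q n.
Proof.
pose r := P n - (P n)`_n *: q n.
suff : r = 0 by move/eqP; rewrite subr_eq0 => /eqP.
have [sq _] := size_monic_jacobi n.
have sr : (size r <= n)%N.
  apply/leq_sizeP => j nj; rewrite coefB coefZ.
  have [->|jn] := eqVneq j n; first by rewrite monic_jacobi_coef mulr1 subrr.
  have nj' : (n < j)%N by rewrite ltn_neqAle eq_sym jn.
  have -> : (P n)`_j = 0 by rewrite nth_default ?size_P.
  have -> : (q n)`_j = 0 by rewrite nth_default ?sq.
  by rewrite mulr0 subrr.
apply/eqP; apply: contraT => r0; have := r0.
rewrite -size_poly_gt0 => sr0; set m := (size r).-1.
have mn : (m < n)%N by rewrite /m prednK.
have [sqm _] := size_monic_jacobi m.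
have : Lam (r * q m) = r`_m * h m by rewrite Lam_mul_monic// /m prednK.
rewrite mulrBl LamB (@ortho_lower n n) ?sqm// -scalerAl LamZ Lam_monic_ortho.
rewrite gtn_eqF// mulr0 subrr => /esym/eqP; rewrite mulf_eq0.
by rewrite (gt_eqF (jacobi_norm2_gt0 m)) orbF -lead_coefE lead_coef_eq0 (negbTE r0).
Qed.
End Uniqueness.
End OrthogonalPolynomials.

Lemma powR_half_sqr (R : realType) (y c : R) :
  y `^ (c / 2) * y `^ (c / 2) = y `^ c.
Proof.
by rewrite -expr2 -powR_mulrn ?powR_ge0// -powRrM divfK.
Qed.

Lemma jacobi_hatM (R : realType) (alpha beta : R) P m n x :
  jacobi_hat alpha beta P m x * jacobi_hat alpha beta P n x =
  jacobi_tilde alpha beta P m x * jacobi_tilde alpha beta P n x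
  * jacobi_weight alpha beta x.
Proof.
rewrite /jacobi_hat /jacobi_weight.
by rewrite -(powR_half_sqr (1 - x) alpha) -(powR_half_sqr (1 + x) beta); ring.
Qed.

(** The convention [v 0 = 0] makes the three-term formula valid in row 1 as well, where the left
    neighbour would have index 0. *)
Lemma sum_tridiag (R : realType) (V : lmodType R) (u v : nat -> R)
    (F : nat -> V) i : v 0 = 0 -> (0 < i)%N ->
  \sum_(1 <= k < i.+2) smx_tridiag u v i k *: F k =
  v i.-1 *: F i.-1 + u i *: F i + v i *: F i.+1.
Proof.
move=> v0; case: i => // i _; rewrite big_nat_recr//= big_nat_recr//=.
rewrite /smx_tridiag !eqxx gtn_eqF//; congr (_ + _ + _).
case: i => [|i]; first by rewrite big_geq// v0 scale0r.
rewrite big_nat_recr//= eqxx ltn_eqF// ltn_eqF// big_nat big1 ?add0r//.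
move=> k /andP[_ ki]; do 3 (case: eqP => [|_]; first lia).
by rewrite scale0r.
Qed.

(** * Normalization of the Jacobi polynomials and the tridiagonal recurrence *)

Section JacobiMatrix.
Variables (R : realType) (alpha beta : R) (P : nat -> {poly R}).
Hypotheses (alpha_gt : -1 < alpha) (beta_gt : -1 < beta).
Hypothesis hP : is_jacobi alpha beta P.
Local Notation s := (alpha + beta).
Local Notation a := (jac_a alpha beta).
Local Notation b := (jac_b alpha beta).
Local Notation q := (monic_jacobi alpha beta).
Local Notation D := (pochD alpha beta).

Let mu0 : R := 2 `^ (s + 1) *
  (Gamma (alpha + 1) * Gamma (beta + 1) / Gamma (s + 2)).

(** Polynomials in [t] are integrated after the substitution [t = 1 + x]. *)
Let Lam (r : {poly R}) := jacobi_functional alpha beta (r \Po (1 + 'X)).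

Let LamD p r : Lam (p + r) = Lam p + Lam r.
Proof. by rewrite /Lam comp_polyD jacobi_functionalD. Qed.

Let LamZ (c : R) (p : {poly R}) : Lam (c *: p) = c * Lam p.
Proof. by rewrite /Lam comp_polyZ jacobi_functionalZ. Qed.

Let LamX j : Lam 'X^j =
  mu0 * 2 ^+ j * pochhammer (beta + 1) j / pochhammer (s + 2) j.
Proof. by rewrite /Lam comp_Xn_poly jacobi_functional_moment. Qed.

Let mu0_gt0 : 0 < mu0.
Proof.
move: (alpha_gt) (beta_gt) => ha hb.
rewrite mulr_gt0 ?powR_gt0// divr_gt0 ?mulr_gt0 ?Gamma_gt0//; lra.
Qed.

Local Notation h := (jacobi_norm2 alpha beta mu0).

Let h_gt0 n : 0 < h n. Proof. exact: jacobi_norm2_gt0. Qed.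

Let shiftK (p : {poly R}) : (p \Po ('X - 1)) \Po (1 + 'X) = p.
Proof.
rewrite -comp_polyA comp_polyB comp_polyX -polyC1 comp_polyC.
by rewrite [1%:P + _]addrC addrK comp_polyXr.
Qed.

(** The leading coefficient of the classical Jacobi polynomial of degree [n]. *)
Let lead n : R := D n / (2 ^+ n * n`!%:R).

(** Uniqueness of orthogonal families gives proportionality; the constant comes from comparing the
    values at [t = 2]. *)
Lemma jacobi_shift n : P n \Po ('X - 1) = lead n *: q n.
Proof.
move: (alpha_gt) (beta_gt) => ha hb; have [sP oP eP] := hP.
have sPt m : size (P m \Po ('X - 1)) = m.+1.
  by rewrite size_comp_poly2 ?sP// -polyC1 size_XsubC.
have oPt m k : m <> k -> Lam ((P m \Po ('X - 1)) * (P k \Po ('X - 1))) = 0.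
  move=> mk; rewrite /Lam comp_polyM !shiftK -[RHS](oP _ _ mk).
  by apply: eq_Rintegral => x _; rewrite hornerM.
have := ortho_eq_monic alpha_gt beta_gt mu0_gt0 LamD LamZ LamX sPt oPt n.
set k := _`_n => E; rewrite E; congr (_ *: _).
have := eP n; rewrite -[P n]shiftK E horner_comp hornerD hornerX hornerC.
have -> : (1 + 1 : R) = 2 by ring.
rewrite hornerZ monic_jacobi_at2// /lead.
have p0 : 0 < pochhammer (alpha + 1) n by apply: pochhammer_gt0; lra.
have D0 := pochD_gt0 alpha_gt beta_gt n.
have f0 : (0 : R) < n`!%:R by rewrite ltr0n fact_gt0.
have t0 : (0 : R) < 2 ^+ n by rewrite exprn_gt0.
move: (pochhammer _ n) (D n) (n`!%:R) (2 ^+ n) p0 D0 f0 t0 => p d f t p0 d0 f0 t0.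
move=> /(congr1 (fun z => z * (d / (t * p)))).
have -> : k * (t * p / d) * (d / (t * p)) = k.
  by field; rewrite !lt0r_neq0.
by move=> ->; field; rewrite !lt0r_neq0.
Qed.

(** The factors [s + 2] to [s + n + 1], then [s + n + 2] to [s + 2n + 2], and finally [s + 2n + 3]
    form one unbroken run. *)
Lemma pochD_pochhammer n : (2 * n.+1%:R + s + 1) * pochhammer (s + 2) n * D n.+1
  = pochhammer (s + 2) (n.+1 + n.+1).
Proof.
move: (alpha_gt) (beta_gt) => ha hb; rewrite addSn addnS.
elim: n => [|n ih].
  rewrite pochDS pochD0 !pochhammerS pochhammer0 /jac_ratio /=; ring.
rewrite pochDS jac_ratioS addSn addnS 2![in RHS]pochhammerS -ih pochhammerS.
rewrite -!natr1 natrD.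
have n0 := ler0n R n; field; apply: lt0r_neq0; lra.
Qed.

(** Since [lead n ^+ 2 * h n] is the squared norm of [P n], the normalizing factor has to be its
    inverse. *)
Lemma jacobi_factorE n : jacobi_factor alpha beta n * (lead n ^+ 2 * h n) = 1.
Proof.
move: (alpha_gt) (beta_gt) => ha hb.
have a0 : 0 < alpha + 1 by lra.
have b0 : 0 < beta + 1 by lra.
have s0 : 0 < s + 2 by lra.
rewrite jacobi_norm2E /lead /jacobi_factor /mu0.
have -> : n%:R + alpha + 1 = alpha + 1 + n%:R by ring.
have -> : n%:R + beta + 1 = beta + 1 + n%:R by ring.
rewrite (GammaD_nat n a0) (GammaD_nat n b0).
have ga := Gamma_gt0 a0; have gb := Gamma_gt0 b0; have gs := Gamma_gt0 s0.
have pa := pochhammer_gt0 n a0; have pb := pochhammer_gt0 n b0.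
have D0 := pochD_gt0 alpha_gt beta_gt n.
have f0 : (0 : R) < n`!%:R by rewrite ltr0n fact_gt0.
have t0 : (0 : R) < 2 ^+ n by rewrite exprn_gt0.
have w0 : 0 < 2 `^ (s + 1) :> R by rewrite powR_gt0.
have -> : 4 ^+ n = 2 ^+ n * 2 ^+ n :> R by rewrite -exprMn -natrM.
have ps := pochhammer_gt0 (n + n) s0.
have -> : n%:R + alpha + beta + 1 = n%:R + s + 1 by ring.
have -> : 2 * n%:R + alpha + beta + 1 = 2 * n%:R + s + 1 by ring.
(* A single expression covers both branches, including the exceptional form for [n = 0]. *)
have -> : (if n == 0%N then Gamma (s + 2) else
    (2 * n%:R + s + 1) * Gamma (n%:R + s + 1))
    = pochhammer (s + 2) (n + n) * Gamma (s + 2) / D n.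
  case: n D0 {pa pb f0 t0 ps} => [|n] D0 /=.
    by rewrite pochD0 pochhammer0 mul1r divr1.
  have -> : n.+1%:R + s + 1 = s + 2 + n%:R by rewrite -natr1; ring.
  rewrite (GammaD_nat n s0) -pochD_pochhammer; field; exact: lt0r_neq0.
move: (Gamma (s + 2)) (Gamma (alpha + 1)) (Gamma (beta + 1)) gs ga gb => G Ga Gb gs ga gb.
by field; rewrite !lt0r_neq0.
Qed.

Definition orthonormal_jacobi n : {poly R} := (Num.sqrt (h n))^-1 *: q n.
Local Notation pn := orthonormal_jacobi.

(** Positivity of [lead n] settles the sign when the square root of the squared norm is taken. *)
Lemma jacobi_tildeE n x : jacobi_tilde alpha beta P n x = (pn n).[1 + x].
Proof.
have E := jacobi_factorE n.
have l0 : 0 < lead n.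
  rewrite divr_gt0 ?mulr_gt0 ?exprn_gt0 ?ltr0n ?fact_gt0//.
  exact: pochD_gt0.
have F0 : 0 <= jacobi_factor alpha beta n.
  have -> : jacobi_factor alpha beta n = (lead n ^+ 2 * h n)^-1.
    apply: (@mulIf _ (lead n ^+ 2 * h n)).
      by rewrite lt0r_neq0// mulr_gt0 ?exprn_gt0.
    by rewrite E mulVf// lt0r_neq0// mulr_gt0 ?exprn_gt0.
  by rewrite invr_ge0 ltW// mulr_gt0 ?exprn_gt0.
have Es : Num.sqrt (jacobi_factor alpha beta n) * lead n = (Num.sqrt (h n))^-1.
  apply: (@mulIf _ (Num.sqrt (h n))); first by rewrite lt0r_neq0 ?sqrtr_gt0.
  rewrite mulVf ?lt0r_neq0 ?sqrtr_gt0//.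
  rewrite -[X in _ * X * _](ger0_norm (ltW l0)) -sqrtr_sqr -!sqrtrM ?(mulr_ge0 F0) ?sqr_ge0//.
  by rewrite -mulrA E sqrtr1.
rewrite /jacobi_tilde -[P n]shiftK jacobi_shift horner_comp hornerD hornerX.
by rewrite hornerC !hornerZ mulrA Es.
Qed.

Lemma mulmatE p i j : mulmat alpha beta P p i j =
  Lam ((p \Po ('X - 1)) * (pn i.-1 * pn j.-1)).
Proof.
apply: eq_Rintegral => x _; rewrite -mulrA jacobi_hatM !jacobi_tildeE mulrA.
congr (_ * _); rewrite !comp_polyM !hornerM shiftK !horner_comp.
by rewrite hornerD hornerX hornerC.
Qed.

Lemma mulmat_tilde p i j :
  \int[lebesgue_measure]_(x in `[-1, 1])
    (p.[x] * jacobi_tilde alpha beta P i.-1 x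
     * jacobi_tilde alpha beta P j.-1 x * jacobi_weight alpha beta x)
  = mulmat alpha beta P p i j.
Proof.
by apply: eq_Rintegral => x _; rewrite -[RHS]mulrA jacobi_hatM; ring.
Qed.

Lemma mulmatC p i j : mulmat alpha beta P p i j = mulmat alpha beta P p j i.
Proof. by rewrite !mulmatE [pn i.-1 * _]mulrC. Qed.

Lemma mulmatD p r i j : mulmat alpha beta P (p + r) i j =
  mulmat alpha beta P p i j + mulmat alpha beta P r i j.
Proof. by rewrite !mulmatE comp_polyD mulrDl LamD. Qed.

Lemma mulmatZ c p i j : mulmat alpha beta P (c *: p) i j =
  c * mulmat alpha beta P p i j.
Proof. by rewrite !mulmatE comp_polyZ -scalerAl LamZ. Qed.

Lemma mulmat1 : smx_eq (mulmat alpha beta P 1) (@smx_id R).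
Proof.
move=> [|i] [|j]// _ _; rewrite mulmatE -polyC1 comp_polyC polyC1 mul1r /=.
rewrite -scalerAl -scalerAr !LamZ (Lam_monic_ortho alpha_gt beta_gt LamD LamZ LamX) /smx_id eqSS.
case: eqVneq => [->|_]; last by rewrite !mulr0.
rewrite mulrA -invfM -expr2 sqr_sqrtr ?(ltW (h_gt0 _))//.
by rewrite mulVf ?lt0r_neq0.
Qed.

Lemma jac_b0 : b 0 = 0.
Proof. by rewrite /jac_b /= !mul0r sqrtr0 mulr0. Qed.

Lemma mulX_orthonormal_jacobi i : 'X * pn i =
  b i *: pn i.-1 + a i.+1 *: pn i + b i.+1 *: pn i.+1.
Proof.
have hS n : Num.sqrt (h n.+1) = b n.+1 * Num.sqrt (h n).
  rewrite jacobi_norm2S// sqrtrM ?sqr_ge0// sqrtr_sqr ger0_norm//.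
  by rewrite ltW// jac_b_gt0.
have s0 n : Num.sqrt (h n) != 0 by rewrite lt0r_neq0 ?sqrtr_gt0.
have b0 n : b n.+1 != 0 by rewrite lt0r_neq0 ?jac_b_gt0.
have E n : b n.+1 / Num.sqrt (h n.+1) = (Num.sqrt (h n))^-1.
  by rewrite hS; field; rewrite b0 s0.
have E' n : b n.+1 / Num.sqrt (h n) = (Num.sqrt (h n.+1))^-1 * b n.+1 ^+ 2.
  by rewrite hS; field; rewrite b0 s0.
rewrite /pn !scalerA E -scalerAr [a _ * _]mulrC -[(_ * a _) *: _]scalerA.
case: i => [|i].
  rewrite jac_b0 mul0r scale0r add0r -scalerDr; congr (_ *: _).
  by rewrite monic_jacobi1 monic_jacobi0 -mul_polyC !mulr1 addrC subrK.
rewrite E' -scalerA -!scalerDr; congr (_ *: _).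
by rewrite monic_jacobiSS -!mul_polyC; ring.
Qed.

(** The recurrence is applied to the polynomial that indexes the row, so a factor [1 + 'X] acts by
    left multiplication whatever [p] is. *)
Lemma mulmat_mulX p i j : (0 < i)%N ->
  mulmat alpha beta P ((1 + 'X) * p) i j =
  \sum_(1 <= k < i.+2) smx_tridiag a b i k * mulmat alpha beta P p k j.
Proof.
move=> i0; rewrite (@sum_tridiag _ R^o) ?jac_b0// !mulmatE.
rewrite comp_polyM comp_polyD comp_polyX -polyC1 comp_polyC addrC subrK.
set r := p \Po _.
have -> : 'X * r * (pn i.-1 * pn j.-1) = r * ('X * pn i.-1 * pn j.-1) by ring.
rewrite mulX_orthonormal_jacobi !mulrDl !mulrDr !LamD prednK//.
by rewrite -!scalerAl -!scalerAr !LamZ.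
Qed.
End JacobiMatrix.

(** * Coefficients of the Cholesky factor *)

Section CholeskyCoefficients.
Variables (R : realType) (alpha beta : R).
Hypotheses (alpha_gt : -1 < alpha) (beta_gt : -1 < beta).
Local Notation s := (alpha + beta).
Local Notation a := (jac_a alpha beta).
Local Notation b := (jac_b alpha beta).
Local Notation c := (jac_c alpha beta).
Local Notation e := (jac_e alpha beta).
Local Notation f := (jac_f alpha beta).
Local Notation g := (jac_g alpha beta).
Local Notation d := (jac_ratio alpha beta).

Let d_gt0 := jac_ratio_gt0 alpha_gt beta_gt.

Lemma jac_cE n : (0 < n)%N -> c n = 2 - a n.
Proof.
move: (alpha_gt) (beta_gt) => ha hb.
case: n => [//|[|n]] _; first by rewrite /jac_a /jac_c /=; field; apply: lt0r_neq0; lra.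
have n0 := ler0n R n; rewrite jac_aSS// /jac_c /= -[n.+2]addn2 natrD.
by field; apply/andP; split; apply: lt0r_neq0; lra.
Qed.

Lemma jac_dE n : jac_d alpha beta n = - b n.
Proof. by rewrite /jac_d /jac_b mulNr. Qed.

(** The radicands are named with indices shifted by one and with [d] absorbing the exceptional case,
    so that identities between roots reduce to uniform rational ones. *)
Definition jac_e_arg n := (n.+1%:R + alpha) * (n.+1%:R + beta) * (n%:R + s + 2)
  / (d n * (2 * n%:R + s + 2) * (2 * n%:R + s + 3)).

Definition jac_b_arg n := n.+1%:R * (n.+1%:R + alpha) * (n.+1%:R + beta)
  / (d n * (2 * n%:R + s + 2) * (2 * n%:R + s + 3)).

Definition jac_f_arg n := n.+1%:R * (n%:R + s + 2).

Definition jac_g_arg n :=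
  n.+1%:R * n.+2%:R * (n.+2%:R + alpha) * (n.+2%:R + beta)
  / ((2 * n%:R + s + 3) * (2 * n%:R + s + 4) ^+ 2 * (2 * n%:R + s + 5)).

Lemma jac_e_arg_gt0 n : 0 < jac_e_arg n.
Proof.
move: (alpha_gt) (beta_gt) => ha hb; have n0 := ler0n R n; have d0 := d_gt0 n.
by rewrite /jac_e_arg divr_gt0 ?mulr_gt0 -?natr1//; lra.
Qed.

Lemma jac_b_arg_gt0 n : 0 < jac_b_arg n.
Proof.
move: (alpha_gt) (beta_gt) => ha hb; have n0 := ler0n R n; have d0 := d_gt0 n.
by rewrite /jac_b_arg divr_gt0 ?mulr_gt0 -?natr1//; lra.
Qed.

Lemma jac_f_arg_gt0 n : 0 < jac_f_arg n.
Proof.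
move: (alpha_gt) (beta_gt) => ha hb; have n0 := ler0n R n.
by rewrite /jac_f_arg ?mulr_gt0 -?natr1//; lra.
Qed.

Lemma jac_g_arg_gt0 n : 0 < jac_g_arg n.
Proof.
move: (alpha_gt) (beta_gt) => ha hb; have n0 := ler0n R n.
by rewrite /jac_g_arg divr_gt0 ?mulr_gt0 ?exprn_gt0 -?natr1//; lra.
Qed.

Lemma jac_eE n : e n.+1 = 2 * Num.sqrt (jac_e_arg n).
Proof.
move: (alpha_gt) (beta_gt) => ha hb.
rewrite /jac_e /jac_e_arg; congr (_ * Num.sqrt _); case: n => [|n] /=.
  by rewrite /jac_ratio /=; field; apply/andP; split; apply: lt0r_neq0; lra.
have n0 := ler0n R n; rewrite jac_ratioS -[n.+2%:R]natr1 -[n.+1%:R]natr1.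
by field; do ?[apply/andP; split]; apply: lt0r_neq0; lra.
Qed.

Lemma jac_b_sqrtE n : b n.+1 = 2 * Num.sqrt (jac_b_arg n).
Proof. exact: jac_bE. Qed.

Lemma jac_fE n : f n.+1 = 2 * (alpha - beta) * Num.sqrt (jac_f_arg n)
  / ((2 * n%:R + s + 2) * (2 * n%:R + s + 4)).
Proof.
rewrite /jac_f /jac_f_arg /= -natr1; congr (_ * Num.sqrt _ / _); ring.
Qed.

Lemma jac_gE n : g n.+1 = - 2 * Num.sqrt (jac_g_arg n).
Proof.
move: (alpha_gt) (beta_gt) => ha hb; have n0 := ler0n R n.
rewrite /jac_g /jac_g_arg /= -!natr1; congr (_ * Num.sqrt _).
by field; do ?[apply/andP; split]; apply: lt0r_neq0; lra.
Qed.

Lemma jac_e_gt0 n : 0 < e n.+1.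
Proof. by rewrite jac_eE mulr_gt0// sqrtr_gt0 jac_e_arg_gt0. Qed.

Lemma jac_g_lt0 n : g n.+1 < 0.
Proof. by rewrite jac_gE mulNr oppr_lt0 mulr_gt0// sqrtr_gt0 jac_g_arg_gt0. Qed.

Lemma jac_e_sqr n : e n.+1 ^+ 2 = 4 * jac_e_arg n.
Proof. by rewrite jac_eE exprMn sqr_sqrtr ?(ltW (jac_e_arg_gt0 _))// -natrX. Qed.

Lemma jac_f_sqr n : f n.+1 ^+ 2 = 4 * (alpha - beta) ^+ 2 * jac_f_arg n
  / ((2 * n%:R + s + 2) * (2 * n%:R + s + 4)) ^+ 2.
Proof.
by rewrite jac_fE expr_div_n !exprMn sqr_sqrtr ?(ltW (jac_f_arg_gt0 _))// -natrX.
Qed.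

Lemma jac_g_sqr n : g n.+1 ^+ 2 = 4 * jac_g_arg n.
Proof.
rewrite jac_gE exprMn sqr_sqrtr ?(ltW (jac_g_arg_gt0 _))//.
by rewrite sqrrN -natrX.
Qed.

Lemma jac_f0 : f 0 = 0. Proof. by []. Qed.
Lemma jac_g0 : g 0 = 0. Proof. by []. Qed.

(** Reduces an identity between products of square roots to one between the radicands. *)
Lemma sqrtM_eq (x y z t : R) : 0 <= x -> 0 <= z -> 0 <= t ->
  x * y = z * t ^+ 2 -> Num.sqrt x * Num.sqrt y = Num.sqrt z * t.
Proof.
move=> x0 z0 t0 E.
by rewrite -[X in _ = _ * X](ger0_norm t0) -sqrtr_sqr -!sqrtrM ?E.
Qed.

(** With its companion for [g], this turns both products in the off-diagonal Cholesky equation into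
    rational multiples of the same [b]. *)
Lemma jac_e_mul_sqrt_f n :
  e n.+1 * Num.sqrt (jac_f_arg n) = b n.+1 * (n%:R + s + 2).
Proof.
move: (alpha_gt) (beta_gt) => ha hb; have n0 := ler0n R n; have d0 := d_gt0 n.
rewrite jac_eE jac_b_sqrtE -!mulrA; congr (_ * _); apply: sqrtM_eq.
- exact/ltW/jac_e_arg_gt0.
- exact/ltW/jac_b_arg_gt0.
- by lra.
rewrite /jac_e_arg /jac_b_arg /jac_f_arg; field.
by do ?[apply/andP; split]; apply: lt0r_neq0; lra.
Qed.

Lemma jac_g_mul_sqrt_f n :
  g n.+1 * Num.sqrt (jac_f_arg n) = - (b n.+2 * n.+1%:R).
Proof.
move: (alpha_gt) (beta_gt) => ha hb; have n0 := ler0n R n; have d0 := d_gt0 n.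
rewrite jac_gE jac_b_sqrtE !mulNr -!mulrA; congr (- (_ * _)); apply: sqrtM_eq => //.
- exact/ltW/jac_g_arg_gt0.
- exact/ltW/jac_b_arg_gt0.
rewrite /jac_g_arg /jac_b_arg /jac_f_arg jac_ratioS -!natr1; field.
by do ?[apply/andP; split]; apply: lt0r_neq0; lra.
Qed.

Lemma jac_eg n : e n.+1 * g n.+1 = - (b n.+1 * b n.+2).
Proof.
move: (alpha_gt) (beta_gt) => ha hb; have n0 := ler0n R n; have d0 := d_gt0 n.
have K : Num.sqrt (jac_e_arg n) * Num.sqrt (jac_g_arg n) =
    Num.sqrt (jac_b_arg n) * Num.sqrt (jac_b_arg n.+1).
  rewrite -!sqrtrM ?(ltW (jac_e_arg_gt0 _)) ?(ltW (jac_b_arg_gt0 _))//.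
  congr Num.sqrt; rewrite /jac_g_arg /jac_e_arg /jac_b_arg jac_ratioS -!natr1.
  by field; do ?[apply/andP; split]; apply: lt0r_neq0; lra.
rewrite jac_gE jac_eE !jac_b_sqrtE.
transitivity (- 4 * (Num.sqrt (jac_e_arg n) * Num.sqrt (jac_g_arg n))); first by ring.
by rewrite K; ring.
Qed.

(** Rows 1 and 2 are checked apart: there the conventions at index 0 shorten the recurrence, and
    [jac_a] and [jac_ratio] take their special forms. *)
Lemma jac_diag n : a n.+1 * c n.+1 - b n ^+ 2 - b n.+1 ^+ 2 =
  e n.+1 ^+ 2 + f n ^+ 2 + g n.-1 ^+ 2.
Proof.
move: (alpha_gt) (beta_gt) => ha hb.
rewrite jac_cE//; case: n => [|[|n]].
- rewrite jac_b0 jac_f0 jac_g0 jac_e_sqr jac_b_sqr// /jac_e_arg /jac_a /jac_ratio /=.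
  by field; do ?[apply/andP; split]; apply: lt0r_neq0; lra.
- rewrite jac_g0 jac_e_sqr jac_f_sqr !jac_b_sqr// jac_aSS// /jac_e_arg /jac_f_arg.
  rewrite jac_ratioS /jac_ratio /=.
  by field; do ?[apply/andP; split]; apply: lt0r_neq0; lra.
have n0 := ler0n R n; have d0 := d_gt0 n.
rewrite jac_e_sqr jac_f_sqr jac_g_sqr !jac_b_sqr// jac_aSS//.
rewrite /jac_e_arg /jac_f_arg /jac_g_arg !jac_ratioS -!natr1.
by field; do ?[apply/andP; split]; apply: lt0r_neq0; lra.
Qed.

(** For the first pair the factor [alpha + beta] has cancelled, so the difference vanishes only for
    [alpha = beta]; later pairs vanish also for [alpha = - beta]. *)
Lemma jac_offdiag_factor1 :
  c 2 - a 1 = 2 * (alpha - beta) / (s + 4).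
Proof.
move: (alpha_gt) (beta_gt) => ha hb.
rewrite jac_cE// jac_aSS// /jac_a /=.
by field; do ?[apply/andP; split]; apply: lt0r_neq0; lra.
Qed.

Lemma jac_offdiag_factorSS n : c n.+3 - a n.+2 =
  2 * (alpha ^+ 2 - beta ^+ 2) / ((2 * n%:R + s + 6) * (2 * n%:R + s + 2)).
Proof.
move: (alpha_gt) (beta_gt) => ha hb; have n0 := ler0n R n.
rewrite jac_cE// !jac_aSS// -natr1.
by field; do ?[apply/andP; split]; apply: lt0r_neq0; lra.
Qed.

Lemma jac_offdiag n : b n.+1 * (c n.+2 - a n.+1) =
  e n.+1 * f n.+1 + f n * g n.
Proof.
move: (alpha_gt) (beta_gt) => ha hb.
have E : e n.+1 * f n.+1 = 2 * (alpha - beta) * (b n.+1 * (n%:R + s + 2))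
    / ((2 * n%:R + s + 2) * (2 * n%:R + s + 4)).
  rewrite -jac_e_mul_sqrt_f jac_fE; ring.
rewrite E; case: n E => [|n] _.
  rewrite jac_f0 mul0r addr0 jac_offdiag_factor1.
  by field; do ?[apply/andP; split]; apply: lt0r_neq0; lra.
have n0 := ler0n R n.
have -> : f n.+1 * g n.+1 = 2 * (alpha - beta) * (- (b n.+2 * n.+1%:R))
    / ((2 * n%:R + s + 2) * (2 * n%:R + s + 4)).
  rewrite -jac_g_mul_sqrt_f jac_fE; ring.
rewrite jac_offdiag_factorSS -!natr1.
by field; do ?[apply/andP; split]; apply: lt0r_neq0; lra.
Qed.

Lemma jac_inv0E n : jac_inv0 alpha beta n.+1 = (e n.+1)^-1.
Proof.
move: (alpha_gt) (beta_gt) => ha hb; have n0 := ler0n R n; have d0 := d_gt0 n.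
rewrite jac_eE invfM -sqrtrV ?(ltW (jac_e_arg_gt0 _))// -div1r.
rewrite /jac_inv0 /jac_e_arg; congr (_ * Num.sqrt _).
case: n n0 d0 => [|n] n0 d0 /=.
  by rewrite /jac_ratio /=; field; do ?[apply/andP; split]; apply: lt0r_neq0; lra.
rewrite jac_ratioS -!natr1; have {}n0 := ler0n R n.
by field; do ?[apply/andP; split]; apply: lt0r_neq0; lra.
Qed.

Definition jac_inv1_arg n : R :=
  n.+1%:R * d n * (2 * n%:R + s + 3) ^+ 2 * (2 * n%:R + s + 5)
  / ((2 * n%:R + s + 2) * ((n%:R + alpha + 1) * (n%:R + alpha + 2))
     * ((n%:R + beta + 1) * (n%:R + beta + 2))
     * ((n%:R + s + 2) * (n%:R + s + 3))).

Definition jac_inv2_arg n : R :=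
  n.+1%:R * n.+2%:R * d n * (2 * n%:R + s + 4) ^+ 2 * (2 * n%:R + s + 7)
  / ((2 * n%:R + s + 2)
     * ((n%:R + alpha + 1) * (n%:R + alpha + 2) * (n%:R + alpha + 3))
     * ((n%:R + beta + 1) * (n%:R + beta + 2) * (n%:R + beta + 3))
     * ((n%:R + s + 2) * (n%:R + s + 3) * (n%:R + s + 4))).

Lemma jac_inv1E n : jac_inv1 alpha beta n.+1 =
  (beta - alpha) / 2 * Num.sqrt (jac_inv1_arg n).
Proof.
move: (alpha_gt) (beta_gt) => ha hb; have n0 := ler0n R n.
rewrite /jac_inv1 /jac_inv1_arg; congr (_ * Num.sqrt _).
rewrite !pochhammerS !pochhammer0.
case: n n0 => [|n] n0 /=.
  by rewrite /jac_ratio /=; field; do ?[apply/andP; split]; apply: lt0r_neq0; lra.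
rewrite jac_ratioS -!natr1; have {}n0 := ler0n R n.
by field; do ?[apply/andP; split]; apply: lt0r_neq0; lra.
Qed.

Lemma jac_inv2E n : jac_inv2 alpha beta n.+1 =
  1 / 8 * Num.sqrt (jac_inv2_arg n)
  * ((2 * n%:R + s + 2) * (2 * n%:R + s + 6) + 3 * (alpha - beta) ^+ 2).
Proof.
move: (alpha_gt) (beta_gt) => ha hb; have n0 := ler0n R n.
rewrite /jac_inv2 /jac_inv2_arg; congr (_ * Num.sqrt _ * _); last first.
  by rewrite -natr1; ring.
rewrite !pochhammerS !pochhammer0.
case: n n0 => [|n] n0 /=.
  by rewrite /jac_ratio /=; field; do ?[apply/andP; split]; apply: lt0r_neq0; lra.
rewrite jac_ratioS -!natr1; have {}n0 := ler0n R n.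
by field; do ?[apply/andP; split]; apply: lt0r_neq0; lra.
Qed.

Lemma jac_inv1_arg_ge0 n : 0 <= jac_inv1_arg n.
Proof.
move: (alpha_gt) (beta_gt) => ha hb; have n0 := ler0n R n; have d0 := d_gt0 n.
by rewrite /jac_inv1_arg divr_ge0 ?mulr_ge0 ?exprn_ge0 ?(ltW d0) -?natr1//; lra.
Qed.

Lemma jac_inv2_arg_ge0 n : 0 <= jac_inv2_arg n.
Proof.
move: (alpha_gt) (beta_gt) => ha hb; have n0 := ler0n R n; have d0 := d_gt0 n.
by rewrite /jac_inv2_arg divr_ge0 ?mulr_ge0 ?exprn_ge0 ?(ltW d0) -?natr1//; lra.
Qed.

(** Back substitution yields the same product for the first superdiagonal of the inverse; dividing
    by the nonzero [e] then identifies the entry with the closed form. *)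
Lemma jac_inv1_mul n :
  jac_inv1 alpha beta n.+1 * (e n.+1 * e n.+2) = - f n.+1.
Proof.
move: (alpha_gt) (beta_gt) => ha hb; have n0 := ler0n R n; have d0 := d_gt0 n.
have K : Num.sqrt (jac_inv1_arg n) * (Num.sqrt (jac_e_arg n)
    * Num.sqrt (jac_e_arg n.+1)) = Num.sqrt (jac_f_arg n)
    * ((2 * n%:R + s + 2) * (2 * n%:R + s + 4))^-1.
  rewrite -sqrtrM ?(ltW (jac_e_arg_gt0 _))//; apply: sqrtM_eq.
  - exact: jac_inv1_arg_ge0.
  - exact: ltW (jac_f_arg_gt0 _).
  - by rewrite invr_ge0 mulr_ge0//; lra.
  rewrite /jac_inv1_arg /jac_e_arg /jac_f_arg jac_ratioS -!natr1.
  by field; do ?[apply/andP; split]; apply: lt0r_neq0; lra.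
rewrite jac_inv1E !jac_eE jac_fE.
transitivity (2 * (beta - alpha) * (Num.sqrt (jac_inv1_arg n)
  * (Num.sqrt (jac_e_arg n) * Num.sqrt (jac_e_arg n.+1)))).
  by field.
by rewrite K; ring.
Qed.

Lemma jac_inv2_mul n :
  jac_inv2 alpha beta n.+1 * (e n.+1 * e n.+2 * e n.+3) =
  f n.+1 * f n.+2 - g n.+1 * e n.+2.
Proof.
move: (alpha_gt) (beta_gt) => ha hb; have n0 := ler0n R n; have d0 := d_gt0 n.
have f0 m := ltW (jac_f_arg_gt0 m); have e0 m := ltW (jac_e_arg_gt0 m).
(* Both sides are rational multiples of the single radical [W]: [K1] treats the left side and [K2]
   the term with [g], after which [field] applies. *)
set W := Num.sqrt (jac_f_arg n) * Num.sqrt (jac_f_arg n.+1).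
have WE : W = Num.sqrt (jac_f_arg n * jac_f_arg n.+1) by rewrite sqrtrM.
have K1 : Num.sqrt (jac_inv2_arg n) * (Num.sqrt (jac_e_arg n)
    * Num.sqrt (jac_e_arg n.+1) * Num.sqrt (jac_e_arg n.+2)) = W
    * ((2 * n%:R + s + 2) * (2 * n%:R + s + 3)
       * (2 * n%:R + s + 5) * (2 * n%:R + s + 6))^-1.
  have <- : Num.sqrt (jac_e_arg n * jac_e_arg n.+1 * jac_e_arg n.+2) =
      Num.sqrt (jac_e_arg n) * Num.sqrt (jac_e_arg n.+1)
      * Num.sqrt (jac_e_arg n.+2).
    by rewrite (sqrtrM _ (mulr_ge0 (e0 n) (e0 n.+1))) (sqrtrM _ (e0 n)).
  rewrite WE; apply: sqrtM_eq.
  - exact: jac_inv2_arg_ge0.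
  - by rewrite mulr_ge0.
  - by rewrite invr_ge0 !mulr_ge0//; lra.
  rewrite /jac_inv2_arg /jac_e_arg /jac_f_arg !jac_ratioS -!natr1.
  by field; do ?[apply/andP; split]; apply: lt0r_neq0; lra.
have K2 : Num.sqrt (jac_g_arg n) * Num.sqrt (jac_e_arg n.+1) = W
    * ((n%:R + alpha + 2) * (n%:R + beta + 2)
       / ((2 * n%:R + s + 3) * (2 * n%:R + s + 4) ^+ 2 * (2 * n%:R + s + 5))).
  rewrite WE; apply: sqrtM_eq.
  - exact: ltW (jac_g_arg_gt0 _).
  - by rewrite mulr_ge0.
  - by rewrite divr_ge0 ?mulr_ge0 ?exprn_ge0//; lra.
  rewrite /jac_g_arg /jac_e_arg /jac_f_arg jac_ratioS -!natr1.
  by field; do ?[apply/andP; split]; apply: lt0r_neq0; lra.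
rewrite jac_inv2E !jac_eE !jac_fE jac_gE.
set Z := (_ + _) * (_ + _) + _.
transitivity (Z * (Num.sqrt (jac_inv2_arg n) * (Num.sqrt (jac_e_arg n)
    * Num.sqrt (jac_e_arg n.+1) * Num.sqrt (jac_e_arg n.+2)))); first by field.
transitivity (4 * (alpha - beta) ^+ 2 * W / ((2 * n%:R + s + 2)
   * (2 * n%:R + s + 4) * ((2 * n.+1%:R + s + 2) * (2 * n.+1%:R + s + 4)))
  + 4 * (Num.sqrt (jac_g_arg n) * Num.sqrt (jac_e_arg n.+1))); last first.
  rewrite /W -natr1.
  by field; do ?[apply/andP; split]; apply: lt0r_neq0; lra.
rewrite K1 K2 /Z -natr1.
by field; do ?[apply/andP; split]; apply: lt0r_neq0; lra.
Qed.
End CholeskyCoefficients.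

(** * Semi-infinite matrices *)

Section SemiInfiniteMatrices.
Variable R : realType.
Implicit Types A B C : smx R.

(** The partial sums are constant from [N] on, so the limit in the product is a finite sum. *)
Lemma smx_mulE A B i j N : (0 < N)%N ->
  (forall k, (N <= k)%N -> A i k * B k j = 0) ->
  smx_mul A B i j = \sum_(1 <= k < N) A i k * B k j.
Proof.
move=> N0 z; apply: cvg_lim => //; apply: cvg_near_cst.
exists N => // M /= NM; rewrite (@big_cat_nat _ _ _ N)//= [X in _ + X]big_nat.
by rewrite [X in _ + X]big1 ?addr0// => k /andP[Nk _]; rewrite z.
Qed.

Lemma eq_smx_mul A A' B B' : smx_eq A A' -> smx_eq B B' ->
  smx_eq (smx_mul A B) (smx_mul A' B').
Proof.
move=> AA BB i j i0 j0; rewrite /smx_mul.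
suff -> : (fun N => \sum_(1 <= k < N) A i k * B k j) =
  (fun N => \sum_(1 <= k < N) A' i k * B' k j) by [].
apply/funext => N; rewrite !big_nat; apply: eq_bigr => k /andP[k0 _].
by rewrite AA// BB.
Qed.

Lemma smx_eq_refl A : smx_eq A A.
Proof. by []. Qed.

Lemma smx_eq_sym A B : smx_eq A B -> smx_eq B A.
Proof. by move=> AB i j i0 j0; rewrite AB. Qed.

Lemma smx_eq_trans A B C : smx_eq A B -> smx_eq B C -> smx_eq A C.
Proof. by move=> AB BC i j i0 j0; rewrite AB// BC. Qed.

Lemma smx_tr_mul A B :
  smx_tr (smx_mul A B) = smx_mul (smx_tr B) (smx_tr A).
Proof.
apply/funext => i; apply/funext => j; rewrite /smx_tr /smx_mul.
suff -> : (fun N => \sum_(1 <= k < N) A j k * B k i) =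
  (fun N => \sum_(1 <= k < N) B k i * A j k) by [].
apply/funext => N.
by apply: eq_bigr => k _; rewrite mulrC.
Qed.

(** Weaker than a bandwidth, as nothing is required below the diagonal. The transposed inverse
    factor satisfies it although it is not banded. *)
Definition smx_row_finite (w : nat) A := forall i j : nat,
  (0 < i)%N -> (i + w < j)%N -> A i j = 0.

Lemma smx_mul_row_finiteE w A B i j N : smx_row_finite w A ->
  (0 < i)%N -> (i + w < N)%N ->
  smx_mul A B i j = \sum_(1 <= k < N) A i k * B k j.
Proof.
move=> hA i0 iN; apply: smx_mulE; first by lia.
by move=> k Nk; rewrite hA ?mul0r//; lia.
Qed.

Lemma smx_mul_upperE A B i j N : smx_upper B -> (0 < j)%N -> (j < N)%N ->
  smx_mul A B i j = \sum_(1 <= k < N) A i k * B k j.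
Proof.
move=> hB j0 jN; apply: smx_mulE; first by lia.
by move=> k Nk; rewrite hB ?mulr0//; lia.
Qed.

Lemma smx_mul_row_finite w1 w2 A B : smx_row_finite w1 A ->
  smx_row_finite w2 B -> smx_row_finite (w1 + w2) (smx_mul A B).
Proof.
move=> hA hB i j i0 ij; rewrite (smx_mul_row_finiteE _ _ hA i0 (ltnSn _)).
rewrite big_nat big1// => k /andP[k0 ki]; rewrite hB ?mulr0//; lia.
Qed.

(** Finite rows in the two left factors make every sum finite, so the order of summation can be
    exchanged with [C] arbitrary. *)
Lemma smx_mulA w1 w2 A B C : smx_row_finite w1 A -> smx_row_finite w2 B ->
  smx_eq (smx_mul (smx_mul A B) C) (smx_mul A (smx_mul B C)).
Proof.
move=> hA hB i j i0 j0; set N := (i + (w1 + w2)).+1.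
have hAB := smx_mul_row_finite hA hB.
rewrite (smx_mul_row_finiteE _ _ hAB i0 (ltnSn _)).
have iN : (i + w1 < N)%N by rewrite /N; lia.
rewrite (smx_mul_row_finiteE _ _ hA i0 iN) -/N.
under eq_bigr do rewrite (smx_mul_row_finiteE _ _ hA i0 iN) mulr_suml.
rewrite exchange_big /= !big_nat; apply: eq_bigr => l /andP[l0 lN].
under eq_bigr do rewrite -mulrA.
rewrite -mulr_sumr; have [il|li] := ltnP (i + w1) l.
  by rewrite hA// !mul0r.
by rewrite (smx_mul_row_finiteE _ _ hB l0 (_ : (l + w2 < N)%N))// /N; lia.
Qed.

Lemma smx_mul1l A : smx_eq (smx_mul (@smx_id R) A) A.
Proof.
move=> i j i0 j0; rewrite (@smx_mulE _ _ _ _ i.+1)//.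
  rewrite big_nat_recr//= /smx_id eqxx mul1r big_nat big1 ?add0r//.
  by move=> k /andP[_ ki]; rewrite gtn_eqF// mul0r.
by move=> k ik; rewrite /smx_id ltn_eqF// mul0r.
Qed.

Lemma smx_mul1r A : smx_eq (smx_mul A (@smx_id R)) A.
Proof.
move=> i j i0 j0; rewrite (@smx_mulE _ _ _ _ j.+1)//.
  rewrite big_nat_recr//= /smx_id eqxx mulr1 big_nat big1 ?add0r//.
  by move=> k /andP[_ ki]; rewrite ltn_eqF// mulr0.
by move=> k ik; rewrite /smx_id gtn_eqF// mulr0.
Qed.

Lemma smx_mul_eq0 A B i j : (forall k, (0 < k)%N -> A i k * B k j = 0) ->
  smx_mul A B i j = 0.
Proof.
move=> z; rewrite /smx_mul.
have -> : (fun N => \sum_(1 <= k < N) A i k * B k j) = cst 0.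
  by apply/funext => N; rewrite big_nat big1// => k /andP[k0 _]; exact: z.
exact: lim_cst.
Qed.

Lemma smx_bandwidth_mul w1 w2 A B : smx_bandwidth w1 A ->
  smx_bandwidth w2 B -> smx_bandwidth (w1 + w2) (smx_mul A B).
Proof.
move=> hA hB i j i0 j0 ij; apply: smx_mul_eq0 => k k0.
have [h|h] := boolP ((i + w1 < k)%N || (k + w1 < i)%N).
  by rewrite hA ?mul0r.
by rewrite hB ?mulr0//; lia.
Qed.

Lemma smx_bandwidth_eq w A B : smx_eq A B -> smx_bandwidth w B ->
  smx_bandwidth w A.
Proof. by move=> AB hB i j i0 j0 ij; rewrite AB// hB. Qed.

Lemma smx_bandwidth_row_finite w A : smx_bandwidth w A -> smx_row_finite w A.
Proof. by move=> hA i j i0 ij; apply: hA => //; rewrite ?ij//; lia. Qed.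

Lemma smx_bandwidth_tr w A : smx_bandwidth w A -> smx_bandwidth w (smx_tr A).
Proof. by move=> hA i j i0 j0 ij; rewrite /smx_tr hA// orbC. Qed.

(** Truncation to the leading square block is multiplicative when the right factor is upper
    triangular, and for finite square matrices a right inverse is a left inverse. *)
Lemma smx_upper_left_inverse A B : smx_upper A -> smx_upper B ->
  smx_eq (smx_mul A B) (@smx_id R) -> smx_eq (smx_mul B A) (@smx_id R).
Proof.
move=> uA uB AB i j i0 j0; set N := maxn i j.
pose tr (X : smx R) : 'M[R]_N := \matrix_(k, l) X k.+1 l.+1.
have trM X Y : smx_upper Y -> tr X *m tr Y = tr (smx_mul X Y).
  move=> uY; apply/matrixP => k l; rewrite !mxE.
  rewrite (@smx_mul_upperE _ _ _ _ N.+1) ?ltnS// big_add1 big_mkord.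
  by apply: eq_bigr => m _; rewrite !mxE.
have tr1 X : smx_eq X (@smx_id R) -> tr X = 1%:M.
  by move=> X1; apply/matrixP => k l; rewrite !mxE X1// /smx_id eqSS.
have /mulmx1C : tr A *m tr B = 1%:M by rewrite trM// tr1.
rewrite trM// => /matrixP E.
have hi : (i.-1 < N)%N by rewrite /N; lia.
have hj : (j.-1 < N)%N by rewrite /N; lia.
by have := E (Ordinal hi) (Ordinal hj); rewrite !mxE -val_eqE /= -eqSS !prednK.
Qed.

(** Induction on the row: once the rows above agree, the diagonal entries have equal squares and are
    positive, and the rest of the row follows by division. *)
Lemma cholesky_unique M A B : is_cholesky M A -> is_cholesky M B -> smx_eq A B.
Proof.
move=> [uA pA EA] [uB pB EB].
have E X : smx_upper X -> smx_eq (smx_mul (smx_tr X) X) M ->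
    forall i j, (0 < i)%N -> (0 < j)%N ->
    M i j = \sum_(1 <= k < i) X k i * X k j + X i i * X i j.
  move=> uX EX i j i0 j0; rewrite -EX// (@smx_mulE _ _ _ _ i.+1)//.
    by rewrite big_nat_recr.
  by move=> k ik; rewrite /smx_tr uX// mul0r.
elim/ltn_ind => i ih j i0 j0.
have [ji|ij] := ltnP j i; first by rewrite uA// uB.
have EE l : (0 < l)%N -> A i i * A i l = B i i * B i l.
  move=> l0; have := E _ uA EA _ _ i0 l0; rewrite (E _ uB EB _ _ i0 l0).
  have -> : \sum_(1 <= k < i) A k i * A k l = \sum_(1 <= k < i) B k i * B k l.
    by rewrite !big_nat; apply: eq_bigr => k /andP[k0 ki]; rewrite !ih.
  by move/addrI.
have dE : A i i = B i i.
  apply/eqP; rewrite -(@eqrXn2 _ 2) ?(ltW (pA _ i0)) ?(ltW (pB _ i0))//.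
  by rewrite !expr2 EE.
by have := EE j j0; rewrite dE; apply: mulfI; rewrite lt0r_neq0// pB.
Qed.

Lemma sum_upper3_row e f g (F : nat -> R) i N : (0 < i)%N -> (i.+2 < N)%N ->
  \sum_(1 <= k < N) smx_upper3 e f g i k * F k =
  e i * F i + f i * F i.+1 + g i * F i.+2.
Proof.
move=> i0 iN; rewrite (@big_cat_nat _ _ _ i)//=; last by lia.
rewrite big_nat big1 => [|k /andP[k0 ki]]; last first.
  by rewrite /smx_upper3; do 3 (case: eqP => [|_]; first lia); rewrite mul0r.
rewrite add0r (@big_cat_nat _ _ _ i.+3)//=; last by lia.
rewrite [X in _ + X]big_nat [X in _ + X]big1 => [|k /andP[k0 ki]]; last first.
  by rewrite /smx_upper3; do 3 (case: eqP => [|_]; first lia); rewrite mul0r.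
rewrite addr0 3?(big_ltn (_ : _ < i.+3)%N)//; try lia.
rewrite big_geq// addr0 addrA /smx_upper3 !eqxx.
by do 3 (case: eqP => [|_]; first lia).
Qed.

(** In columns 1 and 2 the truncated predecessors give index 0, where [f] and [g] vanish, so no
    separate formula is needed. *)
Lemma sum_upper3_col e f g (F : nat -> R) i : f 0%N = 0 -> g 0%N = 0 ->
  (0 < i)%N ->
  \sum_(1 <= k < i.+1) smx_upper3 e f g k i * F k =
  e i * F i + f i.-1 * F i.-1 + g i.-2 * F i.-2.
Proof.
move=> f0 g0; case: i => // i _; rewrite big_nat_recr//= /smx_upper3 eqxx.
rewrite -[RHS]addrA [RHS]addrC; congr (_ + _).
case: i => [|i]; first by rewrite big_geq//= f0 g0 !mul0r addr0.
rewrite big_nat_recr//= gtn_eqF// eqxx [RHS]addrC; congr (_ + _).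
case: i => [|i]; first by rewrite big_geq//= g0 mul0r.
rewrite big_nat_recr//= gtn_eqF// gtn_eqF// eqxx big_nat big1 ?add0r//.
move=> k /andP[k0 ki]; do 3 (case: eqP => [|_]; first lia).
by rewrite mul0r.
Qed.

Lemma smx_upper3_upper (e f g : nat -> R) : smx_upper (smx_upper3 e f g).
Proof.
move=> i j j0 ji; rewrite /smx_upper3.
by do 3 (case: eqP => [|_]; first lia).
Qed.

Lemma smx_upper3_bandwidth (e f g : nat -> R) :
  smx_bandwidth 2 (smx_upper3 e f g).
Proof.
move=> i j i0 j0 ij; rewrite /smx_upper3.
by do 3 (case: eqP => [|_]; first lia).
Qed.
End SemiInfiniteMatrices.

(** * Inverse of an upper triangular matrix with three diagonals *)

Section UpperTridiagonalInverse.
Variables (R : realType) (e f g : nat -> R).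
Hypothesis e_neq0 : forall n, (0 < n)%N -> e n != 0.
Local Notation R0 := (smx_upper3 e f g).

(* Entries [j - t] and [j - t + 1] of the column [j] of the inverse, by back
   substitution. *)
Fixpoint inverse_column (j t : nat) : R * R :=
  if t is t'.+1 then
    let xy := inverse_column j t' in
    (- (f (j - t) * xy.1 + g (j - t) * xy.2) / e (j - t), xy.1)
  else ((e j)^-1, 0).

Definition upper3_inverse : smx R := fun i j =>
  if (i <= j)%N then (inverse_column j (j - i)).1 else 0.

Lemma upper3_inverse_upper : smx_upper upper3_inverse.
Proof. by move=> i j _ ji; rewrite /upper3_inverse leqNgt ji. Qed.

Lemma upper3_inverseP : is_upper_inverse R0 upper3_inverse.
Proof.
have uR := smx_upper3_upper e f g; have uI := upper3_inverse_upper.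
suff H : smx_eq (smx_mul R0 upper3_inverse) (@smx_id R).
  by split => //; exact: smx_upper_left_inverse uR uI H.
move=> i j i0 j0.
have hR := smx_bandwidth_row_finite (smx_upper3_bandwidth e f g).
have iN : (i + 2 < i.+3)%N by lia.
rewrite (smx_mul_row_finiteE _ _ hR i0 iN) sum_upper3_row// /smx_id.
have [ij|ji|<-] := ltngtP i j; last first.
- rewrite (uI i.+1 i)// (uI i.+2 i)// ?mulr0 ?addr0 ?leqnSn//.
  by rewrite /upper3_inverse leqnn subnn /= divff ?e_neq0.
- by rewrite !uI ?mulr0 ?addr0//; lia.
have -> : upper3_inverse i j = (inverse_column j (j - i.+1).+1).1.
  by rewrite /upper3_inverse (ltnW ij); congr (inverse_column _ _).1; lia.
have -> : upper3_inverse i.+1 j = (inverse_column j (j - i.+1)).1.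
  by rewrite /upper3_inverse ij.
(* For [j = i + 1] this entry lies below the diagonal and matches the initial 0 in the second
   component of [inverse_column]. *)
have -> : upper3_inverse i.+2 j = (inverse_column j (j - i.+1)).2.
  rewrite /upper3_inverse; have [ij2|ji2] := ltnP i.+1 j.
    by have -> : (j - i.+1 = (j - i.+2).+1)%N by lia.
  by have -> : (j - i.+1 = 0)%N by lia.
rewrite /=; have -> : (j - (j - i.+1).+1 = i)%N by lia.
by field; exact: e_neq0.
Qed.

Variable Ri : smx R.
Hypothesis hRi : is_upper_inverse R0 Ri.

Lemma upper3_inverse_rec i j : (0 < i)%N -> (0 < j)%N ->
  e i * Ri i j + f i * Ri i.+1 j + g i * Ri i.+2 j = (i == j)%:R.
Proof.
case: hRi => _ H _ i0 j0; rewrite -[RHS]/(smx_id R i j) -H//.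
have hR := smx_bandwidth_row_finite (smx_upper3_bandwidth e f g).
have iN : (i + 2 < i.+3)%N by lia.
by rewrite (smx_mul_row_finiteE _ _ hR i0 iN) sum_upper3_row.
Qed.

Lemma upper3_inverse_diag n : (0 < n)%N -> e n * Ri n n = 1.
Proof.
case: (hRi) => uRi _ _ n0; have := upper3_inverse_rec n0 n0.
by rewrite eqxx (uRi n.+1 n)// (uRi n.+2 n)// ?mulr0 ?addr0// leqnSn.
Qed.

Lemma upper3_inverse_super1 n : (0 < n)%N ->
  Ri n n.+1 * (e n * e n.+1) = - f n.
Proof.
case: (hRi) => uRi _ _ n0; have := @upper3_inverse_rec n n.+1 n0 isT.
have E1 := @upper3_inverse_diag n.+1 isT.
rewrite (uRi n.+2 n.+1)// mulr0 addr0 ltn_eqF// mulr0n => E2.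
transitivity ((e n * Ri n n.+1 + f n * Ri n.+1 n.+1) * e n.+1
   - f n * (e n.+1 * Ri n.+1 n.+1)); first by ring.
by rewrite E2 E1; ring.
Qed.

Lemma upper3_inverse_super2 n : (0 < n)%N ->
  Ri n n.+2 * (e n * e n.+1 * e n.+2) = f n * f n.+1 - g n * e n.+1.
Proof.
move=> n0; have := @upper3_inverse_rec n n.+2 n0 isT.
have E1 := @upper3_inverse_diag n.+2 isT.
have E2 := @upper3_inverse_super1 n.+1 isT.
rewrite ltn_eqF// mulr0n => E3.
transitivity ((e n * Ri n n.+2 + f n * Ri n.+1 n.+2 + g n * Ri n.+2 n.+2)
  * (e n.+1 * e n.+2) - f n * (Ri n.+1 n.+2 * (e n.+1 * e n.+2))
  - g n * e n.+1 * (e n.+2 * Ri n.+2 n.+2)); first by ring.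
by rewrite E1 E2 E3; ring.
Qed.

(* If the inverse had bandwidth [w], the entries 1 and 2 of its column [w + 3]
   would vanish, and the recurrence solved for its last term would propagate
   this up to the diagonal. *)
Lemma upper3_inverse_dense : (forall n, (0 < n)%N -> g n != 0) ->
  ~ smx_banded Ri.
Proof.
move=> g_neq0 [w hw]; set j := (w + 3)%N.
have z i : (0 < i)%N -> (i <= j)%N -> Ri i j = 0.
  elim/ltn_ind: i => -[|[|[|i]]] ih // _ ij; try by apply: hw; rewrite // /j; lia.
  have j1 : (0 < j)%N by rewrite /j; lia.
  have := @upper3_inverse_rec i.+1 j isT j1.
  rewrite (ih i.+1) ?(ih i.+2); try lia.
  rewrite !mulr0 !add0r ltn_eqF; last by lia.
  by move/eqP; rewrite mulf_eq0 (negbTE (g_neq0 _ _))// => /eqP.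
have j1 : (0 < j)%N by rewrite /j; lia.
have /eqP := upper3_inverse_diag j1.
by rewrite z// mulr0 eq_sym oner_eq0.
Qed.

(* The recurrence expresses every row above [j0] through the rows [j0] and
   [j0 + 1] on the columns from [j0] on. *)
Lemma upper3_inverse_rank : smx_rank_structured 2 Ri.
Proof.
move=> i0 j0 p q i0_gt0 pj.
have H t : (t < j0)%N -> exists uv : R * R, forall l, (j0 <= l)%N ->
    Ri (j0 - t)%N l = uv.1 * Ri j0 l + uv.2 * Ri j0.+1 l.
  elim/ltn_ind: t => -[|[|t]] ih tj.
  - by exists (1, 0) => l _; rewrite subn0 mul1r mul0r addr0.
  - exists (- f j0.-1 / e j0.-1, - g j0.-1 / e j0.-1) => l jl /=.
    have i1 : (0 < j0.-1)%N by lia.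
    have l1 : (0 < l)%N by lia.
    have := upper3_inverse_rec i1 l1; rewrite ltn_eqF; last by lia.
  rewrite mulr0n.
    rewrite prednK; last by lia.
    have -> : (j0 - 1 = j0.-1)%N by lia.
    move=> E; have en := e_neq0 i1; apply: (mulfI en).
    transitivity ((e j0.-1 * Ri j0.-1 l + f j0.-1 * Ri j0 l + g j0.-1 * Ri j0.+1 l)
      - (f j0.-1 * Ri j0 l + g j0.-1 * Ri j0.+1 l)); first by ring.
    by rewrite E; field.
  have [|uv1 E1] := ih t.+1 (ltnSn _); first by lia.
  have [|uv0 E0] := ih t (ltnW (ltnSn _)); first by lia.
  set i := (j0 - t.+2)%N.
  exists (- (f i * uv1.1 + g i * uv0.1) / e i,
          - (f i * uv1.2 + g i * uv0.2) / e i) => l jl /=.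
  have i1 : (0 < i)%N by rewrite /i; lia.
  have l1 : (0 < l)%N by lia.
  have := upper3_inverse_rec i1 l1; rewrite ltn_eqF; last by rewrite /i; lia.
  rewrite mulr0n.
  have -> : i.+1 = (j0 - t.+1)%N by rewrite /i; lia.
  have -> : (j0 - t.+1).+1 = (j0 - t)%N by lia.
  rewrite E1// E0// => E; have en := e_neq0 i1; apply: (mulfI en).
  transitivity (e i * Ri i l
    + f i * (uv1.1 * Ri j0 l + uv1.2 * Ri j0.+1 l)
    + g i * (uv0.1 * Ri j0 l + uv0.2 * Ri j0.+1 l)
    - (f i * (uv1.1 * Ri j0 l + uv1.2 * Ri j0.+1 l)
    + g i * (uv0.1 * Ri j0 l + uv0.2 * Ri j0.+1 l))); first by ring.
  by rewrite E; field.
have /choice[uv Huv] : forall k : 'I_p, exists uv : R * R,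
    forall l, (j0 <= l)%N ->
    Ri (i0 + k)%N l = uv.1 * Ri j0 l + uv.2 * Ri j0.+1 l.
  move=> k; have kp := ltn_ord k.
  have [|uv Huv] := H (j0 - (i0 + k))%N; first by lia.
  by exists uv => l jl; rewrite -Huv//; congr Ri; lia.
pose U : 'M[R]_(p, 2) := \matrix_(k, m) if m == 0 then (uv k).1 else (uv k).2.
pose V : 'M[R]_(2, q) := \matrix_(m, l) if m == 0 then Ri j0 (j0 + l)%N
  else Ri j0.+1 (j0 + l)%N.
have -> : \matrix_(k < p, l < q) Ri (i0 + k)%N (j0 + l)%N = U *m V.
  apply/matrixP => k l; rewrite !mxE !big_ord_recl big_ord0 addr0 !mxE /=.
  by rewrite Huv// leq_addr.
exact: leq_trans (mxrankM_maxl _ _) (rank_leq_col _).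
Qed.
End UpperTridiagonalInverse.

(** * Similarity by the Cholesky factor for a matrix commuting with [M] *)

Section CholeskySimilarity.
Variables (R : realType) (w : nat) (M S Rc Ri : smx R).
Hypotheses (chol : is_cholesky M Rc) (inv : is_upper_inverse Rc Ri).
Hypotheses (Rc_band : smx_bandwidth w Rc) (S_band : smx_bandwidth 2 S).
Hypotheses (S_sym : smx_sym S) (MS : smx_eq (smx_mul M S) (smx_mul S M)).
Local Notation Rt := (smx_tr Rc).
Local Notation Rit := (smx_tr Ri).
Local Notation T := (smx_mul (smx_mul Rc S) Ri).

Let uRc : smx_upper Rc. Proof. by case: chol. Qed.
Let uRi : smx_upper Ri. Proof. by case: inv. Qed.

Let Rc_fin : smx_row_finite w Rc.
Proof. exact: smx_bandwidth_row_finite. Qed.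

Let S_fin : smx_row_finite 2 S.
Proof. exact: smx_bandwidth_row_finite. Qed.

Let Rt_fin : smx_row_finite 0 Rt.
Proof. by move=> i j i0 ij; rewrite /smx_tr uRc//; lia. Qed.

Let Rit_fin : smx_row_finite 0 Rit.
Proof. by move=> i j i0 ij; rewrite /smx_tr uRi//; lia. Qed.

Let M_fin : smx_row_finite (0 + w) M.
Proof.
case: chol => _ _ E i j i0 ij; rewrite -E//; last by lia.
exact: (smx_mul_row_finite Rt_fin Rc_fin).
Qed.

(** From [Rit M = Rc] and [M S = S M], right multiplication of the left-hand side by [Rc] gives
    [Rc S]; multiplying by [Ri] returns the claim. The factor [Ri], whose rows may be infinite,
    occurs only in last position, where associativity allows it. *)
Lemma cholesky_similarity : smx_eq (smx_mul (smx_mul Rit S) Rt) T.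
Proof.
have [_ _ E] := chol; have [_ I1 I2] := inv.
have RitS := smx_mul_row_finite Rit_fin S_fin.
have U_fin := smx_mul_row_finite RitS Rt_fin.
have ItIr : smx_eq (smx_mul Rit Rt) (@smx_id R).
  move=> i j i0 j0; rewrite -smx_tr_mul /smx_tr I1// /smx_id eq_sym.
  by [].
have RitM : smx_eq (smx_mul Rit M) Rc.
  apply: smx_eq_trans (smx_mul1l Rc).
  apply: smx_eq_trans (eq_smx_mul ItIr (smx_eq_refl Rc)).
  apply: smx_eq_trans (smx_eq_sym (smx_mulA _ Rit_fin Rt_fin)).
  by apply: eq_smx_mul => //; exact: smx_eq_sym.
have URc : smx_eq (smx_mul (smx_mul (smx_mul Rit S) Rt) Rc) (smx_mul Rc S).
  apply: smx_eq_trans (smx_mulA _ RitS Rt_fin) _.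
  apply: smx_eq_trans (eq_smx_mul (smx_eq_refl _) E) _.
  apply: smx_eq_trans (smx_mulA _ Rit_fin S_fin) _.
  apply: smx_eq_trans (eq_smx_mul (smx_eq_refl _) (smx_eq_sym MS)) _.
  apply: smx_eq_trans (smx_eq_sym (smx_mulA _ Rit_fin M_fin)) _.
  exact: eq_smx_mul.
apply: smx_eq_trans (smx_eq_sym (smx_mul1r _)) _.
apply: smx_eq_trans (eq_smx_mul (smx_eq_refl _) (smx_eq_sym I1)) _.
apply: smx_eq_trans (smx_eq_sym (smx_mulA _ U_fin Rc_fin)) _.
exact: eq_smx_mul.
Qed.

Lemma cholesky_similarity_sym : smx_sym T.
Proof.
rewrite /smx_sym !smx_tr_mul.
apply: smx_eq_trans cholesky_similarity.
apply: smx_eq_trans (smx_eq_sym (smx_mulA _ Rit_fin S_fin)).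
by apply: eq_smx_mul => //; exact: eq_smx_mul.
Qed.

Let RcS_low i k : (0 < k)%N -> (k + 2 < i)%N -> smx_mul Rc S i k = 0.
Proof.
move=> k0 ki; apply: smx_mul_eq0 => l l0.
have [li|il] := ltnP l i; first by rewrite uRc ?mul0r.
by rewrite S_band ?mulr0//; lia.
Qed.

(** Upper triangular factors around a pentadiagonal matrix create nothing below the second
    subdiagonal; symmetry gives the upper part. *)
Lemma cholesky_similarity_pentadiag : smx_pentadiag T.
Proof.
have low i j : (0 < j)%N -> (j + 2 < i)%N -> T i j = 0.
  move=> j0 ji; apply: smx_mul_eq0 => k k0.
  have [jk|kj] := ltnP j k; first by rewrite uRi ?mulr0.
  by rewrite RcS_low ?mul0r//; lia.
move=> i j i0 j0 /orP[ij|ji]; last exact: low.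
by rewrite -cholesky_similarity_sym// /smx_tr low.
Qed.

(** For an entry [(p, q)] with [q <= p], a term [k] survives only if [p <= k + 2] and [k <= q],
    hence [q - k] is 0, 1 or 2. *)
Lemma cholesky_similarity_three_diagonals (Q : smx R) : smx_upper Q ->
  (forall i : nat, (0 < i)%N ->
     [/\ Q i i = Ri i i, Q i i.+1 = Ri i i.+1 & Q i i.+2 = Ri i i.+2]) ->
  forall i j : nat, (0 < i)%N -> (0 < j)%N ->
    T i j = smx_mul (smx_mul Rc S) Q (maxn i j) (minn i j).
Proof.
move=> uQ hQ i j i0 j0.
have -> : T i j = T (maxn i j) (minn i j).
  by case: leqP => _ //; rewrite -cholesky_similarity_sym.
have : (minn i j <= maxn i j)%N by lia.
have : (0 < minn i j)%N by lia.
move: (maxn i j) (minn i j) => p q q0 qp.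
rewrite !(@smx_mul_upperE _ _ _ _ _ q.+1)// !big_nat.
apply: eq_bigr => k /andP[k0 kq].
have [kp|pk] := ltnP (k + 2) p; first by rewrite RcS_low// !mul0r.
have [h0 h1 h2] := hQ k k0; congr (_ * _).
have : [\/ q = k, q = k.+1 | q = k.+2].
  have : (q == k) || (q == k.+1) || (q == k.+2) by lia.
  by move=> /orP[/orP[]|] /eqP ->; [constructor 1|constructor 2|constructor 3].
by case=> ->.
Qed.
End CholeskySimilarity.

(** * Rounding errors *)

Section Rounding.
Variables (R : realType) (u : R) (rnd : R -> R).
Hypothesis hrnd : is_rounding u rnd.

Let u_ge0 : 0 <= u. Proof. by case: hrnd => /andP[]. Qed.

Let u1_ge1 n : 1 <= (1 + u) ^+ n.
Proof. by rewrite exprn_ege1// lerDl. Qed.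

Lemma rounding0 : rnd 0 = 0.
Proof.
case: hrnd => _ h _ _ _; have := h 0.
by rewrite subr0 normr0 mulr0 normr_le0 => /eqP.
Qed.

(** For [u] between 0 and 1 the convex function on the left stays below its secant, which gives
    error constants independent of [u]. *)
Lemma rounding_growth n : (1 + u) ^+ n - 1 <= (2 ^+ n - 1) * u.
Proof.
have u1 : u <= 1 by case: hrnd => /andP[_ /ltW].
elim: n => [|n ih]; first by rewrite !expr0 !subrr mul0r.
have e0 : 0 <= (1 + u) ^+ n - 1 by rewrite subr_ge0.
rewrite !exprS; apply: (@le_trans _ _ (((1 + u) ^+ n - 1) * 2 + u)).
  have -> : (1 + u) * (1 + u) ^+ n - 1 =
    ((1 + u) ^+ n - 1) * (1 + u) + u by ring.
  by rewrite lerD2r ler_wpM2l//; lra.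
apply: (@le_trans _ _ ((2 ^+ n - 1) * u * 2 + u)).
  by rewrite lerD2r ler_wpM2r.
by have -> : (2 ^+ n - 1) * u * 2 + u = (2 * 2 ^+ n - 1) * u by ring.
Qed.

(* [y] approximates [x] after [n] roundings of quantities bounded by [X]. *)
Definition fl_approx n (y x X : R) :=
  `|x| <= X /\ `|y - x| <= ((1 + u) ^+ n - 1) * X.

Lemma approx_exact x : fl_approx 0 x x `|x|.
Proof. by split; rewrite // expr0 !subrr normr0 mul0r. Qed.

Lemma approx_norm n y x X : fl_approx n y x X -> `|y| <= (1 + u) ^+ n * X.
Proof.
move=> [xX yx]; rewrite -[y](subrK x) (le_trans (ler_normD _ _))//.
rewrite (le_trans (lerD yx xX))//.
by have -> : ((1 + u) ^+ n - 1) * X + X = (1 + u) ^+ n * X by ring.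
Qed.

Lemma approx_rnd n y x X : fl_approx n y x X -> fl_approx n.+1 (rnd y) x X.
Proof.
move=> H; have ny := approx_norm H; case: H => xX yx; split => //.
case: hrnd => _ h _ _ _.
rewrite -(subrK y (rnd y)) -addrA (le_trans (ler_normD _ _))//.
have hy : `|rnd y - y| <= u * ((1 + u) ^+ n * X).
  by rewrite (le_trans (h y))// ler_wpM2l.
rewrite (le_trans (lerD hy yx))// exprS.
by rewrite le_eqVlt; apply/orP; left; apply/eqP; ring.
Qed.

Lemma approxD n y x X y' x' X' : fl_approx n y x X -> fl_approx n y' x' X' ->
  fl_approx n (y + y') (x + x') (X + X').
Proof.
move=> [xX yx] [xX' yx']; split; first by rewrite (le_trans (ler_normD _ _))// lerD.
rewrite opprD addrACA (le_trans (ler_normD _ _))// mulrDr.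
exact: lerD.
Qed.

Lemma approxN n y x X : fl_approx n y x X -> fl_approx n (- y) (- x) X.
Proof. by move=> [xX yx]; split; rewrite ?normrN// -opprD normrN. Qed.

Lemma approxM m n y x X y' x' X' : fl_approx m y x X -> fl_approx n y' x' X' ->
  fl_approx (m + n) (y * y') (x * x') (X * X').
Proof.
move=> [xX yx] H'; have ny' := approx_norm H'; case: H' => xX' yx'.
split; first by rewrite normrM ler_pM.
have -> : y * y' - x * x' = (y - x) * y' + x * (y' - x') by ring.
rewrite (le_trans (ler_normD _ _))// !normrM.
rewrite (le_trans (lerD (ler_pM _ _ yx ny') (ler_pM _ _ xX yx')))// exprD.
by rewrite le_eqVlt; apply/orP; left; apply/eqP; ring.
Qed.

Lemma approx_weaken m n y x X : (m <= n)%N -> fl_approx m y x X -> fl_approx n y x X.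
Proof.
move=> mn [xX yx]; split => //; rewrite (le_trans yx)//.
rewrite ler_wpM2r ?(le_trans _ xX)// lerD2r ler_weXn2l// lerDl.
by [].
Qed.

(** Sums of zero terms stay exactly 0, and adding the first remaining product to 0 changes nothing
    since [rnd] is idempotent; only two additions can round. *)
Lemma fl_mul_tridiag (p v : nat -> R) (B : smx R) i j : v 0%N = 0 -> (0 < i)%N ->
  let q x k := rnd (rnd x * rnd (B k j)) in
  fl_mul rnd (smx_tridiag p v) B i j =
  rnd (rnd (q (v i.-1) i.-1 + q (p i) i) + q (v i) i.+1).
Proof.
case: (hrnd) => _ _ _ hid _.
move=> v0 i0 q; rewrite /fl_mul; set A := smx_tridiag p v.
set F := fun t k => _.
have z n : (n < i.-1)%N || (n == 0)%N -> foldl F 0 (iota 1 n) = 0.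
  elim: n => [//|n ih] ni; rewrite -[n.+1]addn1 iotaD foldl_cat ih; last by lia.
  rewrite /= /F; have -> : A i (1 + n)%N = 0.
    by rewrite /A /smx_tridiag; do 3 (case: eqP => [|_]; first lia).
  by rewrite rounding0 mul0r rounding0 addr0 rounding0.
have A1 : A i i = p i by rewrite /A /smx_tridiag eqxx.
have A2 : A i i.+1 = v i by rewrite /A /smx_tridiag eqxx gtn_eqF.
have A0 : A i i.-1 = v i.-1.
  rewrite /A /smx_tridiag prednK// eqxx; do 2 (case: eqP => [|_]; first lia).
  by [].
have -> : iota 1 i.+1 = iota 1 i.-1 ++ [:: i; i.+1].
  by rewrite -[i.+1](_ : i.-1 + 2 = _)%N ?iotaD /=; [congr (_ ++ _); congr [:: _; _]; lia|lia].
have P : foldl F 0 (iota 1 i.-1) = q (v i.-1) i.-1.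
  case E: i.-1 => [|m]; first by rewrite /= /q v0 rounding0 mul0r rounding0.
  have -> : iota 1 m.+1 = iota 1 m ++ [:: m.+1].
    by have := iotaD 1 m 1; rewrite addn1 add1n.
  rewrite foldl_cat z; last by lia.
  by rewrite /= /F add0r -E A0 E /q hid.
by rewrite foldl_cat /= P /F A1 A2.
Qed.

(** Three roundings go into each product, one for each factor and one for the result, and two into
    the additions. *)
Lemma fl_mul_tridiag_approx (p v : nat -> R) (B : smx R) i j :
  v 0%N = 0 -> (0 < i)%N ->
  fl_approx 5 (fl_mul rnd (smx_tridiag p v) B i j)
    (v i.-1 * B i.-1 j + p i * B i j + v i * B i.+1 j)
    (`|v i.-1 * B i.-1 j| + `|p i * B i j| + `|v i * B i.+1 j|).
Proof.
move=> v0 i0; rewrite fl_mul_tridiag//.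
have q x k : fl_approx 3 (rnd (rnd x * rnd (B k j))) (x * B k j) `|x * B k j|.
  apply: approx_rnd; rewrite normrM; apply: (@approxM 1 1);
    by apply: approx_rnd; exact: approx_exact.
apply: approx_rnd; apply: approxD; last by apply: approx_weaken (q _ _).
by apply: approx_rnd; exact: approxD.
Qed.

Lemma eq_fl_mul (A A' B B' : smx R) : smx_eq A A' -> smx_eq B B' ->
  smx_eq (fl_mul rnd A B) (fl_mul rnd A' B').
Proof.
move=> AA BB i j i0 j0; rewrite /fl_mul.
have : all (fun k => 0 < k)%N (iota 1 i.+1).
  by apply/allP => k; rewrite mem_iota => /andP[].
elim: (iota _ _) 0 => //= k l ih t /andP[k0 hl].
by rewrite AA// BB// ih.
Qed.
End Rounding.

(** * Signs and lower bounds that control cancellation *)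

Section ConditioningBounds.
Variables (R : realType) (alpha beta : R).
Hypotheses (alpha_gt : -1 < alpha) (beta_gt : -1 < beta).
Local Notation s := (alpha + beta).
Local Notation a := (jac_a alpha beta).
Local Notation b := (jac_b alpha beta).
Local Notation c := (jac_c alpha beta).
Local Notation e := (jac_e alpha beta).

Lemma jac_a_ge0 n : 0 <= a n.+1.
Proof.
move: (alpha_gt) (beta_gt) => ha hb; case: n => [|n].
  by rewrite /jac_a /= divr_ge0//; lra.
have n0 := ler0n R n; rewrite jac_aSS//; move: (n%:R) n0 => x x0.
(* In terms of [alpha + 1] and [beta + 1] the numerator has only nonnegative coefficients. *)
pose p := alpha + 1; pose q := beta + 1.
have p0 : 0 <= p by rewrite /p; lra.
have q0 : 0 <= q by rewrite /q; lra.
have -> : 1 + (beta ^+ 2 - alpha ^+ 2) / ((2 * x + s + 4) * (2 * x + s + 2)) =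
  (4 * (x * x) + 4 * (x * (p + q)) + 2 * (q * q) + 2 * (p * q) + 4 * x + 4 * p)
  / ((2 * x + s + 4) * (2 * x + s + 2)).
  rewrite /p /q; field; apply/andP; split; apply: lt0r_neq0; lra.
rewrite divr_ge0//; last by rewrite mulr_ge0//; lra.
clearbody p q; by rewrite !addr_ge0 ?mulr_ge0 ?addr_ge0.
Qed.

Lemma jac_c_ge0 n : 0 <= c n.+1.
Proof.
move: (alpha_gt) (beta_gt) => ha hb; case: n => [|n].
  by rewrite /jac_c /= divr_ge0//; lra.
have n0 := ler0n R n; rewrite jac_cE// jac_aSS//; move: (n%:R) n0 => x x0.
pose p := alpha + 1; pose q := beta + 1.
have p0 : 0 <= p by rewrite /p; lra.
have q0 : 0 <= q by rewrite /q; lra.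
have -> : 2 - (1 + (beta ^+ 2 - alpha ^+ 2) / ((2 * x + s + 4) * (2 * x + s + 2))) =
  (4 * (x * x) + 4 * (x * (p + q)) + 2 * (p * p) + 2 * (p * q) + 4 * x + 4 * q)
  / ((2 * x + s + 4) * (2 * x + s + 2)).
  rewrite /p /q; field; apply/andP; split; apply: lt0r_neq0; lra.
rewrite divr_ge0//; last by rewrite mulr_ge0//; lra.
clearbody p q; by rewrite !addr_ge0 ?mulr_ge0 ?addr_ge0.
Qed.

Lemma jac_b_ge0 n : 0 <= b n.
Proof. by case: n => [|n]; [rewrite jac_b0|rewrite ltW// jac_b_gt0]. Qed.

(** From index 2 on, the square is a quotient of two polynomials of degree 4 in [x = n]: the
    numerator is at least [t / (1 + t)] times the fourth power of [x + 1], and the denominator is at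
    most the fourth power of [(x + 1) * (3 + t)]. Index 1 enters through the minimum. *)
Lemma jac_e_sqr_lower : exists2 k : R, 0 < k & forall n, k <= e n.+1 ^+ 2.
Proof.
move: (alpha_gt) (beta_gt) => ha hb.
pose t := s + 2; have t0 : 0 < t by rewrite /t; lra.
pose k := 4 * (t / ((1 + t) * (3 + t) ^+ 4)).
have k0 : 0 < k by rewrite mulr_gt0// divr_gt0 ?mulr_gt0 ?exprn_gt0//; lra.
have e0 : 0 < e 1 ^+ 2 by rewrite exprn_gt0// jac_e_gt0.
exists (Num.min (e 1 ^+ 2) k) => [|[|n]].
- by rewrite lt_min e0 k0.
- by rewrite ge_min lexx.
rewrite ge_min; apply/orP; right; rewrite jac_e_sqr// /k ler_pM2l//.
rewrite /jac_e_arg jac_ratioS -[n.+2%:R]natr1 -[n.+1%:R]natr1; have n0 := ler0n R n.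
move: (n%:R) n0 => x x0.
have [p1 q1] : x + 1 <= x + 1 + 1 + alpha /\ x + 1 <= x + 1 + 1 + beta by split; lra.
have r1 : x + 1 <= x + 1 + s + 2 by lra.
have r2 : (x + 1) * (t / (1 + t)) <= x + t.
  rewrite mulrA ler_pdivrMr; last by lra.
  have tt : 0 <= t * t by rewrite mulr_ge0// ltW.
  rewrite -subr_ge0.
  have -> : (x + t) * (1 + t) - (x + 1) * t = x + t * t by ring.
  exact: addr_ge0.
have D0 : 0 < (2 * x + s + 4) ^+ 2 * (2 * x + s + 3) * (2 * x + s + 5).
  by rewrite !mulr_gt0 ?exprn_gt0//; lra.
have -> : (x + 1 + 1 + alpha) * (x + 1 + 1 + beta) * (x + 1 + s + 2) /
  ((2 * x + s + 4) * (2 * x + s + 3) / (x + s + 2) *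
   (2 * (x + 1) + s + 2) * (2 * (x + 1) + s + 3)) =
  ((x + 1 + 1 + alpha) * (x + 1 + 1 + beta) * (x + 1 + s + 2) * (x + t))
  / ((2 * x + s + 4) ^+ 2 * (2 * x + s + 3) * (2 * x + s + 5)).
  by rewrite /t; field; do ?[apply/andP; split]; apply: lt0r_neq0; lra.
rewrite ler_pdivlMr//.
have y0 : 0 <= x + 1 by lra.
apply: (@le_trans _ _ ((x + 1) * (x + 1) * (x + 1) * ((x + 1) * (t / (1 + t))))); last first.
  have tt0 : 0 <= t / (1 + t) by rewrite divr_ge0//; lra.
  apply: ler_pM r2; [by rewrite !mulr_ge0|exact: mulr_ge0|].
  by apply: ler_pM r1; [exact: mulr_ge0| |exact: ler_pM].
have E : (x + 1) * (x + 1) * (x + 1) * ((x + 1) * (t / (1 + t))) =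
    t / ((1 + t) * (3 + t) ^+ 4) * ((x + 1) * (3 + t)) ^+ 4.
  by field; apply/andP; split; apply: lt0r_neq0; lra.
rewrite E ler_wpM2l ?divr_ge0 ?mulr_ge0 ?exprn_ge0//; try lra.
have xt : 0 <= x * t by rewrite mulr_ge0// ltW.
have h v : v <= 2 * x + s + 5 -> v <= (x + 1) * (3 + t).
  move=> hv; have -> : (x + 1) * (3 + t) = 3 * x + 3 + x * t + t by ring.
  have tE : t = s + 2 by [].
  by move: (x * t) xt => z z0; lra.
have -> : ((x + 1) * (3 + t)) ^+ 4 = ((x + 1) * (3 + t)) ^+ 2
  * ((x + 1) * (3 + t)) * ((x + 1) * (3 + t)) by ring.
have d3 : 0 <= 2 * x + s + 3 by lra.
have d4 : 0 <= 2 * x + s + 4 by lra.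
have d5 : 0 <= 2 * x + s + 5 by lra.
apply: ler_pM; rewrite ?mulr_ge0 ?exprn_ge0// ?h//; try lra.
apply: ler_pM; rewrite ?mulr_ge0 ?exprn_ge0// ?h//; try lra.
by apply: lerXn2r; rewrite ?nnegrE ?h//; lra.
Qed.

Lemma jac_offdiag_zero n : c n.+2 = a n.+1 -> a n.+1 = 1 /\ a n.+2 = 1.
Proof.
move: (alpha_gt) (beta_gt) => ha hb E.
have E2 : c n.+2 - a n.+1 = 0 by rewrite E subrr.
have E3 : a n.+2 = 2 - a n.+1 by rewrite -E jac_cE//; ring.
rewrite E3; suff -> : a n.+1 = 1 by split => //; ring.
case: n E2 {E E3} => [|n].
  rewrite jac_offdiag_factor1// => /eqP; rewrite mulf_eq0 invr_eq0.
  rewrite (gt_eqF (_ : 0 < s + 4)) ?orbF; last by lra.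
  rewrite mulf_eq0 pnatr_eq0 /= subr_eq0 => /eqP ->.
  by rewrite /jac_a /=; field; apply: lt0r_neq0; lra.
have n0 := ler0n R n.
rewrite jac_offdiag_factorSS// => /eqP; rewrite mulf_eq0 invr_eq0.
rewrite (gt_eqF (_ : 0 < (2 * n%:R + s + 6) * (2 * n%:R + s + 2))) ?orbF; last first.
  by rewrite mulr_gt0//; lra.
rewrite mulf_eq0 pnatr_eq0 /= subr_eq0 => /eqP E.
by rewrite jac_aSS// E subrr mul0r addr0.
Qed.

Lemma jac_offdiag_lower : exists2 k : R, 0 <= k & forall n,
  c n.+2 != a n.+1 -> 4 <= k * (n.+1 * n.+2)%:R * `|c n.+2 - a n.+1|.
Proof.
move: (alpha_gt) (beta_gt) => ha hb.
(* One constant for the first pair and one for all later pairs. If a denominator is 0 the quotient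
   is 0 by convention, and the corresponding pairs are excluded by [c n.+2 != a n.+1]. *)
pose k1 := 4 / `|c 2 - a 1|.
pose k2 := 2 * (s + 6) ^+ 2 / `|alpha ^+ 2 - beta ^+ 2|.
have k10 : 0 <= k1 by rewrite divr_ge0.
have k20 : 0 <= k2 by rewrite divr_ge0// mulr_ge0// sqr_ge0.
exists (k1 + k2) => [|[|n] ne]; first exact: addr_ge0.
- have c0 : 0 < `|c 2 - a 1| by rewrite normr_gt0 subr_eq0.
  apply: (@le_trans _ _ (k1 * (1 * 2)%:R * `|c 2 - a 1|)); last first.
    by rewrite ler_wpM2r// ler_wpM2r// lerDl.
  rewrite /k1 mulrAC divfK ?lt0r_neq0// -[leLHS]mulr1 ler_wpM2l//.
  by rewrite mul1n ler1n.
have n0 := ler0n R n.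
have := ne; rewrite -subr_eq0 jac_offdiag_factorSS// => ne'.
have q0 : 0 < `|alpha ^+ 2 - beta ^+ 2|.
  by rewrite normr_gt0; apply: contraNneq ne' => ->; rewrite mulr0 mul0r.
have D0 : 0 < (2 * n%:R + s + 6) * (2 * n%:R + s + 2) by rewrite mulr_gt0//; lra.
rewrite normf_div normrM (ger0_norm (ltW D0)) ger0_norm//.
apply: (@le_trans _ _ (k2 * (n.+2 * n.+3)%:R * (2 * `|alpha ^+ 2 - beta ^+ 2|
    / ((2 * n%:R + s + 6) * (2 * n%:R + s + 2))))); last first.
  apply: ler_wpM2r; first by rewrite divr_ge0 ?(ltW D0)// mulr_ge0.
  by apply: ler_wpM2r => //; rewrite lerDr.
have -> : k2 * (n.+2 * n.+3)%:R * (2 * `|alpha ^+ 2 - beta ^+ 2|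
    / ((2 * n%:R + s + 6) * (2 * n%:R + s + 2))) =
  4 * (((s + 6) * n.+2%:R) * ((s + 6) * n.+3%:R)
    / ((2 * n%:R + s + 6) * (2 * n%:R + s + 2))).
  by rewrite /k2 natrM; field; do ?[apply/andP; split]; apply: lt0r_neq0; lra.
rewrite ler_peMr// ler_pdivlMr// mul1r -[n.+3%:R]natr1 -[n.+2%:R]natr1 -[n.+1%:R]natr1.
have sn : 0 <= (s + 4) * n%:R by rewrite mulr_ge0//; lra.
apply: ler_pM; lra.
Qed.

(** From index 2 on the numbers [a n - 1] share one sign, so their absolute values add up to that of
    [c n.+2 - a n.+1]; only the first pair needs its own constant. *)
Lemma jac_offdiag_same_sign : exists2 k : R, 0 <= k & forall n,
  `|a n.+1 - 1| + `|a n.+2 - 1| <= k * `|c n.+2 - a n.+1|.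
Proof.
move: (alpha_gt) (beta_gt) => ha hb.
pose k1 := (`|a 1 - 1| + `|a 2 - 1|) / `|c 2 - a 1|.
have k10 : 0 <= k1 by rewrite divr_ge0// addr_ge0.
exists (k1 + 1) => [|n]; first exact: addr_ge0.
have [E|ne] := eqVneq (c n.+2) (a n.+1).
  have [-> ->] := jac_offdiag_zero E.
  by rewrite subrr normr0 addr0 mulr_ge0// addr_ge0.
case: n ne => [|n] ne.
  have c0 : 0 < `|c 2 - a 1| by rewrite normr_gt0 subr_eq0.
  apply: (@le_trans _ _ (k1 * `|c 2 - a 1|)); last by rewrite ler_wpM2r// lerDl.
  by rewrite /k1 divfK ?lt0r_neq0.
apply: (@le_trans _ _ (1 * `|c n.+3 - a n.+2|)); last first.
  by rewrite ler_wpM2r// lerDr.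
rewrite mul1r jac_cE//.
have -> : `|2 - a n.+3 - a n.+2| = `|(a n.+2 - 1) + (a n.+3 - 1)|.
  by rewrite -normrN; congr Num.norm; ring.
have n0 := ler0n R n; have n1 := ler0n R n.+1.
have E m : a m.+2 - 1 = (beta ^+ 2 - alpha ^+ 2)
    * ((2 * m%:R + s + 4) * (2 * m%:R + s + 2))^-1.
  by rewrite jac_aSS//; ring.
have D0 m : 0 <= ((2 * m%:R + s + 4) * (2 * m%:R + s + 2))^-1.
  by have m0 := ler0n R m; rewrite invr_ge0 mulr_ge0//; lra.
rewrite !E -mulrDr !normrM -mulrDr (ger0_norm (D0 n)) (ger0_norm (D0 n.+1)).
by rewrite (ger0_norm (addr_ge0 (D0 n) (D0 n.+1))).
Qed.
End ConditioningBounds.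

(** * Multiplication matrices *)

Section TridiagonalProducts.
Variable R : realType.

Lemma smx_tridiag_bandwidth (u v : nat -> R) : smx_bandwidth 1 (smx_tridiag u v).
Proof.
move=> i j i0 j0 ij; rewrite /smx_tridiag.
by do 3 (case: eqP => [|_]; first lia).
Qed.

Lemma smx_tridiag_diag (u v : nat -> R) n : smx_tridiag u v n n = u n.
Proof. by rewrite /smx_tridiag eqxx. Qed.

Lemma smx_tridiag_super (u v : nat -> R) n : smx_tridiag u v n n.+1 = v n.
Proof. by rewrite /smx_tridiag eqxx gtn_eqF. Qed.

Lemma smx_tridiag_sub (u v : nat -> R) n : smx_tridiag u v n.+1 n = v n.
Proof. by rewrite /smx_tridiag eqxx !ltn_eqF// leqW. Qed.

Lemma smx_tridiag_super2 (u v : nat -> R) n : smx_tridiag u v n n.+2 = 0.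
Proof. by rewrite /smx_tridiag; do ?(case: eqP => [|_]; first lia). Qed.

Lemma smx_tridiag_sub2 (u v : nat -> R) n : smx_tridiag u v n.+2 n = 0.
Proof. by rewrite /smx_tridiag; do ?(case: eqP => [|_]; first lia). Qed.

Definition smx_tridiagE := (smx_tridiag_diag, smx_tridiag_super,
  smx_tridiag_sub, smx_tridiag_super2, smx_tridiag_sub2).

Lemma smx_tridiag_row_finite (u v : nat -> R) :
  smx_row_finite 1 (smx_tridiag u v).
Proof. exact/smx_bandwidth_row_finite/smx_tridiag_bandwidth. Qed.

Lemma smx_mul_tridiagE (u v : nat -> R) B i j : v 0 = 0 -> (0 < i)%N ->
  smx_mul (smx_tridiag u v) B i j =
  v i.-1 * B i.-1 j + u i * B i j + v i * B i.+1 j.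
Proof.
move=> v0 i0; have hT := @smx_tridiag_row_finite u v.
have iN : (i + 1 < i.+2)%N by rewrite addn1.
rewrite (smx_mul_row_finiteE _ _ hT i0 iN).
exact: (@sum_tridiag _ R^o u v (B ^~ j)).
Qed.

Lemma normr_sum3_same_sign (sg x y z : R) : `|sg| = 1 ->
  0 <= sg * x -> 0 <= sg * y -> 0 <= sg * z ->
  `|x| + `|y| + `|z| = `|x + y + z|.
Proof.
move=> s1 x0 y0 z0; have N w : `|w| = `|sg * w| by rewrite normrM s1 mul1r.
rewrite (N x) (N y) (N z) (N (x + y + z)) !mulrDr.
by rewrite !ger0_norm ?addr_ge0.
Qed.

(** At distance at least 2 from the diagonal at most one of the three products is nonzero, so no
    cancellation can occur. *)
Lemma sumabs_far (u v : nat -> R) (B : smx R) i j : smx_bandwidth 1 B ->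
  v 0 = 0 -> (0 < i)%N -> (0 < j)%N -> (i.+1 < j)%N || (j.+1 < i)%N ->
  `|v i.-1 * B i.-1 j| + `|u i * B i j| + `|v i * B i.+1 j| =
  `|v i.-1 * B i.-1 j + u i * B i j + v i * B i.+1 j|.
Proof.
move=> hB v0 i0 j0 ij; rewrite (hB i j)//; last by lia.
have [h|h] := ltnP i.+1 j.
  have -> : v i.-1 * B i.-1 j = 0.
    case: i i0 h ij => // -[|n] _ h _ /=; first by rewrite v0 mul0r.
    by rewrite hB ?mulr0//; lia.
  by rewrite mulr0 normr0 !add0r.
by rewrite (hB i.+1 j)//; [rewrite !mulr0 normr0 !addr0|lia].
Qed.

End TridiagonalProducts.

Section MultiplicationMatrices.
Variables (R : realType) (alpha beta : R) (P : nat -> {poly R}).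
Hypotheses (alpha_gt : -1 < alpha) (beta_gt : -1 < beta).
Hypothesis hP : is_jacobi alpha beta P.
Local Notation mm := (mulmat alpha beta P).
Local Notation a := (jac_a alpha beta).
Local Notation b := (jac_b alpha beta).
Local Notation c := (jac_c alpha beta).
Local Notation d := (jac_d alpha beta).
Local Notation e := (jac_e alpha beta).
Local Notation f := (jac_f alpha beta).
Local Notation g := (jac_g alpha beta).
Local Notation J1 := (smx_tridiag a b).
Local Notation J2 := (smx_tridiag c d).

Lemma jac_d0 : d 0 = 0.
Proof. by rewrite jac_dE jac_b0 oppr0. Qed.

Lemma mulmat_mul_add p : smx_eq (mm ((1 + 'X) * p)) (smx_mul J1 (mm p)).
Proof.
move=> i j i0 j0; rewrite mulmat_mulX// smx_mul_tridiagE ?jac_b0//.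
exact: (@sum_tridiag _ R^o a b (fun k => mm p k j) _ (jac_b0 _ _) i0).
Qed.

Lemma mulmat_mul_sub p : smx_eq (mm ((1 - 'X) * p)) (smx_mul J2 (mm p)).
Proof.
move=> i j i0 j0.
have -> : (1 - 'X) * p = 2 *: p + (-1) *: ((1 + 'X) * p).
  by rewrite -!mul_polyC !rmorphN !rmorph1 rmorph_nat; ring.
rewrite mulmatD// !mulmatZ// mulmat_mul_add//.
rewrite !smx_mul_tridiagE ?jac_b0 ?jac_d0// !jac_dE jac_cE//; ring.
Qed.

Lemma mulmat_add : smx_eq (mm (1 + 'X)) J1.
Proof.
rewrite -[1 + 'X]mulr1; apply: smx_eq_trans (mulmat_mul_add _) _.
apply: smx_eq_trans (smx_mul1r _).
by apply: eq_smx_mul => //; exact: mulmat1.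
Qed.

Lemma mulmat_sub : smx_eq (mm (1 - 'X)) J2.
Proof.
rewrite -[1 - 'X]mulr1; apply: smx_eq_trans (mulmat_mul_sub _) _.
apply: smx_eq_trans (smx_mul1r _).
by apply: eq_smx_mul => //; exact: mulmat1.
Qed.

Lemma mulmat_X : smx_eq (mm 'X) (smx_tridiag (fun n => a n - 1) b).
Proof.
move=> i j i0 j0.
have -> : 'X = (1 + 'X) + (-1) *: 1 :> {poly R}.
  by rewrite -mul_polyC rmorphN rmorph1; ring.
rewrite mulmatD// mulmatZ// mulmat_add// mulmat1// /smx_id /smx_tridiag.
rewrite eq_sym; case: eqP => [->|_]; first by rewrite mulr1.
by rewrite mulr0 addr0.
Qed.

Lemma mulmat_mul_sqr p : smx_eq (mm ((1 - 'X ^+ 2) * p))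
  (smx_mul (mm (1 - 'X ^+ 2)) (mm p)).
Proof.
have E : 1 - 'X ^+ 2 = (1 + 'X) * (1 - 'X) :> {poly R} by ring.
rewrite E -mulrA.
apply: smx_eq_trans (mulmat_mul_add _) _.
apply: smx_eq_trans (eq_smx_mul (smx_eq_refl _) (mulmat_mul_sub _)) _.
apply: smx_eq_trans
  (smx_eq_sym (smx_mulA _ (smx_tridiag_row_finite a b) (smx_tridiag_row_finite c d))) _.
apply: eq_smx_mul => //; apply: smx_eq_sym.
apply: smx_eq_trans (mulmat_mul_add _) _.
by apply: eq_smx_mul => //; exact: mulmat_sub.
Qed.

(** The product in one order is the matrix of a polynomial, hence symmetric; its transpose is the
    product in the other order. *)
Lemma mulmat_sqr_commute p : smx_eq (smx_mul (mm (1 - 'X ^+ 2)) (mm p))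
  (smx_mul (mm p) (mm (1 - 'X ^+ 2))).
Proof.
move=> i j i0 j0; rewrite -mulmat_mul_sqr// (mulmatC _ _ _ _ i j)// mulmat_mul_sqr//.
rewrite -[LHS]/(smx_tr (smx_mul _ _) i j) smx_tr_mul.
by apply: eq_smx_mul => // k l k0 l0; rewrite /smx_tr mulmatC.
Qed.

Lemma mulmat_products :
  [/\ smx_eq (mm (1 - 'X ^+ 2)) (smx_mul (mm (1 + 'X)) (mm (1 - 'X))),
      smx_eq (mm ((1 + 'X) ^+ 2)) (smx_mul (mm (1 + 'X)) (mm (1 + 'X)))
    & smx_eq (mm ((1 - 'X) ^+ 2)) (smx_mul (mm (1 - 'X)) (mm (1 - 'X)))].
Proof.
split.
- have -> : 1 - 'X ^+ 2 = (1 + 'X) * (1 - 'X) :> {poly R} by ring.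
  apply: smx_eq_trans (mulmat_mul_add _) _.
  by apply: eq_smx_mul => //; apply: smx_eq_sym; exact: mulmat_add.
- rewrite expr2; apply: smx_eq_trans (mulmat_mul_add _) _.
  by apply: eq_smx_mul => //; apply: smx_eq_sym; exact: mulmat_add.
- rewrite expr2; apply: smx_eq_trans (mulmat_mul_sub _) _.
  by apply: eq_smx_mul => //; apply: smx_eq_sym; exact: mulmat_sub.
Qed.

Lemma mulmat_sqrE : smx_eq (mm (1 - 'X ^+ 2)) (smx_mul J1 J2).
Proof.
have [E _ _] := mulmat_products; apply: smx_eq_trans E _.
by apply: eq_smx_mul; [exact: mulmat_add|exact: mulmat_sub].
Qed.

Lemma mulmat_sym p : smx_sym (mm p).
Proof. by move=> i j _ _; rewrite /smx_tr mulmatC. Qed.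

Lemma mulmat_sqr_pentadiag :
  [/\ smx_pentadiag (mm (1 - 'X ^+ 2)), smx_pentadiag (mm ((1 + 'X) ^+ 2))
    & smx_pentadiag (mm ((1 - 'X) ^+ 2))].
Proof.
have [E1 E2 E3] := mulmat_products.
have h1 := smx_bandwidth_eq mulmat_add (smx_tridiag_bandwidth a b).
have h2 := smx_bandwidth_eq mulmat_sub (smx_tridiag_bandwidth c d).
split.
- exact: smx_bandwidth_eq E1 (smx_bandwidth_mul h1 h2).
- exact: smx_bandwidth_eq E2 (smx_bandwidth_mul h1 h1).
- exact: smx_bandwidth_eq E3 (smx_bandwidth_mul h2 h2).
Qed.

Lemma mulmat_sqr_diag n : mm (1 - 'X ^+ 2) n.+1 n.+1 =
  a n.+1 * c n.+1 - b n ^+ 2 - b n.+1 ^+ 2.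
Proof.
rewrite mulmat_sqrE// smx_mul_tridiagE ?jac_b0//= !smx_tridiagE !jac_dE; ring.
Qed.

Lemma mulmat_sqr_super1 n : mm (1 - 'X ^+ 2) n.+1 n.+2 =
  b n.+1 * (c n.+2 - a n.+1).
Proof.
rewrite mulmat_sqrE// smx_mul_tridiagE ?jac_b0//= /smx_tridiag !eqxx.
have -> : (n.+2 == n) = false by lia.
have -> : (n.+2 == n.+1) = false by lia.
have -> : (n == n.+3) = false by lia.
rewrite !jac_dE; ring.
Qed.

Lemma mulmat_sqr_super2 n : mm (1 - 'X ^+ 2) n.+1 n.+3 = - (b n.+1 * b n.+2).
Proof.
rewrite mulmat_sqrE// smx_mul_tridiagE ?jac_b0//= /smx_tridiag !eqxx.
have -> : (n.+3 == n) = false by lia.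
have -> : (n.+3 == n.+1) = false by lia.
have -> : (n.+3 == n.+2) = false by lia.
have -> : (n == n.+4) = false by lia.
have -> : (n.+1 == n.+4) = false by lia.
rewrite !jac_dE; ring.
Qed.

(** By symmetry only [i <= j] matters. The cases [j - i = 0, 1, 2] are [jac_diag], [jac_offdiag] and
    [jac_eg]; all further entries vanish by the bandwidth. *)
Lemma mulmat_cholesky : is_cholesky (mm (1 - 'X ^+ 2)) (smx_upper3 e f g).
Proof.
set R0 := smx_upper3 e f g.
have uR : smx_upper R0 := smx_upper3_upper e f g.
split => //.
  by case=> // n _; rewrite /R0 /smx_upper3 eqxx jac_e_gt0.
move=> i j i0 j0.
wlog ij : i j i0 j0 / (i <= j)%N.
  move=> H; have [/H ->//|/ltnW ji] := leqP i j.
  rewrite mulmatC// -H// -[RHS]/(smx_tr (smx_mul _ _) i j) smx_tr_mul.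
  by [].
rewrite (@smx_mulE _ _ _ _ _ i.+1)//; last first.
  by move=> k ik; rewrite /smx_tr uR ?mul0r.
rewrite -[LHS]/(\sum_(1 <= k < i.+1) smx_upper3 e f g k i * R0 k j).
rewrite sum_upper3_col//.
case: i i0 ij => // n _ nj /=.
have [m -> {j j0 nj}] : exists m, j = (n.+1 + m)%N by exists (j - n.+1)%N; lia.
rewrite /R0 /smx_upper3; case: m => [|[|[|m]]].
- rewrite addn0 !eqxx mulmat_sqr_diag jac_diag//.
  have -> : (n.+1 == n) = false by lia.
  case: n => [|n]; first by rewrite /= jac_f0 jac_g0 !mul0r; ring.
  have -> : (n.+2 == n) = false by lia.
  have -> : (n.+2 == n.+1) = false by lia.
  by rewrite /= !eqxx; ring.
- rewrite addn1 !eqxx mulmat_sqr_super1 jac_offdiag//.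
  have -> : (n.+2 == n.+1) = false by lia.
  have -> : (n.+2 == n) = false by lia.
  case: n => [|n]; first by rewrite /= jac_f0 jac_g0 !mul0r; ring.
  have -> : (n.+3 == n) = false by lia.
  have -> : (n.+3 == n.+1) = false by lia.
  have -> : (n.+3 == n.+2) = false by lia.
  by rewrite /=; ring.
- rewrite addn2 !eqxx mulmat_sqr_super2 -jac_eg//.
  do ?(case: eqP => [|_]; first lia).
  case: n => [|n]; first by rewrite /= jac_g0; ring.
  do ?(case: eqP => [|_]; first lia).
  by rewrite /=; ring.
have [h _ _] := mulmat_sqr_pentadiag.
rewrite h//; try lia.
do ?(case: eqP => [|_]; first lia).
by rewrite !mulr0 !addr0.
Qed.

Lemma jac_tridiag_add_ge0 i j : (0 < j)%N -> 0 <= J1 i j.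
Proof.
move=> j0; rewrite /smx_tridiag; case: eqP => [<-|_].
  by case: j j0 => // n _; exact: jac_a_ge0.
by do ?case: eqP => _; rewrite ?jac_b_ge0.
Qed.

(** The signs form a checkerboard, so all terms of an entry of the square of [J2] have the same
    sign. *)
Lemma jac_tridiag_sub_sign i j : (0 < j)%N -> 0 <= (-1) ^+ (i + j) * J2 i j.
Proof.
move=> j0; rewrite /smx_tridiag; case: eqP => [<-|_].
  rewrite -signr_odd oddD addbb expr0 mul1r.
  by case: j j0 => // n _; exact: jac_c_ge0.
case: eqP => [->|_].
  by rewrite -signr_odd oddD /= addbN addbb jac_dE mulN1r opprK jac_b_ge0.
case: eqP => [->|_]; last by rewrite mulr0.
by rewrite -signr_odd oddD /= addNb addbb jac_dE mulN1r opprK jac_b_ge0.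
Qed.

(** The terms are nonnegative, so the sum of their absolute values is the entry itself and the
    absolute bound becomes relative. *)
Lemma fl_mul_add_sqr u rnd : is_rounding u rnd ->
  cw_rel_error_le (fun _ _ => (1 + u) ^+ 5 - 1)
    (fl_mul rnd (mm (1 + 'X)) (mm (1 + 'X))) (mm ((1 + 'X) ^+ 2)).
Proof.
move=> hr i j i0 j0; have [_ E _] := mulmat_products.
rewrite (eq_fl_mul _ mulmat_add mulmat_add)// E//.
rewrite (eq_smx_mul mulmat_add mulmat_add)// smx_mul_tridiagE ?jac_b0//.
have [_] := fl_mul_tridiag_approx hr a J1 j (jac_b0 alpha beta) i0.
rewrite (@normr_sum3_same_sign _ 1) ?normr1// !mul1r mulr_ge0 ?jac_b_ge0//;
  rewrite ?jac_tridiag_add_ge0//.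
by case: i i0 => // n _; exact: jac_a_ge0.
Qed.

Lemma fl_mul_sub_sqr u rnd : is_rounding u rnd ->
  cw_rel_error_le (fun _ _ => (1 + u) ^+ 5 - 1)
    (fl_mul rnd (mm (1 - 'X)) (mm (1 - 'X))) (mm ((1 - 'X) ^+ 2)).
Proof.
move=> hr i j i0 j0; have [_ _ E] := mulmat_products.
rewrite (eq_fl_mul _ mulmat_sub mulmat_sub)// E//.
rewrite (eq_smx_mul mulmat_sub mulmat_sub)// smx_mul_tridiagE ?jac_d0//.
have [_] := fl_mul_tridiag_approx hr c J2 j jac_d0 i0.
rewrite (@normr_sum3_same_sign _ ((-1) ^+ (i + j))) ?normrX ?normrN1 ?expr1n//.
- case: i i0 => // n _ /=; rewrite jac_dE mulNr mulrN addSn exprS mulN1r mulNr opprK.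
  by rewrite mulrCA mulr_ge0 ?jac_b_ge0 ?jac_tridiag_sub_sign.
- rewrite mulrCA mulr_ge0 ?jac_tridiag_sub_sign//.
  by case: i i0 => // n _; exact: jac_c_ge0.
- have := jac_tridiag_sub_sign i.+1 j0; rewrite addSn exprS mulN1r mulNr => h.
  by rewrite jac_dE mulNr mulrN mulrCA -mulrN mulr_ge0 ?jac_b_ge0.
Qed.

Local Notation M := (mm (1 - 'X ^+ 2)).

Lemma mulmat_sqr_diag_lower : exists2 k : R, 0 < k & forall n, k <= M n.+1 n.+1.
Proof.
have [k k0 hk] := jac_e_sqr_lower alpha_gt beta_gt.
exists k => // n; rewrite mulmat_sqr_diag jac_diag// (le_trans (hk n))//.
by rewrite -addrA lerDl addr_ge0 ?sqr_ge0.
Qed.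

(** Bounds the condition number of the three-term sum: it is uniform on the diagonal and far from
    it, and grows at most like [i * j] next to the diagonal. *)
Lemma jac_sumabs_product : exists2 k : R, 0 <= k & forall i j,
  (0 < i)%N -> (0 < j)%N -> ((i == j.+1) || (j == i.+1) -> M i j != 0) ->
  `|b i.-1 * J2 i.-1 j| + `|a i * J2 i j| + `|b i * J2 i.+1 j| <=
  k * (if (i == j.+1) || (j == i.+1) then (i * j)%:R else 1) * `|M i j|.
Proof.
have [k1 k10 h1] := mulmat_sqr_diag_lower.
have [k2 k20 h2] := jac_offdiag_lower alpha_gt beta_gt.
have pa := jac_a_ge0 alpha_gt beta_gt; have pb := jac_b_ge0 alpha_gt beta_gt.
have pc := jac_c_ge0 alpha_gt beta_gt.
have a2 n : a n.+1 <= 2.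
  by have := jac_c_ge0 alpha_gt beta_gt n; rewrite jac_cE// subr_ge0.
have c2 n : c n.+1 <= 2.
  by rewrite jac_cE// lerBlDr lerDl; exact: jac_a_ge0.
have k1V : 0 <= 2 / k1 by rewrite divr_ge0// ltW.
have K0 : 0 <= 2 / k1 + k2 + 1 by rewrite !addr_ge0.
have off n t : t <= 4 -> M n.+1 n.+2 != 0 -> b n.+1 * t <=
    (2 / k1 + k2 + 1) * (n.+1 * n.+2)%:R * `|M n.+1 n.+2|.
  move=> t4; rewrite mulmat_sqr_super1 mulf_eq0 negb_or => /andP[_]; rewrite subr_eq0 => ne.
  have bn := jac_b_ge0 alpha_gt beta_gt n.+1.
  rewrite normrM (ger0_norm bn) mulrCA ler_wpM2l//.
  rewrite (le_trans t4)// (le_trans (h2 n ne))// ler_wpM2r// ler_wpM2r//.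
  by rewrite -addrA addrCA lerDl addr_ge0.
(* The three summands serve the diagonal, the entries next to it and the remaining ones. *)
exists (2 / k1 + k2 + 1) => // i j i0 j0 nz.
have [far|near] := boolP ((i.+1 < j)%N || (j.+1 < i)%N).
  have -> : (i == j.+1) || (j == i.+1) = false by lia.
  rewrite sumabs_far ?jac_b0//; last exact: smx_tridiag_bandwidth.
  rewrite mulmat_sqrE// smx_mul_tridiagE ?jac_b0//.
  by rewrite ler_peMl// mulr1 lerDr addr_ge0.
have : [\/ i = j, j = i.+1 | i = j.+1].
  have : (i == j) || (j == i.+1) || (i == j.+1) by lia.
  by move=> /orP[/orP[]|] /eqP ->; [constructor 1|constructor 2|constructor 3].
case=> ij.
- move: ij i0 nz near => <- {j j0}; case: i => // n _ _ _.
  have -> : (n.+1 == n.+2) || (n.+1 == n.+2) = false by lia.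
  rewrite mulr1; apply: (@le_trans _ _ (2 / k1 * `|M n.+1 n.+1|)); last first.
    by rewrite ler_wpM2r// -addrA lerDl addr_ge0.
  have Mp : k1 <= M n.+1 n.+1 := h1 n.
  rewrite (ger0_norm (le_trans (ltW k10) Mp)).
  apply: (@le_trans _ _ 2); last first.
    by rewrite mulrAC ler_pdivlMr// ler_wpM2l.
  (* Since the diagonal entry is nonnegative, the subtracted squares are at most [a * c], which is
     at most 1 because [c = 2 - a]; the absolute values therefore sum to at most 2. *)
  have E : b n ^+ 2 + b n.+1 ^+ 2 <= a n.+1 * c n.+1.
    have := le_trans (ltW k10) Mp; rewrite mulmat_sqr_diag.
    by move: (a _ * c _) (b n ^+ 2) (b n.+1 ^+ 2) => *; lra.
  have ac : a n.+1 * c n.+1 <= 1.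
    rewrite jac_cE// -subr_ge0.
    have -> : 1 - a n.+1 * (2 - a n.+1) = (a n.+1 - 1) ^+ 2 by ring.
    exact: sqr_ge0.
  rewrite /= !smx_tridiagE.
  rewrite !jac_dE !mulrN !normrN -!expr2 !(ger0_norm (sqr_ge0 _)).
  rewrite ger0_norm ?mulr_ge0 ?jac_a_ge0 ?jac_c_ge0//.
  by move: (a _ * c _) (b n ^+ 2) (b n.+1 ^+ 2) E ac => *; lra.
- rewrite ij eqxx orbT in nz *; have {nz} := nz isT.
  case: i i0 near ij => // n _ _ _ nz.
  have t4 : a n.+1 + c n.+2 <= 4 by have := a2 n; have := c2 n.+1; lra.
  apply: le_trans (off n _ t4 nz); rewrite /= !smx_tridiagE.
  rewrite jac_dE mulr0 normr0 add0r mulrN normrN.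
  rewrite (ger0_norm (mulr_ge0 (pa n) (pb n.+1))).
  rewrite (ger0_norm (mulr_ge0 (pb n.+1) (pc n.+1))).
  by rewrite mulrDr [a n.+1 * b _]mulrC.
- rewrite ij eqxx /= in nz *; have {nz} := nz isT.
  case: j j0 near ij => // n _ _ _; rewrite mulmatC// mulnC => nz.
  have t4 : c n.+1 + a n.+2 <= 4 by have := a2 n.+1; have := c2 n; lra.
  apply: le_trans (off n _ t4 nz); rewrite /= !smx_tridiagE.
  rewrite jac_dE mulr0 normr0 addr0 mulrN normrN.
  rewrite (ger0_norm (mulr_ge0 (pb n.+1) (pc n))).
  rewrite (ger0_norm (mulr_ge0 (pa n.+1) (pb n.+1))).
  by rewrite mulrDr [a n.+2 * b _]mulrC.
Qed.

(* When an entry next to the diagonal vanishes, the two products it sums are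
   opposite, and so are their computed values since one factor is 1. *)
Lemma fl_mul_add_sub_zero u rnd i j : is_rounding u rnd ->
  (0 < i)%N -> (0 < j)%N -> (i == j.+1) || (j == i.+1) -> M i j = 0 ->
  fl_mul rnd J1 J2 i j = 0.
Proof.
move=> hr i0 j0 ij Mij; have r0 := rounding0 hr.
have [_ _ rN rid r1] := hr.
have Z n : M n.+1 n.+2 = 0 -> a n.+1 = 1 /\ a n.+2 = 1.
  rewrite mulmat_sqr_super1 => /eqP; rewrite mulf_eq0.
  rewrite (gt_eqF (jac_b_gt0 alpha_gt beta_gt n)) /= subr_eq0 => /eqP.
  exact: jac_offdiag_zero.
rewrite (fl_mul_tridiag hr)// ?jac_b0//.
move: ij => /orP[] /eqP ij; subst.
  case: j j0 Mij i0 => // n _; rewrite mulmatC// => /Z[a1 a2] _ /=.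
  rewrite /= !smx_tridiagE.
  rewrite jac_dE !jac_cE// a1 a2 (_ : 2 - 1 = 1); last by ring.
  rewrite !(rN, r1, mulr1, mul1r, rid, r0, mulr0, addr0).
  by rewrite subrr r0.
case: i i0 Mij j0 => // n _ /Z[a1 a2] _ /=.
rewrite /= !smx_tridiagE.
rewrite jac_dE !jac_cE// a1 a2 (_ : 2 - 1 = 1); last by ring.
rewrite !(rN, r1, mulr1, mul1r, rid, r0, mulr0, add0r).
by rewrite addNr r0.
Qed.

End MultiplicationMatrices.

Section SquaredMatrix.
Variables (R : realType) (alpha beta : R) (P : nat -> {poly R}).
Hypotheses (alpha_gt : -1 < alpha) (beta_gt : -1 < beta).
Hypothesis hP : is_jacobi alpha beta P.
Local Notation mm := (mulmat alpha beta P).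
Local Notation a := (jac_a alpha beta).
Local Notation b := (jac_b alpha beta).
Local Notation c := (jac_c alpha beta).
Local Notation d := (jac_d alpha beta).
Local Notation e := (jac_e alpha beta).
Local Notation f := (jac_f alpha beta).
Local Notation g := (jac_g alpha beta).
Local Notation J1 := (smx_tridiag a b).
Local Notation J2 := (smx_tridiag c d).

Local Notation M := (mm (1 - 'X ^+ 2)).
Local Notation JX := (smx_tridiag (fun n => a n - 1) b).

Lemma mulmat_mul_X p : smx_eq (mm ('X * p)) (smx_mul JX (mm p)).
Proof.
move=> i j i0 j0.
have -> : 'X * p = (1 + 'X) * p + (-1) *: p.
  by rewrite -mul_polyC rmorphN rmorph1; ring.
rewrite mulmatD// mulmatZ// mulmat_mul_add// !smx_mul_tridiagE ?jac_b0//; ring.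
Qed.

Let mulmat_XE := mulmat_X alpha_gt beta_gt hP.

Lemma mulmat_sqr_id_sub i j : (0 < i)%N -> (0 < j)%N -> M i j =
  smx_id R i j - (b i.-1 * JX i.-1 j + (a i - 1) * JX i j + b i * JX i.+1 j).
Proof.
move=> i0 j0.
have -> : 1 - 'X ^+ 2 = 1 + (-1) *: ('X * 'X) :> {poly R}.
  by rewrite -mul_polyC rmorphN rmorph1; ring.
rewrite mulmatD// mulmatZ// mulmat1// mulmat_mul_X// mulN1r; congr (_ - _).
have <- := @smx_mul_tridiagE R (fun n => a n - 1) b JX i j (jac_b0 _ _) i0.
by apply: eq_smx_mul => //; exact: mulmat_XE.
Qed.

(** Here the condition number is bounded uniformly: on the diagonal the subtracted squares sum to at
    most 1, and next to it [jac_offdiag_same_sign] excludes severe cancellation. *)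
Lemma jac_sumabs_sqr : exists2 k : R, 0 <= k & forall i j,
  (0 < i)%N -> (0 < j)%N ->
  `|smx_id R i j| + (`|b i.-1 * JX i.-1 j| + `|(a i - 1) * JX i j|
   + `|b i * JX i.+1 j|) <= k * `|M i j|.
Proof.
have [k1 k10 h1] := mulmat_sqr_diag_lower alpha_gt beta_gt hP.
have [k2 k20 h2] := jac_offdiag_same_sign alpha_gt beta_gt.
have k1V : 0 <= 2 / k1 by rewrite divr_ge0// ltW.
have K0 : 0 <= 2 / k1 + k2 + 1 by rewrite !addr_ge0.
have pb := jac_b_ge0 alpha_gt beta_gt.
have off n : b n.+1 * (`|a n.+1 - 1| + `|a n.+2 - 1|) <=
    (2 / k1 + k2 + 1) * `|M n.+1 n.+2|.
  have bn := jac_b_ge0 alpha_gt beta_gt n.+1.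
  rewrite mulmat_sqr_super1// normrM (ger0_norm bn) mulrCA ler_wpM2l//.
  rewrite (le_trans (h2 n))// ler_wpM2r//.
  by rewrite -addrA addrCA lerDl addr_ge0.
exists (2 / k1 + k2 + 1) => // i j i0 j0.
have [far|near] := boolP ((i.+1 < j)%N || (j.+1 < i)%N).
  have /= -> := @sumabs_far R (fun n => a n - 1) b JX i j
    (smx_tridiag_bandwidth _ _) (jac_b0 _ _) i0 j0 far.
  rewrite mulmat_sqr_id_sub// /smx_id.
  have -> : (i == j) = false by lia.
  by rewrite mulr0n normr0 add0r sub0r normrN ler_peMl// lerDr addr_ge0.
have : [\/ i = j, j = i.+1 | i = j.+1].
  have : (i == j) || (j == i.+1) || (i == j.+1) by lia.
  by move=> /orP[/orP[]|] /eqP ->; [constructor 1|constructor 2|constructor 3].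
case=> ij.
- move: ij i0 near => <- {j j0}; case: i => // n _ _.
  apply: (@le_trans _ _ (2 / k1 * `|M n.+1 n.+1|)); last first.
    by rewrite ler_wpM2r// -addrA lerDl addr_ge0.
  have Mp : k1 <= M n.+1 n.+1 := h1 n.
  have M0 := le_trans (ltW k10) Mp; rewrite (ger0_norm M0).
  apply: (@le_trans _ _ 2); last first.
    by rewrite mulrAC ler_pdivlMr// ler_wpM2l.
  have := M0; rewrite mulmat_sqr_id_sub// /smx_id eqxx mulr1n normr1.
  rewrite /= !smx_tridiagE.
  rewrite -!expr2 !(ger0_norm (sqr_ge0 _)).
  by move: ((a _ - 1) ^+ 2) (b n ^+ 2) (b n.+1 ^+ 2) => *; lra.
- rewrite ij; case: i i0 near ij => // n _ _ _.
  apply: le_trans (off n); rewrite /smx_id ltn_eqF//= !smx_tridiagE.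
  rewrite mulr0 !normr0 !add0r (normrM (a n.+1 - 1)) (normrM (b n.+1)).
  by rewrite (ger0_norm (pb n.+1)) mulrDr [`|a n.+1 - 1| * _]mulrC.
- rewrite ij; case: j j0 near ij => // n _ _ _; rewrite mulmatC//.
  apply: le_trans (off n); rewrite /smx_id gtn_eqF//= !smx_tridiagE.
  rewrite mulr0 !normr0 add0r addr0 (normrM (b n.+1)) (normrM (a n.+2 - 1)).
  by rewrite (ger0_norm (pb n.+1)) mulrDr [`|a n.+2 - 1| * _]mulrC.
Qed.

Lemma fl_products_accurate : exists C : R, forall (u : R) (rnd : R -> R),
  is_rounding u rnd ->
  cw_rel_error_le
    (fun i j => if (i == j.+1) || (j == i.+1) then C * (i * j)%:R * u
                else C * u)
    (fl_mul rnd (mm (1 + 'X)) (mm (1 - 'X))) M /\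
  cw_rel_error_le (fun _ _ => C * u) (fl_id_sub_sqr rnd (mm 'X)) M.
Proof.
have [k1 k10 h1] := jac_sumabs_product alpha_gt beta_gt hP; have [k2 k20 h2] := jac_sumabs_sqr.
(* The factors are [2 ^+ 5 - 1] and [2 ^+ 6 - 1]: five roundings for the product, and one more for
   the subtraction from the identity. *)
exists (31 * k1 + 63 * k2) => u rnd hr.
have u0 : 0 <= u by case: hr => /andP[].
have g5 := rounding_growth hr 5; have g6 := rounding_growth hr 6.
have C0 : 0 <= 31 * k1 + 63 * k2 by rewrite addr_ge0// mulr_ge0.
split => i j i0 j0.
- rewrite (eq_fl_mul _ (mulmat_add alpha_gt beta_gt hP) (mulmat_sub alpha_gt beta_gt hP))//.
  have -> : (if (i == j.+1) || (j == i.+1)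
      then (31 * k1 + 63 * k2) * (i * j)%:R * u else (31 * k1 + 63 * k2) * u)
    = (31 * k1 + 63 * k2)
      * (if (i == j.+1) || (j == i.+1) then (i * j)%:R else 1) * u.
    by case: ifP => _; rewrite ?mulr1.
  (* A vanishing entry next to the diagonal admits no relative bound; its exact computation is used
     instead. *)
  have [/andP[near /eqP z]|nz] :=
      boolP (((i == j.+1) || (j == i.+1)) && (M i j == 0)).
    by rewrite (fl_mul_add_sub_zero alpha_gt beta_gt hP hr)// z subrr normr0 mulr0.
  have nz' : (i == j.+1) || (j == i.+1) -> M i j != 0.
    by move=> near; move: nz; rewrite near.
  have := h1 i j i0 j0 nz'; set F := (if _ then _ else _) => hF.
  have F0 : 0 <= F by rewrite /F; case: ifP.
  have [_] := fl_mul_tridiag_approx hr a J2 j (jac_b0 alpha beta) i0.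
  have <- : M i j = b i.-1 * J2 i.-1 j + a i * J2 i j + b i * J2 i.+1 j.
    by rewrite (mulmat_sqrE alpha_gt beta_gt hP)// smx_mul_tridiagE ?jac_b0.
  set X := _ + _ + _ => hX; apply: (le_trans hX).
  apply: (@le_trans _ _ ((2 ^+ 5 - 1) * u * (k1 * F * `|M i j|))).
    apply: ler_pM => //; first by rewrite subr_ge0 exprn_ege1// lerDl.
    by rewrite /X !addr_ge0.
  have -> : (2 ^+ 5 - 1) * u * (k1 * F * `|M i j|) =
      31 * k1 * (F * u * `|M i j|) by ring.
  have -> : (31 * k1 + 63 * k2) * F * u * `|M i j| =
      (31 * k1 + 63 * k2) * (F * u * `|M i j|) by ring.
  by rewrite ler_wpM2r ?mulr_ge0// lerDl mulr_ge0.
rewrite /fl_id_sub_sqr (eq_fl_mul _ mulmat_XE mulmat_XE)//.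
have A := @fl_mul_tridiag_approx R u rnd hr (fun n => a n - 1) b JX i j
  (jac_b0 alpha beta) i0.
have I : fl_approx u 5 (smx_id R i j) (smx_id R i j) `|smx_id R i j|.
  by apply: (approx_weaken hr (leq0n 5)); exact: approx_exact.
have [_ hX] := approx_rnd hr (approxD I (approxN A)).
have h := h2 i j i0 j0; have E := mulmat_sqr_id_sub i0 j0.
set Y := `|smx_id R i j| + _ in hX; set y := rnd _ in hX *.
have {hX} hX : `|y - M i j| <= ((1 + u) ^+ 6 - 1) * Y by rewrite E.
apply: (le_trans hX).
apply: (@le_trans _ _ ((2 ^+ 6 - 1) * u * (k2 * `|M i j|))).
  apply: ler_pM => //; first by rewrite subr_ge0 exprn_ege1// lerDl.
  by rewrite /Y !addr_ge0.
have -> : (2 ^+ 6 - 1) * u * (k2 * `|M i j|) = 63 * k2 * (u * `|M i j|) by ring.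
have -> : (31 * k1 + 63 * k2) * u * `|M i j| =
  (31 * k1 + 63 * k2) * (u * `|M i j|) by ring.
by rewrite ler_wpM2r ?mulr_ge0// lerDr mulr_ge0.
Qed.
End SquaredMatrix.

(** * Assembly: multiplication matrices, rounding errors, Cholesky factor and similarity *)

Theorem theoremB1 (R : realType) (alpha beta gamma delta : R)
    (halpha : -1 < alpha) (hbeta : -1 < beta)
    (hgamma : -1 < gamma) (hdelta : -1 < delta)
    (P : nat -> {poly R}) (hP : is_jacobi alpha beta P) :
  let M1 := mulmat alpha beta P (1 + 'X) in
  let M2 := mulmat alpha beta P (1 - 'X) in
  let X := mulmat alpha beta P 'X in
  let M := mulmat alpha beta P (1 - 'X ^+ 2) in
  let Mplus := mulmat alpha beta P ((1 + 'X) ^+ 2) in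
  let Mminus := mulmat alpha beta P ((1 - 'X) ^+ 2) in
  let S := S_mat alpha beta gamma delta Mplus Mminus M in
  let D := D_mat alpha beta in
  let a := jac_a alpha beta in
  let b := jac_b alpha beta in
  let c := jac_c alpha beta in
  let d := jac_d alpha beta in
  let e := jac_e alpha beta in
  let f := jac_f alpha beta in
  let g := jac_g alpha beta in
  (* the bases of orthonormal and of weighted normalized Jacobi polynomials
     give the same multiplication matrices *)
  (forall (p : {poly R}) (i j : nat), (0 < i)%N -> (0 < j)%N ->
     \int[lebesgue_measure]_(x in `[-1, 1])
       (p.[x] * jacobi_tilde alpha beta P i.-1 x
        * jacobi_tilde alpha beta P j.-1 x * jacobi_weight alpha beta x)
     = mulmat alpha beta P p i j) /\
  (* 1 *)
  smx_eq M1 (smx_tridiag a b) /\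
  (* 2 *)
  smx_eq M2 (smx_tridiag c d) /\
  (* 3 *)
  [/\ smx_eq M (smx_mul M1 M2),
      smx_eq Mplus (smx_mul M1 M1)
    & smx_eq Mminus (smx_mul M2 M2)] /\
  (forall (u : R) (rnd : R -> R), is_rounding u rnd ->
     cw_rel_error_le (fun _ _ => (1 + u) ^+ 5 - 1) (fl_mul rnd M1 M1) Mplus /\
     cw_rel_error_le (fun _ _ => (1 + u) ^+ 5 - 1) (fl_mul rnd M2 M2) Mminus) /\
  (exists C : R, forall (u : R) (rnd : R -> R), is_rounding u rnd ->
     cw_rel_error_le
       (fun i j => if (i == j.+1) || (j == i.+1) then C * (i * j)%:R * u
                   else C * u)
       (fl_mul rnd M1 M2) M /\
     cw_rel_error_le (fun _ _ => C * u) (fl_id_sub_sqr rnd X) M) /\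
  (smx_sym (smx_scale (S_coef_plus alpha gamma) Mplus) /\
   smx_pentadiag (smx_scale (S_coef_plus alpha gamma) Mplus) /\
   smx_sym (smx_scale (S_coef_minus beta delta) Mminus) /\
   smx_pentadiag (smx_scale (S_coef_minus beta delta) Mminus) /\
   smx_sym (smx_scale (S_coef_mid alpha beta gamma delta) M) /\
   smx_pentadiag (smx_scale (S_coef_mid alpha beta gamma delta) M)) /\
  (* 4 and 5 *)
  (exists Rc Ri : smx R, is_cholesky M Rc /\ is_upper_inverse Rc Ri) /\
  forall Rc Ri : smx R, is_cholesky M Rc -> is_upper_inverse Rc Ri ->
    let Rt := smx_tr Rc in
    let Rit := smx_tr Ri in
    (* 4 *)
    (forall n : nat, (0 < n)%N ->
       [/\ M n n = e n ^+ 2 + f (n - 1)%N ^+ 2 + g (n - 2)%N ^+ 2,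
           M n n.+1 = e n * f n + f (n - 1)%N * g (n - 1)%N
         & M n n.+2 = e n * g n]) /\
    smx_eq Rc (smx_upper3 e f g) /\
    [/\ smx_banded Rc, smx_banded Rt, smx_banded D,
        smx_banded (smx_mul Rc Rt)
      & smx_banded (smx_mul (smx_mul Rc D) Rt)] /\
    [/\ smx_upper Ri, ~ smx_banded Ri & smx_rank_structured 2 Ri] /\
    (forall i j : nat, (0 < i)%N ->
       e i * Ri i (i + j)%N + f i * Ri i.+1 (i + j)%N
       + g i * Ri i.+2 (i + j)%N = (j == 0%N)%:R) /\
    (forall n : nat, (0 < n)%N ->
       [/\ Ri n n = jac_inv0 alpha beta n,
           Ri n n.+1 = jac_inv1 alpha beta n
         & Ri n n.+2 = jac_inv2 alpha beta n]) /\
    (* 5 *)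
    let T := smx_mul (smx_mul Rc S) Ri in
    smx_eq (smx_mul (smx_mul Rit S) Rt) T /\
    smx_sym T /\ smx_pentadiag T /\
    (* an upper triangular Q that agrees with the inverse factor on the main
       diagonal and on the first two superdiagonals yields the lower triangle
       of T, hence T by symmetry *)
    (forall Q : smx R, smx_upper Q ->
       (forall i : nat, (0 < i)%N ->
          [/\ Q i i = Ri i i, Q i i.+1 = Ri i i.+1 & Q i i.+2 = Ri i i.+2]) ->
       forall i j : nat, (0 < i)%N -> (0 < j)%N ->
         T i j = smx_mul (smx_mul Rc S) Q (maxn i j) (minn i j)).
Proof.
move=> M1 M2 X M Mplus Mminus S D a b c d e f g.
have [B1 B2 B3] := mulmat_sqr_pentadiag halpha hbeta hP.
have sM p : smx_sym (mulmat alpha beta P p) := mulmat_sym halpha hbeta hP p.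
have scale_sym k A : smx_sym A -> smx_sym (smx_scale k A).
  by move=> sA i j i0 j0; rewrite /smx_tr /smx_scale -sA.
have scale_band k A : smx_pentadiag A -> smx_pentadiag (smx_scale k A).
  by move=> hA i j i0 j0 ij; rewrite /smx_scale hA ?mulr0.
split; first by move=> p i j i0 j0; exact: mulmat_tilde.
split; first exact: mulmat_add.
split; first exact: mulmat_sub.
split; first exact: (mulmat_products halpha hbeta hP).
split.
  move=> u rnd hr; split; first exact: fl_mul_add_sqr.
  exact: fl_mul_sub_sqr.
split; first exact: fl_products_accurate.
split.
  by do !split; try (apply: scale_sym; exact: sM); exact: scale_band.
have chol := mulmat_cholesky halpha hbeta hP.
have e_neq0 n : (0 < n)%N -> e n != 0.
  by case: n => // n _; rewrite lt0r_neq0// jac_e_gt0.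
have g_neq0 n : (0 < n)%N -> g n != 0.
  by case: n => // n _; rewrite ltr0_neq0// jac_g_lt0.
split.
  exists (smx_upper3 e f g), (upper3_inverse e f g); split => //.
  exact: upper3_inverseP.
move=> Rc Ri hRc hRi Rt Rit.
(* Uniqueness of the Cholesky factor transfers every explicit formula to the given [Rc], and with it
   to [Ri]. *)
have RE : smx_eq Rc (smx_upper3 e f g) := cholesky_unique hRc chol.
have hRi' : is_upper_inverse (smx_upper3 e f g) Ri.
  have [uRi I1 I2] := hRi; split => //.
    by apply: smx_eq_trans I1; apply: eq_smx_mul => //; exact: smx_eq_sym.
  by apply: smx_eq_trans I2; apply: eq_smx_mul => //; exact: smx_eq_sym.
have Rc_band : smx_bandwidth 2 Rc.
  exact: smx_bandwidth_eq RE (smx_upper3_bandwidth e f g).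
have Rt_band := smx_bandwidth_tr Rc_band.
have D_band : smx_bandwidth 0 D.
  by move=> i j i0 j0 ij; rewrite /D /D_mat; case: eqP => // ?; lia.
split.
  case=> // n _; rewrite subn1 /=.
  (* In row 1 the truncated subtraction gives index 0, where [g] vanishes; this realizes the
     convention for index -1. *)
  have -> : (n.+1 - 2 = n.-1)%N by lia.
  split.
  - by rewrite /M mulmat_sqr_diag// jac_diag.
  - by rewrite /M mulmat_sqr_super1// jac_offdiag.
  - by rewrite /M mulmat_sqr_super2// -jac_eg.
split => //.
split.
  split; [by exists 2|by exists 2|by exists 0| |].
    by exists (2 + 2)%N; exact: smx_bandwidth_mul.
  exists (2 + 0 + 2)%N; apply: smx_bandwidth_mul => //.
  exact: smx_bandwidth_mul.
split.
  split; first by case: hRi.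
    exact: upper3_inverse_dense hRi' g_neq0.
  exact (upper3_inverse_rank e_neq0 hRi').
split.
  move=> i j i0; rewrite (upper3_inverse_rec hRi')//; last by lia.
  by congr (nat_of_bool _)%:R; lia.
split.
  case=> // n _; rewrite -/e; split.
  - apply: (mulfI (e_neq0 n.+1 isT)); rewrite (upper3_inverse_diag hRi')//.
    by rewrite jac_inv0E// mulfV// e_neq0.
  - apply: (@mulIf _ (e n.+1 * e n.+2)); first by rewrite mulf_neq0 ?e_neq0.
    by rewrite (upper3_inverse_super1 hRi')// jac_inv1_mul.
  - apply: (@mulIf _ (e n.+1 * e n.+2 * e n.+3)).
      by apply: mulf_neq0; [apply: mulf_neq0|]; exact: e_neq0.
    by rewrite (upper3_inverse_super2 hRi')// jac_inv2_mul.
(* [S] is itself multiplication by a polynomial, which gives its symmetry and its commutation with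
   [M]. *)
pose pS : {poly R} := S_coef_plus alpha gamma *: (1 + 'X) ^+ 2
  + S_coef_minus beta delta *: (1 - 'X) ^+ 2
  + S_coef_mid alpha beta gamma delta *: (1 - 'X ^+ 2).
have SE : S = mulmat alpha beta P pS.
  apply/funext => i; apply/funext => j.
  by rewrite /pS !(mulmatD halpha hbeta hP) !(mulmatZ halpha hbeta hP).
have S_sym : smx_sym S by rewrite SE.
have S_band : smx_bandwidth 2 S.
  move=> i j i0 j0 ij; rewrite /S /S_mat.
  by rewrite !scale_band// !addr0.
have MS : smx_eq (smx_mul M S) (smx_mul S M).
  by rewrite SE; exact: mulmat_sqr_commute.
move=> T; split; first exact: cholesky_similarity hRc hRi Rc_band S_band MS.
split; first exact: cholesky_similarity_sym hRc hRi Rc_band S_band S_sym MS.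
split; first exact: cholesky_similarity_pentadiag hRc hRi Rc_band S_band S_sym MS.
exact: cholesky_similarity_three_diagonals hRc hRi Rc_band S_band S_sym MS.
Qed.
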